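(* Let $1<p<\infty$. Let $\Pi\colon\mathbb{R}^m\to\mathbb{R}$ be an $\mathscr{A}$-quasiaffine homogeneous polynomial of degree $p$ with $|\Pi(w)|\le|w|^p$ for all $w\in\mathbb{R}^m$, and let $\alpha>1$. Let $f\colon\mathbb{T}_n\times\mathbb{R}^m\to\mathbb{R}$ be a measurable integrand such that, for constants $\nu>0$, $c\ge0$, $L>0$, for a.e. $x\in\mathbb{T}_n$ and all $w,w'\in\mathbb{R}^m$, $$|w|^p-\alpha\,\Pi(w)\le f(x,w)\le\nu|w|^p+c,$$ $$|f(x,w)-f(x,w')|\le L\,(1+|w|^{p-1}+|w'|^{p-1})\,|w-w'|.$$ Suppose that the differential operator $\mathscr{A}$ satisfies the truncation property (TP) with exponent $p$ and constant $C(\mathscr{A})$. Let $u_0\in\mathbb{R}^m$ and let $u\in L^p(\mathbb{T}_n;\mathbb{R}^m)$ be a minimiser, over $L^p(\mathbb{T}_n;\mathbb{R}^m)$, of $$I'(u)=\begin{cases}\int_{\mathbb{T}_n}f(x,u(x))\,\mathrm{d}x&\text{if }\mathscr{A}u=0\text{ and }\int_{\mathbb{T}_n}u\,\mathrm{d}x=u_0,\\ \infty&\text{else.}\end{cases}$$ Then there is an $\varepsilon_0=\varepsilon_0(L,p,C(\mathscr{A}),\nu+\alpha)>0$ such that $u\in L^{p+\varepsilon}(\mathbb{T}_n;\mathbb{R}^m)$ for all $0<\varepsilon<\varepsilon_0$.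
   Context: $\mathbb{T}_n$ is the $n$-dimensional torus $\mathbb{R}^n/\mathbb{Z}^n$; the dimensions $n,m,l$ are fixed. Measurability of $f$ is understood so that $x\mapsto f(x,v(x))$ is measurable for every measurable $v$. $\mathscr{A}$ is a linear homogeneous constant-coefficient differential operator $\mathscr{A}u=\sum_{|\alpha|=k}A_\alpha\partial^\alpha u$ with linear maps $A_\alpha\colon\mathbb{R}^m\to\mathbb{R}^l$. For $u\in L^p$, the equation $\mathscr{A}u=0$ is understood in the distributional sense: $\int_{\mathbb{T}_n} u\cdot\mathscr{A}^*\varphi\,\mathrm{d}x=0$ for all $\varphi\in C^\infty(\mathbb{T}_n;\mathbb{R}^l)$, where $\mathscr{A}^*\varphi=\sum_{|\alpha|=k}A_\alpha^T\partial^\alpha\varphi$. A measurable, locally bounded function $g\colon\mathbb{R}^m\to\mathbb{R}$ is $\mathscr{A}$-quasiconvex if $g(w)\le\int_{\mathbb{T}_n}g(w+\psi(x))\,\mathrm{d}x$ for all $w\in\mathbb{R}^m$ and all $\psi\in C^\infty(\mathbb{T}_n;\mathbb{R}^m)$ with $\mathscr{A}\psi=0$ and $\int_{\mathbb{T}_n}\psi\,\mathrm{d}x=0$. It is $\mathscr{A}$-quasiaffine if both $g$ and $-g$ are $\mathscr{A}$-quasiconvex. Maximal function: $\mathscr{M}u(x)=\sup_{r>0}\frac{1}{\mathcal{L}^n(B_r(x))}\int_{B_r(x)}|u|\,\mathrm{d}y$, where $u\in L^1(\mathbb{T}_n;\mathbb{R}^m)$ is regarded as a $\mathbb{Z}^n$-periodic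 function on $\mathbb{R}^n$. Truncation property (TP) with exponent $p$: there is a constant $C(\mathscr{A})$ such that for any $u\in L^p(\mathbb{T}_n;\mathbb{R}^m)$ with $\mathscr{A}u=0$ and any $\lambda>0$ there exists $\tilde u\in L^\infty(\mathbb{T}_n;\mathbb{R}^m)$ with $\mathscr{A}\tilde u=0$, $\|\tilde u\|_{L^\infty}\le C(\mathscr{A})\lambda$, and $\{u\neq\tilde u\}\subset\{\mathscr{M}u\ge\lambda\}$ (up to null sets). *)

(* Defs.v *)
From HB Require Import structures.
From mathcomp Require Import all_boot all_order all_algebra.
(* [mpoly] is only required: importing it clashes with the notations of
   MathComp-Analysis. *)
From mathcomp Require mpoly.
From mathcomp Require Import all_classical all_reals all_analysis.

Set Implicit Arguments.
Unset Strict Implicit.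
Unset Printing Implicit Defensive.

Import Order.TTheory GRing.Theory Num.Theory.
Import numFieldNormedType.Exports.

Local Open Scope classical_set_scope.
Local Open Scope ring_scope.

(* R^n is ['rV[R]_n], with the product (= Borel) sigma-algebra. *)

Definition rV_display : measure_display.
Proof. exact: default_measure_display. Qed.

Definition coord {R : realType} {n : nat} (i : 'I_n) (x : 'rV[R]_n) :
  measurableTypeR R := x ord0 i.

Section measurable_rV.
Context {R : realType} (n : nat).

Let rV_set0 : g_sigma_preimage (@coord R n) set0.
Proof. exact: sigma_algebra0. Qed.

Let rV_setC A :
  g_sigma_preimage (@coord R n) A -> g_sigma_preimage (@coord R n) (~` A).
Proof. exact: sigma_algebraC. Qed.

Let rV_bigcup (F : (set 'rV[R]_n)^nat) :
  (forall i, g_sigma_preimage (@coord R n) (F i)) ->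
  g_sigma_preimage (@coord R n) (\bigcup_i (F i)).
Proof. exact: sigma_algebra_bigcup. Qed.

HB.instance Definition _ := @isMeasurable.Build rV_display
  'rV[R]_n (g_sigma_preimage (@coord R n)) rV_set0 rV_setC rV_bigcup.

End measurable_rV.

Lemma measurable_coord {R : realType} n (i : 'I_n) :
  measurable_fun [set: 'rV[R]_n] (coord i).
Proof.
move=> _ Y mY; rewrite setTI; apply: sub_sigma_algebra => /=.
rewrite -bigcup_seq/=; exists i => /=; first by rewrite mem_index_enum.
by exists Y => //; rewrite setTI.
Qed.

Lemma measurable_fun_rV {R : realType} d (T : measurableType d) n
    (f : T -> 'rV[R]_n) :
  (forall i, measurable_fun [set: T] (coord i \o f)) ->
  measurable_fun [set: T] f.
Proof.
move=> mf; suff sub : g_sigma_preimage (fun i => coord i \o f) `<=` measurable.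
  move=> _ A mA; rewrite setTI; apply: sub.
  by rewrite g_sigma_preimage_comp; exists A => //; rewrite setTI.
apply: smallest_sub; first exact: sigma_algebra_measurable.
rewrite -bigcup_seq => A [i _ [B mB <-]]; exact: mf.
Qed.

Section lebesgue_rV.
Context {R : realType}.

Definition rV_rcons n (vt : 'rV[R]_n * measurableTypeR R) : 'rV[R]_n.+1 :=
  \row_i oapp (fun j => vt.1 ord0 j) vt.2 (unlift ord_max i).

Lemma measurable_rV_rcons n : measurable_fun setT (@rV_rcons n).
Proof.
apply: measurable_fun_rV => i.
case: (unliftP ord_max i) => [j|] ->.
  rewrite (_ : _ \o _ = coord j \o fst); last first.
    by apply/funext => vt; rewrite /= /coord mxE liftK.
  exact: (measurableT_comp (measurable_coord j)).
rewrite (_ : _ \o _ = snd) //.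
by apply/funext => vt; rewrite /= /coord mxE unlift_none.
Qed.

(* n-dimensional Lebesgue measure, as an iterated product. *)
Fixpoint lebesgue_rV n : {measure set 'rV[R]_n -> \bar R} :=
  match n return {measure set 'rV[R]_n -> \bar R} with
  | 0 => @dirac _ 'rV[R]_0 0 R
  | n'.+1 => measure_function_pushforward__canonical__measure_function_Measure
      (lebesgue_rV n' \x (@lebesgue_measure R))%E (@measurable_rV_rcons n')
  end.

End lebesgue_rV.

Lemma measurable_box {R : realType} n (A : 'I_n -> set (measurableTypeR R)) :
  (forall i, measurable (A i)) ->
  measurable [set x : 'rV[R]_n | forall i, A i (coord i x)].
Proof.
move=> mA; rewrite (_ : mkset _ = \bigcap_(i in [set: 'I_n]) (coord i @^-1` A i)).
  apply: fin_bigcap_measurable => [|i _]; first exact: finite_finset.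
  by rewrite -[X in measurable X]setTI; exact: (@measurable_coord R n i measurableT _ (mA i)).
by apply/seteqP; split => [x xA i _|x xA i]; [exact: xA|exact: (xA i I)].
Qed.

Lemma lebesgue_rV_box {R : realType} n (A : 'I_n -> set (measurableTypeR R)) :
  (forall i, measurable (A i)) ->
  lebesgue_rV n [set x : 'rV[R]_n | forall i, A i (coord i x)] =
  (\prod_(i < n) lebesgue_measure (A i))%E.
Proof.
elim: n => [|n IHn] in A * => mA.
  by rewrite big_ord0 /= diracE mem_set //=; case.
rewrite big_ord_recr /= /pushforward.
pose B i := A (widen_ord (leqnSn n) i).
rewrite (_ : _ @^-1` _ =
  [set x : 'rV[R]_n | forall i, B i (coord i x)] `*` A ord_max).
  rewrite product_measure1E ?IHn//; first by move=> i; exact: mA.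
  by apply: measurable_box => i; exact: mA.
have liftE (j : 'I_n) : lift ord_max j = widen_ord (leqnSn n) j.
  by apply: val_inj; exact: lift_max.
apply/seteqP; split => [[v t] /= vtA|[v t] /= [vB tA] i].
  split=> [j|]; last by have := vtA ord_max; rewrite /coord mxE unlift_none.
  by have := vtA (lift ord_max j); rewrite /coord mxE liftK liftE.
case: (unliftP ord_max i) => [j|] ->; rewrite /coord mxE ?unlift_none//.
by rewrite liftK liftE; exact: vB.
Qed.

(* Functions on the torus R^n/Z^n are Z^n-periodic functions on R^n; the
   measure of the torus is Lebesgue measure restricted to the unit cube. *)

Definition Zn_periodic {R : realType} n {T : Type} (g : 'rV[R]_n -> T) :=
  forall (x : 'rV[R]_n) (z : 'rV[int]_n), g (x + map_mx intr z) = g x.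

Definition unit_cube {R : realType} n : set 'rV[R]_n :=
  [set x | forall i, x ord0 i \in `[0, 1[].

Lemma measurable_unit_cube {R : realType} n : measurable (@unit_cube R n).
Proof.
by apply: (@measurable_box R n (fun=> `[0, 1[%classic)) => i; exact: measurable_itv.
Qed.

Definition torus_measure {R : realType} n : {measure set 'rV[R]_n -> \bar R} :=
  mrestr (lebesgue_rV n) (@measurable_unit_cube R n).

Lemma torus_measureT {R : realType} n : torus_measure n [set: 'rV[R]_n] = 1%E.
Proof.
rewrite /= /mrestr setTI (@lebesgue_rV_box R n (fun=> `[0, 1[%classic)).
  by rewrite big1// => i _; rewrite lebesgue_measure_itv /= lte01 sube0.
by move=> i; exact: measurable_itv.
Qed.

(* The library's norm on ['rV[R]_n] is the sup norm. *)
Definition enorm {R : realType} n (w : 'rV[R]_n) : R :=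
  Num.sqrt (\sum_i w ord0 i ^+ 2).

Definition eball {R : realType} n (x : 'rV[R]_n) (r : R) : set 'rV[R]_n :=
  [set y | enorm (y - x) < r].

Definition dotrv {R : realType} n (v w : 'rV[R]_n) : R :=
  \sum_i v ord0 i * w ord0 i.

(* Membership in L^p(T_n; R^m), for representatives. *)
Definition in_Lp {R : realType} n m (p : \bar R) (u : 'rV[R]_n -> 'rV[R]_m) :=
  [/\ Zn_periodic u, measurable_fun setT u &
      finite_norm (torus_measure n) p (fun x => enorm (u x))].

Definition torus_mean {R : realType} n m (u : 'rV[R]_n -> 'rV[R]_m) :
  'rV[R]_m := \row_i (\int[torus_measure n]_x u x ord0 i).

Definition maximal_function {R : realType} n m (u : 'rV[R]_n -> 'rV[R]_m)
    (x : 'rV[R]_n) : \bar R :=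
  ereal_sup [set ((lebesgue_rV n (eball x r))^-1 *
      \int[lebesgue_rV n]_(y in eball x r) (enorm (u y))%:E)%E
    | r in `]0, +oo[].

Section smooth.
Context {R : realType} {n m : nat}.
Implicit Type g : 'rV[R]_n -> 'rV[R]_m.

Definition partial (i : 'I_n) g : 'rV[R]_n -> 'rV[R]_m :=
  fun x => 'D_(delta_mx ord0 i) g x.

Definition partials (s : seq 'I_n) g := foldr partial g s.

Definition smooth g := forall s : seq 'I_n,
  continuous (partials s g) /\
  forall i x, derivable (partials s g) x (delta_mx ord0 i).

Definition partial_multi (a : 'I_n -> nat) g :=
  foldr (fun i => iter (a i) (partial i)) g (enum 'I_n).

Definition torus_smooth g := Zn_periodic g /\ smooth g.

End smooth.

Section operator.
Context {R : realType} {n m l k : nat}.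

(* The multi-indices of a homogeneous operator of order k have entries at most
   k.  A family indexed by all such multi-indices is used; only the entries
   with |a| = k occur in the operator. *)
Definition multi_index := {ffun 'I_n -> 'I_k.+1}.

Definition multi_order (a : multi_index) : nat := (\sum_i a i)%N.

(* Linear maps act on row vectors from the right: the map w |-> w *m A a from
   R^m to R^l, whose transpose is v |-> v *m (A a)^T. *)
Implicit Type A : multi_index -> 'M[R]_(m, l).

Definition diffop A (psi : 'rV[R]_n -> 'rV[R]_m) (x : 'rV[R]_n) : 'rV[R]_l :=
  \sum_(a : multi_index | multi_order a == k)
    partial_multi (fun i => a i) psi x *m A a.

Definition diffop_adj A (phi : 'rV[R]_n -> 'rV[R]_l) (x : 'rV[R]_n) :
    'rV[R]_m :=
  \sum_(a : multi_index | multi_order a == k)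
    partial_multi (fun i => a i) phi x *m (A a)^T.

Definition weak_free A (u : 'rV[R]_n -> 'rV[R]_m) :=
  forall phi : 'rV[R]_n -> 'rV[R]_l, torus_smooth phi ->
    (\int[torus_measure n]_x (dotrv (u x) (diffop_adj A phi x))%:E = 0)%E.

Definition quasiconvex A (g : 'rV[R]_m -> R) :=
  [/\ measurable_fun setT g,
      forall w : 'rV[R]_m, bounded_near g (nbhs w) &
      forall (w : 'rV[R]_m) (psi : 'rV[R]_n -> 'rV[R]_m), torus_smooth psi ->
        (forall x, diffop A psi x = 0) -> torus_mean psi = 0 ->
        ((g w)%:E <= \int[torus_measure n]_x (g (w + psi x))%:E)%E].

Definition quasiaffine A (g : 'rV[R]_m -> R) :=
  quasiconvex A g /\ quasiconvex A (fun w => - g w).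

Definition truncation_property A (p C : R) :=
  forall u : 'rV[R]_n -> 'rV[R]_m, in_Lp p%:E u -> weak_free A u ->
  forall lambda : R, 0 < lambda ->
  exists v : 'rV[R]_n -> 'rV[R]_m,
    [/\ in_Lp +oo%E v, weak_free A v,
        (Lnorm (torus_measure n) +oo (fun x => (enorm (v x))%:E)
          <= (C * lambda)%:E)%E &
        {ae torus_measure n, forall x,
          u x <> v x -> (lambda%:E <= maximal_function u x)%E}].

Definition functional A (f : 'rV[R]_n -> 'rV[R]_m -> R) (u0 : 'rV[R]_m)
    (u : 'rV[R]_n -> 'rV[R]_m) : \bar R :=
  (if `[< weak_free A u /\ torus_mean u = u0 >]
   then \int[torus_measure n]_x (f x (u x))%:E else +oo)%E.

Definition is_minimiser A f u0 (p : R) (u : 'rV[R]_n -> 'rV[R]_m) :=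
  in_Lp p%:E u /\
  forall v, in_Lp p%:E v -> (functional A f u0 u <= functional A f u0 v)%E.

End operator.

Arguments multi_index : clear implicits.

(* The exponent is real: unless Pi = 0, it is forced to be a natural number. *)
Definition homogeneous_polynomial {R : realType} m (p : R)
    (Pi : 'rV[R]_m -> R) :=
  exists q : mpoly.mpoly m R,
    (forall a, mpoly.mcoeff a q != 0 -> (mpoly.mdeg a)%:R = p) /\
    forall w, Pi w = mpoly.meval (w ord0) q.

(* Functions that agree almost everywhere with a Borel function are the
   Lebesgue measurable ones. *)
Definition ae_measurable {R : realType} n (g : 'rV[R]_n -> R) :=
  exists2 h : 'rV[R]_n -> R, measurable_fun setT h &
    {ae torus_measure n, forall x, g x = h x}.

Definition measurable_integrand {R : realType} n m
    (f : 'rV[R]_n -> 'rV[R]_m -> R) :=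
  forall v : 'rV[R]_n -> 'rV[R]_m, Zn_periodic v -> measurable_fun setT v ->
    ae_measurable (fun x => f x (v x)).

(* Main.v *)
(* Let v be the truncation of u at height t, with |v| <= C t and u = v off
   E = {M u >= t}.  The field v + (u_0 - mean v) competes with u.  Where u = v the
   Lipschitz bound on f controls the price of the added constant, and on E the
   growth bounds on f leave the null-Lagrangian term alpha (Pi u - Pi v), whose
   integral over the torus is alpha (Pi (mean u) - Pi (mean v)).  Both errors are
   O(t |E| + int_E |u|) with constants depending on u, hence negligible for large
   t against int_E |u|^p and t^p |E|.  With the weak-type bound
   t |E| <= c_n int_{|u| > t/2} |u| this gives, for t large,
     int_{|u| > C t} |u|^p <= K_1 t^(p-1) int_{|u| > t/2} |u|.
   The right-hand side is at most the L^p tail above t/2, and splitting it at a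
   height a t with a^(p-1) >= 2 K_1 fills the hole: the L^p tails phi satisfy
   phi (b s) <= th phi (s) with th < 1, so they decay like a power and
   u is in L^(p + eps) whenever b^eps th < 1.

   The mean-value property of Pi holds for smooth fields by A-quasiaffinity, is
   transferred to bounded A-free fields by convolution with trigonometric
   polynomials, for which all differentiations are algebraic, and to L^p fields by
   truncating at heights tending to infinity. *)

From HB Require Import structures.
Require Import Defs.
From mathcomp Require Import all_boot all_order all_algebra.
From mathcomp Require Import all_classical all_reals all_analysis.
From mathcomp Require Import ring lra measurable_realfun ess_sup_inf.

Set Implicit Arguments.
Unset Strict Implicit.
Unset Printing Implicit Defensive.

Import Order.TTheory GRing.Theory Num.Theory.
Import numFieldNormedType.Exports.

Local Open Scope classical_set_scope.
Local Open Scope ring_scope.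

(** * Periodic integration *)

(** Constants that depend on u, Pi, L or c enter only through the height from which the reverse
    Hölder inequality holds; the decay factor, and with it the exponent, is computed from p, n, [C]
    and [nu + alpha]. This is possible because the errors are linear in D = int_E |u| + C t |E|
    while the main terms carry the power p > 1: Young's inequality moves int_E |u| into int_E |u|^p,
    and t |E| is dominated by t^p |E|.

    Restoring the mean by adding a constant requires constants to be A-free, which is where the
    positive order of the operator enters.

    Half-open cubes replace balls in the covering argument: they tile the space exactly, their
    measure is a product, and those of the rational grids are countable. The convolution kernels are
    normalised powers of prod_i cos (pi y_i)^2. As functions of y - x they are finite sums of
    products of a function of x and a function of y, so a convolution is a finite combination of
    explicit smooth fields and no derivative is ever taken under an integral sign. *)

Definition hbox {R : realType} n (a : 'rV[R]_n) (s : R) : set 'rV[R]_n :=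
  [set x | forall i, a ord0 i <= x ord0 i < a ord0 i + s].

Section translation.
Context {R : realType}.
Local Open Scope ereal_scope.

Lemma ler_coord_norm n (x : 'rV[R]_n) i : (`|x ord0 i| <= `|x|)%R.
Proof.
rewrite [leRHS]/Num.norm /= mx_normrE.
by apply/bigmax_geP; right => /=; exists (ord0, i).
Qed.

Lemma measurable_rV_coords : forall n,
  @measurable _ 'rV[R]_n = g_sigma_preimage (@Defs.coord R n).
Proof. by []. Qed.

Lemma lebesgue_measure_translate (t : R) (A : set (measurableTypeR R)) :
  measurable A ->
  lebesgue_measure ((fun x : measurableTypeR R => (x + t)%R) @^-1` A) =
  lebesgue_measure A.
Proof.
have mt : measurable_fun setT (fun x : measurableTypeR R => (x + t)%R : measurableTypeR R).
  exact: measurable_funD.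
move=> mA; apply/esym.
apply: (@lebesgue_measure_unique R (pushforward lebesgue_measure
  (fun x : measurableTypeR R => (x + t)%R : measurableTypeR R))) => //= X.
move=> /ocitvP[->|[[a b] /= ab ->]]; first by rewrite measure0.
rewrite /pushforward /= (_ : _ @^-1` _ = `](a - t)%R, (b - t)%R]%classic).
  rewrite !lebesgue_measure_itv /= !lte_fin ltrD2r ab.
  by rewrite -!EFinD; congr (_%:E); lra.
by apply/seteqP; split=> x /=; rewrite !in_itv /= ltrBlDr lerBrDr.
Qed.

Lemma measurable_rV_add n (y : 'rV[R]_n) :
  measurable_fun setT (fun x : 'rV[R]_n => (x + y)%R).
Proof.
apply: measurable_fun_rV => i.
rewrite (_ : _ \o _ = fun x => (Defs.coord i x + Defs.coord i y)%R); last first.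
  by apply/funext => x; rewrite /= /Defs.coord mxE.
by apply: measurable_funD => //; exact: measurable_coord.
Qed.

Lemma measurable_hbox n (a : 'rV[R]_n) s : measurable (hbox a s).
Proof.
rewrite (_ : hbox a s = [set x | forall i,
  `[a ord0 i, (a ord0 i + s)%R[%classic (Defs.coord i x)]).
  apply: (@measurable_box R n (fun i => `[a ord0 i, (a ord0 i + s)%R[%classic)).
  by move=> i; exact: measurable_itv.
by apply/seteqP; split=> x /= h i; have := h i; rewrite /= in_itv.
Qed.

Lemma lebesgue_hbox n (a : 'rV[R]_n) s : (0 <= s)%R ->
  lebesgue_rV n (hbox a s) = (s ^+ n)%:E.
Proof.
move=> s0; rewrite (_ : hbox a s = [set x | forall i,
  `[a ord0 i, (a ord0 i + s)%R[%classic (Defs.coord i x)]); last first.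
  by apply/seteqP; split=> x /= h i; have := h i; rewrite /= in_itv.
rewrite (@lebesgue_rV_box R n (fun i => `[a ord0 i, (a ord0 i + s)%R[%classic))
  => [|i]; last exact: measurable_itv.
rewrite (eq_bigr (fun=> s%:E)) => [|i _].
  by rewrite prodEFin prodr_const card_ord.
rewrite lebesgue_measure_itv /= lte_fin ltrDl.
have [s1|s1] := ltP 0%R s; first by rewrite -EFinD addrAC subrr add0r.
by congr (_%:E); apply/eqP; rewrite eq_le s0 s1.
Qed.

Lemma unit_cubeE n : @unit_cube R n = hbox 0 1.
Proof.
by apply/seteqP; split=> x /= h i; have := h i; rewrite in_itv /= mxE add0r.
Qed.

Lemma preimage_hbox n (a y : 'rV[R]_n) s :
  (fun x => (x + y)%R) @^-1` (hbox a s) = hbox (a - y) s.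
Proof.
apply/seteqP; split=> x /= h i; have := h i; rewrite !mxE; lra.
Qed.

(** A generating pi-system on which the product formula determines the measure. *)
Definition rV_boxes n : set (set 'rV[R]_n) :=
  [set B | exists2 A : 'I_n -> set (measurableTypeR R),
     (forall i, measurable (A i)) & B = [set x | forall i, A i (Defs.coord i x)]].

Lemma rV_boxes_gen n : @measurable _ 'rV[R]_n = <<s @rV_boxes n >>.
Proof.
apply/seteqP; split; last first.
  by apply: smallest_sub; [exact: sigma_algebra_measurable|
    move=> _ [A mA ->]; exact: measurable_box].
rewrite measurable_rV_coords; apply: smallest_sub.
  exact: smallest_sigma_algebra.
rewrite -bigcup_seq => _ [i _ [B mB <-]]; apply: sub_sigma_algebra.
exists (fun j => if j == i then B else setT).
  by move=> j; case: ifP => // _; exact: measurableT.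
rewrite setTI; apply/seteqP; split=> x /=.
  by move=> Bx j; case: ifPn => // /eqP ->.
by move=> /(_ i); rewrite eqxx.
Qed.

Lemma rV_boxesI n : setI_closed (@rV_boxes n).
Proof.
move=> _ _ [A mA ->] [B mB ->]; exists (fun i => A i `&` B i).
  by move=> i; exact: measurableI.
by apply/seteqP; split=> x /= => [[Ax Bx] i|AB]; [split|split=> i; have [] := AB i].
Qed.

Lemma bigcup_hbox n :
  \bigcup_k hbox (\row_(i < n) - k%:R)%R (k%:R *+ 2)%R = [set: 'rV[R]_n].
Proof.
apply/seteqP; split=> // x _.
have [k xk] : exists k : nat, (`|x| < k%:R)%R.
  by exists (Num.bound `|x|); apply: archi_boundP.
exists k => // i; rewrite !mxE mulr2n addrA addNr add0r.
have : (`|x ord0 i| <= `|x|)%R by exact: ler_coord_norm.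
by move=> /le_lt_trans /(_ xk); rewrite ltr_norml => /andP[/ltW -> ->].
Qed.

(** Lebesgue measure and its translate agree on boxes by the one-dimensional case, and the cubes
    [-k, k)^n exhaust the space with finite measure. *)
Lemma lebesgue_rV_translate n (y : 'rV[R]_n) (A : set 'rV[R]_n) :
  measurable A ->
  lebesgue_rV n ((fun x => (x + y)%R) @^-1` A) = lebesgue_rV n A.
Proof.
move=> mA.
have mty := @measurable_rV_add n y.
pose m2 := measure_function_pushforward__canonical__measure_function_Measure
  (lebesgue_rV n) mty.
pose g k : set 'rV[R]_n := hbox (\row_(i < n) - k%:R)%R (k%:R *+ 2)%R.
apply/esym.
apply: (measure_unique (@rV_boxes n) g _ _ _ _ (lebesgue_rV n) m2) => //.
- exact: rV_boxes_gen.
- exact: rV_boxesI.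
- move=> k; exists (fun i => `[(- k%:R)%R, (k%:R)%R[%classic).
    by move=> i; exact: measurable_itv.
  by apply/seteqP; split=> x /= h i; have := h i;
    rewrite /= in_itv/= !mxE mulr2n addrA addNr add0r.
- exact: bigcup_hbox.
- move=> _ [B mB ->].
  rewrite [RHS](_ : _ = lebesgue_rV n [set x | forall i,
    ((fun t : measurableTypeR R => (t + y ord0 i)%R) @^-1` B i) (Defs.coord i x)]).
    rewrite lebesgue_rV_box// (@lebesgue_rV_box R n (fun i =>
      (fun t : measurableTypeR R => (t + y ord0 i)%R) @^-1` B i)); last first.
      move=> i; rewrite -[X in measurable X]setTI.
      have mt : measurable_fun setT (fun t : measurableTypeR R =>
          (t + y ord0 i)%R : measurableTypeR R) by exact: measurable_funD.
      exact: mt measurableT _ (mB i).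
    by apply: eq_bigr => i _; rewrite lebesgue_measure_translate.
  rewrite /m2 /= /pushforward; congr (lebesgue_rV n _).
  by apply/seteqP; split=> x /= h i; have := h i; rewrite /Defs.coord mxE.
- by move=> k; rewrite lebesgue_hbox ?ltry// mulrn_wge0.
Qed.

Lemma integral_mrestr d (T : measurableType d) (mu : {measure set T -> \bar R})
    (D : set T) (mD : measurable D) (f : T -> \bar R) :
  measurable_fun setT f -> (forall x, 0 <= f x) ->
  \int[mrestr mu mD]_x f x = \int[mu]_(x in D) f x.
Proof.
move=> mf f0; have mDC := measurableC mD.
rewrite -(setUv D) ge0_integral_setU//; [|by rewrite setUv|by apply/disj_setPCl].
rewrite [X in _ + X](null_set_integral mDC)//; last 2 first.
- exact: measurable_funTS.
- by rewrite /= /mrestr setICl measure0.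
rewrite adde0; apply: eq_measure_integral => A mA AD.
by rewrite /= /mrestr setIidl.
Qed.

Lemma integral_torus n (f : 'rV[R]_n -> \bar R) :
  measurable_fun setT f -> (forall x, 0 <= f x) ->
  \int[torus_measure n]_x f x = \int[lebesgue_rV n]_(x in hbox 0 1) f x.
Proof. by move=> mf f0; rewrite integral_mrestr// unit_cubeE. Qed.

Lemma integral_translate n (y : 'rV[R]_n) (D : set 'rV[R]_n) f :
  measurable D -> measurable_fun setT f -> (forall x, 0 <= f x) ->
  \int[lebesgue_rV n]_(x in (fun x => (x + y)%R) @^-1` D) f (x + y)%R =
  \int[lebesgue_rV n]_(x in D) f x.
Proof.
move=> mD mf f0.
have mty := @measurable_rV_add n y.
rewrite -(ge0_integral_pushforward mty)//; last exact: measurable_funTS.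
apply: eq_measure_integral => A mA _; exact: lebesgue_rV_translate.
Qed.

Definition intrV n (z : 'rV[int]_n) : 'rV[R]_n := map_mx intr z.

Definition floorV n (x : 'rV[R]_n) : 'rV[int]_n := \row_i Num.floor (x ord0 i).

Lemma hbox_floorV n (a x : 'rV[R]_n) (z : 'rV[int]_n) :
  hbox (a + intrV z) 1 x <-> z = floorV (x - a).
Proof.
split=> [h|-> i].
  apply/rowP => i; rewrite !mxE; apply/esym/floor_def.
  by have := h i; rewrite !mxE intrD; lra.
rewrite !mxE; have := @floor_itv R (x ord0 i - a ord0 i)%R.
by rewrite intrD; lra.
Qed.

(** Indexed by [nat] through [pickle_inv], so that countable additivity applies to a sequence;
    numbers that encode no lattice point give the empty cell. The reindexing [f] allows two
    decompositions to be matched term by term. *)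
Definition lattice_cell n (f : 'rV[int]_n -> 'rV[int]_n) (a : 'rV[R]_n) (i : nat) :
    set 'rV[R]_n :=
  if pickle_inv i is Some z then hbox (a + intrV (f z))%R 1 else set0.

Lemma measurable_lattice_cell n f (a : 'rV[R]_n) i :
  measurable (lattice_cell f a i).
Proof.
by rewrite /lattice_cell; case: pickle_inv => // z; exact: measurable_hbox.
Qed.

Lemma trivIset_lattice_cell n f (a : 'rV[R]_n) (D : set 'rV[R]_n) :
  injective f -> trivIset setT (fun i => D `&` lattice_cell f a i).
Proof.
move=> finj i j _ _ [x [[_ +] [_ +]]]; rewrite /lattice_cell.
case Ei : pickle_inv => [z|//]; case Ej : pickle_inv => [w|//].
move=> /hbox_floorV zx /hbox_floorV; rewrite -zx => /finj wz.
have := @pickle_invK 'rV[int]_n i; have := @pickle_invK 'rV[int]_n j.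
by rewrite Ei Ej /= wz => -> ->.
Qed.

Lemma bigcup_lattice_cell n f g (a : 'rV[R]_n) (D : set 'rV[R]_n) :
  cancel g f -> \bigcup_i (D `&` lattice_cell f a i) = D.
Proof.
move=> gf; apply/seteqP; split=> [x [i _ []//]|x Dx].
exists (pickle (g (floorV (x - a)))) => //; split=> //.
by rewrite /lattice_cell pickleK_inv gf; exact/hbox_floorV.
Qed.

Lemma ge0_integral_lattice n f g (a : 'rV[R]_n) (D : set 'rV[R]_n) h :
  injective f -> cancel g f -> measurable D ->
  measurable_fun setT h -> (forall x, 0 <= h x) ->
  \int[lebesgue_rV n]_(x in D) h x =
  \sum_(0 <= i <oo) \int[lebesgue_rV n]_(x in D `&` lattice_cell f a i) h x.
Proof.
move=> finj gf mD mh h0; rewrite -{1}(bigcup_lattice_cell a D gf).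
rewrite ge0_integral_bigcup//.
- by move=> i; apply: measurableI => //; exact: measurable_lattice_cell.
- exact: measurable_funTS.
- exact: trivIset_lattice_cell.
Qed.

Lemma periodicB n (T : Type) (h : 'rV[R]_n -> T) x z :
  Zn_periodic h -> h (x + intrV z)%R = h x.
Proof. by move=> /(_ x z). Qed.

Lemma integral_hbox_periodic n (y : 'rV[R]_n) (h : 'rV[R]_n -> \bar R) :
  measurable_fun setT h -> (forall x, 0 <= h x) -> Zn_periodic h ->
  \int[lebesgue_rV n]_(x in hbox y 1) h x =
  \int[lebesgue_rV n]_(x in hbox 0 1) h x.
Proof.
move=> mh h0 hper.
have mI (a : 'rV[R]_n) f b i : measurable (hbox a 1 `&` lattice_cell f b i).
  by apply: measurableI; [exact: measurable_hbox|exact: measurable_lattice_cell].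
rewrite (@ge0_integral_lattice _ id id 0)//; last exact: measurable_hbox.
(* The piece of [hbox y 1] in the cell z + [0,1)^n, moved by -z, is the piece of the unit cube in y
   - z + [0,1)^n. Indexing the second decomposition by -z therefore matches the summands. *)
pose N (z : 'rV[int]_n) : 'rV[int]_n := (- z)%R.
have -> := @ge0_integral_lattice n N N y (hbox 0 1) h (@oppr_inj _) (@opprK _)
  (measurable_hbox 0 1) mh h0.
apply: eq_eseriesr => i _; rewrite /lattice_cell.
case: pickle_inv => [z|]; last by rewrite !setI0 !integral_set0.
rewrite -(integral_translate (intrV z))//; last first.
  by apply: measurableI; exact: measurable_hbox.
rewrite preimage_setI !preimage_hbox add0r subrr setIC.
rewrite (_ : intrV (N z) = - intrV z)%R; last by apply/rowP => j; rewrite !mxE rmorphN.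
by apply: eq_integral => x _; rewrite periodicB.
Qed.

Lemma integral_torus_translate n (y : 'rV[R]_n) (h : 'rV[R]_n -> \bar R) :
  measurable_fun setT h -> (forall x, 0 <= h x) -> Zn_periodic h ->
  \int[torus_measure n]_x h (x + y)%R = \int[torus_measure n]_x h x.
Proof.
move=> mh h0 hper; rewrite !integral_torus//; last first.
  by apply: measurableT_comp => //; exact: measurable_rV_add.
rewrite -[RHS](integral_hbox_periodic y)//.
have := @integral_translate n y (hbox y 1) h (measurable_hbox _ _) mh h0.
by rewrite preimage_hbox subrr.
Qed.

Lemma integral_hbox_nat n (y : 'rV[R]_n) (N : nat) (h : 'rV[R]_n -> \bar R) :
  measurable_fun setT h -> (forall x, 0 <= h x) -> Zn_periodic h ->
  \int[lebesgue_rV n]_(x in hbox y N%:R) h x <=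
  (N%:R ^+ n)%:E * \int[torus_measure n]_x h x.
Proof.
move=> mh h0 hper; rewrite integral_torus//.
pose c (z : {ffun 'I_n -> 'I_N}) := (y + \row_i (z i)%:R)%R.
have mc z : measurable_fun setT (h \_ (hbox (c z) 1)).
  apply/(measurable_restrictT _ (measurable_hbox _ _)).
  exact: measurable_funTS.
have hc0 z x : 0 <= (h \_ (hbox (c z) 1)) x by rewrite patchE; case: ifP.
(* For an upper bound it suffices to dominate the indicator of the large box by the sum of the
   indicators of N^n unit cubes that cover it. *)
apply: (@le_trans _ _ (\int[lebesgue_rV n]_x \sum_(z : {ffun 'I_n -> 'I_N})
    (h \_ (hbox (c z) 1)) x)).
  rewrite integral_mkcond; apply: ge0_le_integral => //.
  - by move=> x _; rewrite patchE; case: ifP.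
  - apply/(measurable_restrictT _ (measurable_hbox _ _)).
    exact: measurable_funTS.
  - exact: emeasurable_sum.
  move=> x _; rewrite patchE; case: ifPn => [|_]; last by rewrite sume_ge0.
  rewrite inE => xy.
  have zP i : (`|Num.floor (x ord0 i - y ord0 i)%R|%N < N)%N.
    have := xy i => /andP[yx xyN].
    have f0 : (0 <= Num.floor (x ord0 i - y ord0 i)%R)%R by rewrite floor_ge_int; lra.
    rewrite -ltz_nat gez0_abs// floor_lt_int; lra.
  pose z := [ffun i => Ordinal (zP i)].
  rewrite (bigD1 z)//= patchE mem_set ?leeDl ?sume_ge0// => i.
  have := floor_itv (x ord0 i - y ord0 i)%R; rewrite intrD !mxE ffunE /=.
  have f0 : (0 <= Num.floor (x ord0 i - y ord0 i)%R)%R.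
    by have := xy i => /andP[yx xyN]; rewrite floor_ge_int; lra.
  by rewrite natr_absz ger0_norm//; lra.
rewrite ge0_integral_sum//.
rewrite (eq_bigr (fun=> \int[lebesgue_rV n]_(x in hbox 0 1) h x)); last first.
  by move=> z _; rewrite -integral_mkcond integral_hbox_periodic.
rewrite sumr_const card_ffun !card_ord -natrX.
elim: (N ^ n)%N => [|k IH]; first by rewrite mulr0n mul0e.
rewrite mulrS -nat1r EFinD ge0_muleDl ?lee_fin// mul1e leeD2l//.
Qed.

End translation.

(** * The weak-type inequality *)

Section weak_type.
Context {R : realType}.
Local Open Scope ereal_scope.

Definition boxes n (s : seq ('rV[R]_n * R)) : set 'rV[R]_n :=
  \bigcup_(q in [set` s]) hbox q.1 q.2.

Lemma measurable_boxes n (s : seq ('rV[R]_n * R)) : measurable (boxes s).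
Proof.
rewrite /boxes bigcup_seq; apply: bigsetU_measurable => q _.
exact: measurable_hbox.
Qed.

Lemma seq_max_snd (T : eqType) (s : seq (T * R)) : s != [::] ->
  exists2 p, p \in s & forall q, q \in s -> (q.2 <= p.2)%R.
Proof.
elim: s => // a [|b s] IH _.
  by exists a; rewrite ?mem_head// => q; rewrite inE => /eqP ->.
have [//|p ps pmax] := IH.
have [ap|pa] := leP a.2 p.2.
  exists p; first by rewrite inE ps orbT.
  by move=> q; rewrite inE => /predU1P[->//|/pmax].
exists a; first by rewrite mem_head.
by move=> q; rewrite inE => /predU1P[->//|/pmax /le_trans]; apply; exact: ltW.
Qed.

(* Greedy choice of a largest box: its triple covers all the boxes that meet
   it, and the induction applies to the remaining ones. *)
Lemma vitali_boxes n (g : 'rV[R]_n -> \bar R) (k : R) s :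
  measurable_fun setT g -> (forall x, 0 <= g x) ->
  (forall q, q \in s -> (0 < q.2)%R /\
     (k * q.2 ^+ n)%:E <= \int[lebesgue_rV n]_(x in hbox q.1 q.2) g x) ->
  (0 <= k)%R ->
  k%:E * lebesgue_rV n (boxes s) <=
  (3 ^+ n)%:E * \int[lebesgue_rV n]_(x in boxes s) g x.
Proof.
move=> mg g0 + k0; have [N] := ubnP (size s).
elim: N s => // N IH s; rewrite ltnS => sN sP.
have [->|s0] := eqVneq s [::].
  by rewrite /boxes set_nil bigcup_set0 measure0 mule0 mule_ge0// ?lee_fin ?exprn_ge0//
    integral_ge0.
have [p ps pmax] := seq_max_snd s0.
pose t := [seq q <- s | `[< hbox q.1 q.2 `&` hbox p.1 p.2 = set0 >]].
have ts q : q \in t -> q \in s by rewrite mem_filter => /andP[].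
have tN : (size t < N)%N.
  apply: leq_trans sN; rewrite size_filter ltn_neqAle count_size andbT.
  rewrite -all_count; apply/negP => /allP /(_ _ ps)/asboolP.
  have [p0 _] := sP _ ps; rewrite setIid => /seteqP[/(_ p.1) + _].
  by apply => i; rewrite lexx ltrDl.
have {}IH := IH t tN (fun q qt => sP q (ts q qt)).
have [p0 pk] := sP _ ps.
pose p3 := hbox (p.1 - \row_i p.2)%R (p.2 * 3)%R.
have mt := measurable_boxes t; have ms := measurable_boxes s.
have sub3 : boxes s `<=` p3 `|` boxes t.
  move=> x [q /= qs qx].
  have [|H] := pselect (hbox q.1 q.2 `&` hbox p.1 p.2 = set0).
    by move=> H; right; exists q => //=; rewrite mem_filter qs andbT; apply/asboolP.
  left; have /set0P[y [yq yp]] : hbox q.1 q.2 `&` hbox p.1 p.2 != set0.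
    by apply/eqP.
  have := pmax _ qs => qp i; have := yq i; have := yp i; have := qx i.
  by rewrite !mxE; lra.
have tp0 : [disjoint boxes t & hbox p.1 p.2].
  apply/disj_setPS => x [[q /=]]; rewrite mem_filter => /andP[/asboolP H _] qx px.
  by have /seteqP[/(_ x) + _] := H; apply.
have tps : boxes t `|` hbox p.1 p.2 `<=` boxes s.
  by move=> x [[q /= /ts qs qx]|px]; [exists q|exists p].
apply: (@le_trans _ _ (k%:E * (lebesgue_rV n p3 + lebesgue_rV n (boxes t)))).
  rewrite lee_wpmul2l ?lee_fin//.
  have mp3 : measurable p3 by exact: measurable_hbox.
  apply: le_trans (measureU2 (lebesgue_rV n) mp3 mt).
  apply: le_measure => //; rewrite inE//.
  by apply: measurableU => //; exact: measurable_hbox.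
apply: (@le_trans _ _ ((3 ^+ n)%:E *
    \int[lebesgue_rV n]_(x in boxes t `|` hbox p.1 p.2) g x)); last first.
  rewrite lee_wpmul2l ?lee_fin ?exprn_ge0//; apply: ge0_subset_integral => //.
    by apply: measurableU => //; exact: measurable_hbox.
  exact: measurable_funTS.
rewrite ge0_integral_setU//; [|exact: measurable_hbox|exact: measurable_funTS].
rewrite ge0_muleDr//; rewrite ge0_muleDr; [|exact: integral_ge0..].
rewrite [leRHS]addeC leeD//.
have p30 : (0 <= p.2 * 3)%R by lra.
rewrite /p3 lebesgue_hbox// -EFinM.
apply: (@le_trans _ _ ((3 ^+ n)%:E * (k * p.2 ^+ n)%:E)); last first.
  by rewrite lee_wpmul2l// lee_fin exprn_ge0.
by rewrite -EFinM lee_fin exprMn mulrA mulrC.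
Qed.

(** Along an enumeration of [I] the finite subfamilies increase to the whole family, and continuity
    from below carries the finite bound over. The set [W] makes the right-hand side independent of
    the subfamily. *)
Lemma vitali_countable n (g : 'rV[R]_n -> \bar R) (k : R) (W : set 'rV[R]_n)
    (I : countType) (P : set I) (B : I -> 'rV[R]_n * R) :
  measurable_fun setT g -> (forall x, 0 <= g x) -> measurable W ->
  (forall i, P i -> [/\ (0 < (B i).2)%R, hbox (B i).1 (B i).2 `<=` W &
     (k * (B i).2 ^+ n)%:E <= \int[lebesgue_rV n]_(x in hbox (B i).1 (B i).2) g x]) ->
  (0 <= k)%R ->
  let U := \bigcup_(i in P) hbox (B i).1 (B i).2 in
  measurable U /\
  k%:E * lebesgue_rV n U <= (3 ^+ n)%:E * \int[lebesgue_rV n]_(x in W) g x.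
Proof.
move=> mg g0 mW PB k0 U.
pose F N := boxes [seq B i | i <- pmap pickle_inv (iota 0 N) & `[< P i >]].
have mF N : measurable (F N) by exact: measurable_boxes.
have UF : U = \bigcup_N F N.
  apply/seteqP; split=> [x [i Pi xi]|x [N _ [q /= /mapP[i]]]].
    exists (pickle i).+1 => //; exists (B i) => //; apply: map_f.
    rewrite mem_filter mem_pmap; apply/andP; split; first exact/asboolP.
    apply/mapP; exists (pickle i); last by rewrite pickleK_inv.
    by rewrite mem_iota add0n ltnSn.
  by rewrite mem_filter => /andP[/asboolP Pi _] -> xi; exists i.
have mU : measurable U by rewrite UF; exact: bigcup_measurable.
split=> //.
have ndF : {homo F : n m / (n <= m)%N >-> (n <= m)%O}.
  move=> a b ab; apply/subsetPset => x [q /= /mapP[i]].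
  rewrite mem_filter mem_pmap => /andP[Pi /mapP[j jiota ij]] -> xi.
  exists (B i) => //=; apply: map_f.
  rewrite mem_filter Pi mem_pmap /=; apply/mapP; exists j => //.
  by move: jiota; rewrite !mem_iota !add0n => /leq_trans; exact.
have mUF : measurable (\bigcup_N F N) by rewrite -UF.
have Fcvg := nondecreasing_cvg_mu (mu := lebesgue_rV n) mF mUF ndF.
rewrite UF; have kcvg := cvgeZl (y := k%:E) isT Fcvg.
rewrite -(cvg_lim _ kcvg)//; apply: lime_le; first by apply/cvg_ex; eexists; exact: kcvg.
apply: nearW => N /=.
apply: le_trans (vitali_boxes mg g0 _ k0) _.
  move=> q /mapP[i]; rewrite mem_filter => /andP[/asboolP Pi _] ->.
  by have [] := PB _ Pi.
apply: lee_wpmul2l; first by rewrite lee_fin exprn_ge0.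
apply: ge0_subset_integral => //; [exact: mF|exact: measurable_funTS|].
move=> x [q /= /mapP[i]]; rewrite mem_filter => /andP[/asboolP Pi _] -> xi.
by have [_ + _] := PB _ Pi; exact.
Qed.

Lemma coord_le_enorm n (x : 'rV[R]_n) i : (`|x ord0 i| <= enorm x)%R.
Proof.
rewrite -(@ler_pXn2r _ 2) ?nnegrE ?sqrtr_ge0// sqr_sqrtr; last first.
  by apply: sumr_ge0 => j _; exact: sqr_ge0.
rewrite real_normK ?num_real// (bigD1 i)//= lerDl.
by apply: sumr_ge0 => j _; exact: sqr_ge0.
Qed.

Lemma enorm_le_sum n (x : 'rV[R]_n) : (enorm x <= \sum_i `|x ord0 i|)%R.
Proof.
rewrite -(@ler_pXn2r _ 2) ?nnegrE ?sqrtr_ge0 ?sumr_ge0// sqr_sqrtr; last first.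
  by apply: sumr_ge0 => j _; exact: sqr_ge0.
rewrite expr2 mulr_suml; apply: ler_sum => i _.
rewrite -real_normK ?num_real// expr2 ler_wpM2l//.
by rewrite (bigD1 i)//= lerDl sumr_ge0.
Qed.

Lemma measurable_enorm n : measurable_fun setT (@enorm R n).
Proof.
have msqrt : measurable_fun setT (Num.sqrt : R -> R).
  by apply: continuous_measurable_fun; exact: sqrt_continuous.
apply: (measurableT_comp msqrt).
apply: measurable_sum => i; apply: measurable_funX.
exact: measurable_coord.
Qed.

Lemma measurable_eball n (x : 'rV[R]_n) r : measurable (eball x r).
Proof.
rewrite (_ : eball x r = (fun y => enorm (y - x)) @^-1` `]-oo, r[%classic).
  rewrite -[X in measurable X]setTI.
  apply: (measurableT_comp (@measurable_enorm n) (measurable_rV_add (- x))) => //.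
by apply/seteqP; split=> y /=; rewrite in_itv.
Qed.

(** The Euclidean norm is bounded by the sum of n coordinates, each at most r / (n + 1); the
    denominator n + 1 keeps the bound strict and covers n = 0. *)
Lemma sub_hbox_eball n (x : 'rV[R]_n) r : (0 < r)%R ->
  hbox (x - \row_i (r / n.+1%:R))%R (r / n.+1%:R * 2)%R `<=` eball x r.
Proof.
move=> r0 y h; rewrite /eball /=; apply: le_lt_trans (enorm_le_sum _) _.
apply: (@le_lt_trans _ _ (\sum_(i < n) (r / n.+1%:R))%R).
  apply: ler_sum => i _; have := h i; rewrite !mxE ler_norml.
  by move: (r / n.+1%:R)%R => q; lra.
rewrite sumr_const card_ord -[ltLHS]mulr_natr -mulrA gtr_pMr// mulrC.
by rewrite ltr_pdivrMr// mul1r ltr_nat.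
Qed.

Lemma eball_sub_hbox n (x : 'rV[R]_n) r : (0 < r)%R ->
  eball x r `<=` hbox (x - \row_i r)%R (r * 2)%R.
Proof.
move=> r0 y h i; have := le_lt_trans (coord_le_enorm (y - x) i) h.
by rewrite !mxE ltr_norml; lra.
Qed.

(** The leading 4 comes from the average t / 4 that remains after cutting at t / 2. The base 60 (n +
    1) is 4 (n + 1) * 3 * 5: a grid cube of side less than 8 r against the inner cube of side 2 r /
    (n + 1), the tripling in the covering, and the side 5 of the region that contains all the
    cubes. *)
Definition weak_const n : R := 4 * (60 * n.+1%:R) ^+ n.

Lemma weak_const_gt0 n : (0 < weak_const n)%R.
Proof. by rewrite /weak_const mulr_gt0 ?exprn_gt0 ?mulr_gt0 ?ltr0n. Qed.

Definition upper_part (T : Type) (w : T -> R) (t : R) (x : T) : R :=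
  if (t < w x)%R then w x else 0%R.

Lemma measurable_upper_part d (T : measurableType d) (w : T -> R) t :
  measurable_fun setT w -> measurable_fun setT (upper_part w t).
Proof.
move=> mw; apply: measurable_fun_ifT => //.
exact: measurable_fun_ltr.
Qed.

(* Cutting w off at height t/2 lowers its average over the ball by at most t/2;
   the ball contains a cube of side 2 r / (n + 1) and lies in one of side 2 r. *)
Lemma large_average n (w : 'rV[R]_n -> R) (t r : R) (x : 'rV[R]_n) :
  measurable_fun setT w -> (forall y, 0 <= w y)%R -> (0 < t)%R -> (0 < r)%R ->
  ((3 / 4 * t)%R)%:E < (lebesgue_rV n (eball x r))^-1 *
    \int[lebesgue_rV n]_(y in eball x r) (w y)%:E ->
  (t / 4 * (r / n.+1%:R * 2) ^+ n)%:E <=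
    \int[lebesgue_rV n]_(y in hbox (x - \row_i r)%R (r * 2)%R) (upper_part w (t / 2) y)%:E.
Proof.
move=> mw w0 t0 r0.
have mg : measurable_fun setT (fun y => (upper_part w (t / 2) y)%:E).
  by apply/measurable_EFinP; exact: measurable_upper_part.
have g0 y : (0 <= upper_part w (t / 2) y)%R by rewrite /upper_part; case: ifP.
have mB : measurable (eball x r) by exact: measurable_eball.
set B := eball x r in mB *; set b := lebesgue_rV n B => H.
have b_lo : ((r / n.+1%:R * 2) ^+ n)%:E <= b.
  have q0 : (0 <= r / n.+1%:R * 2)%R by rewrite mulr_ge0// divr_ge0// ltW.
  rewrite -(lebesgue_hbox (x - \row_i (r / n.+1%:R))%R q0).
  by apply: le_measure; rewrite ?inE//; [exact: measurable_hbox|exact: sub_hbox_eball].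
have b_hi : b <= ((r * 2) ^+ n)%:E.
  have q0 : (0 <= r * 2)%R by lra.
  rewrite -(lebesgue_hbox (x - \row_i r)%R q0).
  by apply: le_measure; rewrite ?inE//; [exact: measurable_hbox|exact: eball_sub_hbox].
have b_fin : b \is a fin_num.
  by rewrite ge0_fin_numE ?measure_ge0// (le_lt_trans b_hi)// ltry.
have b_gt0 : (0 < fine b)%R.
  rewrite fine_gt0// (lt_le_trans _ b_lo) ?lte_fin ?exprn_gt0 ?mulr_gt0 ?invr_gt0//=.
  by rewrite (le_lt_trans b_hi)// ltry.
have mwE : measurable_fun setT (fun y => (w y)%:E) by exact/measurable_EFinP.
have int_lo : ((3 / 4 * t) * fine b)%:E <= \int[lebesgue_rV n]_(y in B) (w y)%:E.
  move: H; rewrite -(fineK b_fin) inver gt_eqF// => /ltW.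
  by rewrite lee_pdivlMl// -EFinM mulrC.
have int_hi : \int[lebesgue_rV n]_(y in B) (w y)%:E <=
    \int[lebesgue_rV n]_(y in B) (upper_part w (t / 2) y)%:E + (t / 2 * fine b)%:E.
  rewrite EFinM (fineK b_fin) -integral_cst// -ge0_integralD//; first last.
  - by move=> y _; rewrite lee_fin; lra.
  - exact: measurable_funTS.
  - by move=> y _; rewrite lee_fin.
  apply: ge0_le_integral => //.
  - by move=> y _; rewrite lee_fin.
  - exact: measurable_funTS.
  - by apply: emeasurable_funD => //; exact: measurable_funTS.
  move=> y _; rewrite -EFinD lee_fin /upper_part; case: ifPn; rewrite -?leNgt; lra.
apply: (@le_trans _ _ (\int[lebesgue_rV n]_(y in B) (upper_part w (t / 2) y)%:E)).
  apply: (@le_trans _ _ ((t / 4) * fine b)%:E).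
    have t40 : (0 <= t / 4)%R by lra.
    by rewrite lee_fin ler_wpM2l// -lee_fin fineK.
  have := le_trans int_lo int_hi.
  rewrite -leeBlDr// -EFinB; congr (_%:E <= _); lra.
apply: ge0_subset_integral => //; first exact: measurable_hbox.
- exact: measurable_funTS.
- by move=> y _; rewrite lee_fin.
- exact: eball_sub_hbox.
Qed.

(* Passing to cubes of the rational grids leaves only countably many of them,
   so that finite Vitali coverings suffice. *)
Lemma grid_cube n (a : 'rV[R]_n) (s : R) : (0 < s)%R -> (s < 1)%R ->
  exists N (z : 'rV[int]_n), [/\ (0 < N)%N,
    hbox a s `<=` hbox (\row_i ((z ord0 i)%:~R / N%:R))%R (2 / N%:R)%R,
    (2 / N%:R < s * 4)%R &
    forall i, (a ord0 i - 1 < (z ord0 i)%:~R / N%:R <= a ord0 i)%R].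
Proof.
(* N = floor (1 / s) gives s <= 1 / N, so a grid cube of side 2 / N has room for the given cube, and
   1 < s (N + 1) <= 2 s N gives 2 / N < 4 s. *)
move=> s0 s1; pose N := `|Num.floor s^-1|%N.
have f0 : (1 <= Num.floor s^-1)%R by rewrite floor_ge_int invf_ge1// ltW.
have NE : N%:R = (Num.floor s^-1)%:~R :> R.
  by rewrite /N natr_absz ger0_norm// (le_trans _ f0).
have N1 : (1 <= N%:R :> R)%R by rewrite NE -[1%R]/(1%:~R) ler_int.
have := floor_itv s^-1; rewrite -NE intrD -NE => /andP[Nle Ngt].
have N0 : (0 < N%:R :> R)%R by lra.
have sN : (s * N%:R <= 1)%R by rewrite -ler_pdivlMl// mulr1.
have sN2 : (1 < s * (N%:R + 1))%R by rewrite -ltr_pdivrMl// mulr1.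
pose z : 'rV[int]_n := \row_i Num.floor (a ord0 i * N%:R)%R.
have zP i : ((z ord0 i)%:~R / N%:R <= a ord0 i < ((z ord0 i)%:~R + 1) / N%:R)%R.
  have := floor_itv (a ord0 i * N%:R)%R.
  by rewrite !mxE intrD ler_pdivrMr// ltr_pdivlMr.
exists N, z; split.
- by rewrite -(ltr0n R).
- move=> x h i; have := h i; have := zP i; rewrite !mxE.
  rewrite mulrDl mul1r.
  have : (s <= 1 / N%:R)%R by rewrite ler_pdivlMr.
  move: (_%:~R / _)%R => y; rewrite mul1r; move: (N%:R^-1)%R => q; lra.
- rewrite ltr_pdivrMr//; nra.
- move=> i; have := zP i; rewrite mulrDl mul1r.
  have : (N%:R^-1 <= 1 :> R)%R by rewrite invf_le1.
  move: (_%:~R / _)%R => y; move: (N%:R^-1)%R => q; lra.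
Qed.

(** The lower bound on t excludes balls of diameter at least 1, over which the average is controlled
    by the mean of w on the torus. The remaining balls produce rational cubes close to the unit
    cube. The set E is kept arbitrary: in the application it is {u <> v}, which is plainly
    measurable, rather than a superlevel set of the maximal function. *)
Lemma weak_type n (w : 'rV[R]_n -> R) (t : R) (E : set 'rV[R]_n) :
  measurable_fun setT w -> (forall x, 0 <= w x)%R -> Zn_periodic w ->
  \int[torus_measure n]_x (w x)%:E < +oo ->
  (4 * (2 * n.+1%:R) ^+ n * fine (\int[torus_measure n]_x (w x)%:E) < t)%R ->
  measurable E ->
  {ae torus_measure n, forall x, E x -> exists2 r, (0 < r)%R &
    ((3 / 4 * t)%R)%:E < (lebesgue_rV n (eball x r))^-1 *
      \int[lebesgue_rV n]_(y in eball x r) (w y)%:E} ->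
  t%:E * torus_measure n E <=
    (weak_const n)%:E * \int[torus_measure n]_x (upper_part w (t / 2) x)%:E.
Proof.
move=> mw w0 wper wfin tw mE [Z [mZ Z0 EZ]].
set J := fine _ in tw.
have J0 : (0 <= J)%R by rewrite fine_ge0// integral_ge0// => x _; rewrite lee_fin.
have JE : \int[torus_measure n]_x (w x)%:E = J%:E.
  by rewrite fineK// ge0_fin_numE// integral_ge0// => x _; rewrite lee_fin.
have n1 : (0 < n.+1%:R :> R)%R by rewrite ltr0n.
have c0 : (0 < 4 * (2 * n.+1%:R) ^+ n :> R)%R by rewrite mulr_gt0// exprn_gt0// mulr_gt0.
have t0 : (0 < t)%R by apply: le_lt_trans tw; rewrite mulr_ge0// ltW.
pose g x := (upper_part w (t / 2) x)%:E.
have mg : measurable_fun setT g.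
  by apply/measurable_EFinP; exact: measurable_upper_part.
have g0 x : 0 <= g x by rewrite /g /upper_part; case: ifP => //; rewrite lee_fin.
have gw x : g x <= (w x)%:E.
  by rewrite /g /upper_part; case: ifP; rewrite lee_fin.
have gper : Zn_periodic g by move=> x z; rewrite /g /upper_part wper.
have mwE : measurable_fun setT (fun y => (w y)%:E) by exact/measurable_EFinP.
have intg : \int[torus_measure n]_x g x <= J%:E.
  by rewrite -JE; apply: ge0_le_integral.
pose k : R := (t / 4 / (4 * n.+1%:R) ^+ n)%R.
have k0 : (0 < k)%R by rewrite /k !divr_gt0// exprn_gt0// mulr_gt0.
(* [-2, 3)^n: for x in the unit cube and 2 r < 1, the chosen grid cube starts above x - r - 1 and
   has side at most 2. *)
pose W : set 'rV[R]_n := hbox (\row_i (-2))%R 5%:R.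
pose B (i : nat * 'rV[int]_n) : 'rV[R]_n * R :=
  ((\row_j ((i.2 ord0 j)%:~R / i.1%:R))%R, (2 / i.1%:R)%R).
pose P := [set i | [/\ (0 < (B i).2)%R, hbox (B i).1 (B i).2 `<=` W &
     (k * (B i).2 ^+ n)%:E <= \int[lebesgue_rV n]_(x in hbox (B i).1 (B i).2) g x]].
have [mU] := @vitali_countable n g k W _ P B mg g0 (measurable_hbox _ _)
  (fun i Pi => Pi) (ltW k0).
set U := \bigcup_(i in P) _ in mU * => UW.
have EU : E `&` hbox 0 1 `<=` U `|` (Z `&` hbox 0 1).
  move=> x [Ex xQ]; have [Zx|nZx] := pselect (Z x); [by right|left].
  have [r r0 /(large_average mw w0 t0 r0) xr] : exists2 r, (0 < r)%R &
    ((3 / 4 * t)%R)%:E < (lebesgue_rV n (eball x r))^-1 *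
      \int[lebesgue_rV n]_(y in eball x r) (w y)%:E.
    by apply: contrapT => nr; apply: nZx; apply: EZ => /= /(_ Ex).
  have r2 : (r * 2 < 1)%R.
    (* If 2 r >= 1, the cube of side 2 r lies in one of integer side N = floor (2 r) + 1 <= 4 r,
       whose mass is at most N^n J; this contradicts [tw]. *)
    rewrite ltNge; apply/negP => r2.
    pose N := `|(Num.floor (r * 2) + 1)%R|%N.
    have f0 : (0 <= Num.floor (r * 2)%R)%R by rewrite floor_ge_int; lra.
    have NE : N%:R = ((Num.floor (r * 2)%R)%:~R + 1)%R :> R.
      by rewrite /N natr_absz ger0_norm ?intrD// addr_ge0.
    have := floor_itv (r * 2)%R; rewrite intrD -NE => /andP[Nle Ngt].
    have N4 : (N%:R <= r * 4 :> R)%R by lra.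
    have H : (t / 4 * (r / n.+1%:R * 2) ^+ n)%:E <= (N%:R ^+ n * J)%:E.
      apply: (le_trans xr).
      apply: (@le_trans _ _ (\int[lebesgue_rV n]_(y in hbox (x - \row_i r)%R N%:R) g y)).
        apply: ge0_subset_integral => //; try exact: measurable_hbox.
        - exact: measurable_funTS.
        - by move=> y _; exact: g0.
        by move=> y h i; have := h i; rewrite !mxE; lra.
      apply: (le_trans (integral_hbox_nat _ _ mg g0 gper)).
      by rewrite EFinM lee_wpmul2l// lee_fin exprn_ge0.
    move: H; rewrite lee_fin; apply/negP; rewrite -ltNge.
    have q0 : (0 < r / n.+1%:R * 2)%R by rewrite mulr_gt0// divr_gt0.
    apply: (@le_lt_trans _ _ ((r / n.+1%:R * 2) ^+ n * (2 * n.+1%:R) ^+ n * J)%R).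
      rewrite ler_wpM2r// -exprMn.
      rewrite (_ : r / n.+1%:R * 2 * (2 * n.+1%:R) = r * 4)%R; last first.
        by field; rewrite gt_eqF.
      by rewrite lerXn2r// nnegrE; lra.
    rewrite -mulrA [ltRHS]mulrC ltr_pM2l ?exprn_gt0//; lra.
  have [||N [z [N0 sub side zP]]] := @grid_cube n (x - \row_i r)%R (r * 2)%R => //.
    by lra.
  exists (N, z); last first.
    apply: sub => i; rewrite !mxE; lra.
  have N0' : (0 < 2 / N%:R :> R)%R by rewrite divr_gt0// ltr0n.
  split => //=.
    move=> y yB i; have := xQ i; have := zP i; have := yB i; rewrite !mxE.
    have : (2 / N%:R <= 2 :> R)%R.
      by rewrite ler_pdivrMr ?ltr0n// ler_peMr// ler1n.
    move: (_%:~R / _)%R => q; move: (2 / _)%R => s; lra.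
  apply: (@le_trans _ _ (t / 4 * (r / n.+1%:R * 2) ^+ n)%:E).
    rewrite lee_fin /k -!mulrA ler_pM2l// ler_pM2l ?invr_gt0//.
    rewrite ler_pdivrMl ?exprn_gt0 ?mulr_gt0// -exprMn.
    rewrite (_ : 4 * n.+1%:R * (r * (n.+1%:R^-1 * 2)) = r * 2 * 4)%R; last first.
      by field; rewrite gt_eqF.
    by rewrite lerXn2r ?nnegrE// ltW//; lra.
  apply: le_trans xr _; apply: ge0_subset_integral => //; try exact: measurable_hbox.
  - exact: measurable_funTS.
  - by move=> y _; exact: g0.
have torusE : torus_measure n E <= lebesgue_rV n U.
  have mQ : measurable (hbox (0 : 'rV[R]_n) 1) by exact: measurable_hbox.
  have mZQ : measurable (Z `&` hbox 0 1) by exact: measurableI.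
  have ZQ0 : lebesgue_rV n (Z `&` hbox 0 1) = 0.
    by rewrite -unit_cubeE; exact: Z0.
  rewrite -[leRHS]adde0 -ZQ0 /torus_measure /= /mrestr unit_cubeE.
  apply: le_trans (measureU2 (lebesgue_rV n) mU mZQ).
  apply: le_measure; rewrite ?inE//; first exact: measurableI.
  exact: measurableU.
have tE : t = (k * (4 * (4 * n.+1%:R) ^+ n))%R.
  by rewrite /k; field; rewrite expf_neq0// mulf_neq0// gt_eqF.
rewrite {1}tE mulrC EFinM -muleA.
apply: (@le_trans _ _ ((4 * (4 * n.+1%:R) ^+ n)%:E * (k%:E * lebesgue_rV n U))).
  rewrite lee_wpmul2l ?lee_fin ?mulr_ge0 ?exprn_ge0//.
  by rewrite lee_wpmul2l// lee_fin ltW.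
apply: (@le_trans _ _ ((4 * (4 * n.+1%:R) ^+ n)%:E *
    ((3 ^+ n)%:E * ((5%:R ^+ n)%:E * \int[torus_measure n]_x g x)))).
  rewrite lee_wpmul2l ?lee_fin ?mulr_ge0 ?exprn_ge0//.
  apply: (le_trans UW); rewrite lee_wpmul2l ?lee_fin ?exprn_ge0//.
  exact: integral_hbox_nat.
rewrite !muleA -!EFinM /weak_const -!mulrA -!exprMn.
by rewrite (_ : 4 * n.+1%:R * _ = 60 * n.+1%:R)%R//; ring.
Qed.

End weak_type.

(** * Real-valued integrals for a measure of total mass one *)

Section unit_mass.
Import HBNNSimple.
Context d (T : measurableType d) {R : realType} (mu : {measure set T -> \bar R}).
Hypothesis mu1 : (mu setT = 1)%E.
Implicit Types f g : T -> R.

Local Notation L1 f := (mu.-integrable setT (EFin \o f)).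

Lemma integrable_measurable f : L1 f -> measurable_fun setT f.
Proof. by move=> /integrableP[/measurable_EFinP]. Qed.

Lemma integrable_cst_unit c : L1 (fun=> c).
Proof.
apply/integrableP; split; first exact/measurable_EFinP.
by under eq_integral do rewrite /=; rewrite integral_cst// mu1 mule1 ltry.
Qed.

Lemma Rintegral_cst_unit c : \int[mu]_x (fun=> c) x = c.
Proof. by rewrite Rintegral_cst// mu1 mulr1. Qed.

Lemma integrable_dominated f g :
  measurable_fun setT f -> (forall x, `|f x| <= g x) -> L1 g -> L1 f.
Proof.
move=> mf fg; apply: le_integrable => //; first exact/measurable_EFinP.
by move=> x _; rewrite /= lee_fin; apply: le_trans (fg x) (ler_norm _).
Qed.

Lemma integrable_bounded f M :
  measurable_fun setT f -> (forall x, `|f x| <= M) -> L1 f.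
Proof. by move=> mf fM; apply: integrable_dominated fM _ => //; exact: integrable_cst_unit. Qed.

Lemma integrable_add f g : L1 f -> L1 g -> L1 (fun x => f x + g x).
Proof.
by move=> *; rewrite (_ : _ \o _ = ((EFin \o f) \+ (EFin \o g))%E)//; exact: integrableD.
Qed.

Lemma integrable_sub f g : L1 f -> L1 g -> L1 (fun x => f x - g x).
Proof.
by move=> *; rewrite (_ : _ \o _ = ((EFin \o f) \- (EFin \o g))%E)//; exact: integrableB.
Qed.

Lemma integrable_scale c f : L1 f -> L1 (fun x => c * f x).
Proof.
by move=> fL; rewrite (_ : _ \o _ = (fun x => c%:E * (f x)%:E)%E)//; exact: integrableZl.
Qed.

Lemma integrable_abs f : L1 f -> L1 (fun x => `|f x|).
Proof. by move=> fL; exact: (integrable_norm fL). Qed.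

Lemma integrable_bigsum (I : Type) (s : seq I) (P : pred I) (F : I -> T -> R) :
  (forall i, P i -> L1 (F i)) -> L1 (fun x => \sum_(i <- s | P i) F i x).
Proof.
move=> FL; rewrite (_ : _ \o _ = fun x => \sum_(i <- s | P i) (F i x)%:E)%E.
  exact: (integrable_sum measurableT).
by apply/funext => x; rewrite /= -sumEFin.
Qed.

Lemma Rintegral_bigsum (I : Type) (s : seq I) (P : pred I) (F : I -> T -> R) :
  (forall i, P i -> L1 (F i)) ->
  \int[mu]_x (\sum_(i <- s | P i) F i x) = \sum_(i <- s | P i) \int[mu]_x F i x.
Proof.
move=> FL; elim: s => [|i s IH].
  by rewrite big_nil; under eq_Rintegral do rewrite big_nil; rewrite Rintegral_cst// mul0r.
rewrite big_cons -IH; under eq_Rintegral do rewrite big_cons.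
by case: ifPn => // Pi; rewrite RintegralD//; [exact: FL|exact: integrable_bigsum].
Qed.

Lemma EFin_Rintegral f : L1 f -> ((\int[mu]_x f x)%:E = \int[mu]_x (f x)%:E)%E.
Proof. by move=> fL; rewrite /Rintegral fineK//; exact: integrable_fin_num. Qed.

Lemma ae_eq_Rintegral f g : measurable_fun setT f -> measurable_fun setT g ->
  {ae mu, forall x, f x = g x} -> \int[mu]_x f x = \int[mu]_x g x.
Proof.
move=> mf mg fg; congr fine; apply: ae_eq_integral => //.
- exact/measurable_EFinP.
- exact/measurable_EFinP.
by apply: filterS fg => x /= -> _.
Qed.

Lemma ae_le_Rintegral f g : L1 f -> L1 g ->
  {ae mu, forall x, f x <= g x} -> \int[mu]_x f x <= \int[mu]_x g x.
Proof.
move=> fL gL fg; rewrite -subr_ge0 -RintegralB//.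
have mf := integrable_measurable fL; have mg := integrable_measurable gL.
rewrite (@ae_eq_Rintegral _ (fun x => `|g x - f x|)).
- by apply: Rintegral_ge0.
- exact: measurable_funB.
- by apply: measurableT_comp => //; exact: measurable_funB.
by apply: filterS fg => x fgx; rewrite ger0_norm ?subr_ge0.
Qed.

(* Neither f nor g need be measurable: the measure is not complete. *)
Lemma ae_eq_nnintegral (f g : T -> \bar R) :
  (forall x, 0 <= f x)%E -> (forall x, 0 <= g x)%E ->
  {ae mu, forall x, f x = g x} ->
  (\int[mu]_x f x <= \int[mu]_x g x)%E.
Proof.
move=> f0 g0 [N [mN N0 fgN]]; rewrite !ge0_integralTE//.
apply: ge_ereal_sup => _ [h /= hf] <-; apply: ereal_sup_ubound.
(* Setting a simple function below f to zero on a measurable null set puts it below g without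
   changing its integral. *)
pose h' := proj_nnsfun h (measurableC mN).
have h'E x : h' x = if x \in N then 0 else h x.
  rewrite /h' /= mindicE in_setC; case: (x \in N); first by rewrite mulr0.
  by rewrite mulr1.
exists h'.
  move=> x; rewrite h'E; case: ifPn => [_|/negP xN]; first exact: g0.
  have -> : g x = f x; last exact: hf.
  by apply: contrapT => ne; apply: xN; rewrite inE; apply: fgN => /= /esym.
have sE (k : {nnsfun T >-> R}) : (sintegral mu k = \int[mu]_x (k x)%:E)%E.
  by rewrite integral_nnsfun// patch_setT.
rewrite !sE; apply: ge0_ae_eq_integral => //.
- exact/measurable_EFinP.
- exact/measurable_EFinP.
- by move=> x _; rewrite lee_fin.
- by move=> x _; rewrite lee_fin.
exists N; split=> // x; apply: contra_notP => xN _; congr (_%:E); rewrite [LHS]h'E.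
by case: ifPn => //; rewrite inE.
Qed.

(** Meant for x |-> f x (u x), which agrees almost everywhere with a Borel function without having
    to be one. *)
Lemma ae_eq_integral_nonmeasurable (f g : T -> \bar R) :
  {ae mu, forall x, f x = g x} -> (\int[mu]_x f x = \int[mu]_x g x)%E.
Proof.
move=> fg; rewrite integralE [RHS]integralE.
have fgp : {ae mu, forall x, f^\+%E x = g^\+%E x}.
  by apply: filterS fg => x fgx; rewrite !funeposE fgx.
have fgn : {ae mu, forall x, f^\-%E x = g^\-%E x}.
  by apply: filterS fg => x fgx; rewrite !funenegE fgx.
congr (_ - _)%E; apply/eqP; rewrite eq_le; apply/andP; split.
- exact: ae_eq_nnintegral fgp.
- by apply: ae_eq_nnintegral => //; apply: filterS fgp => x /esym.
- exact: ae_eq_nnintegral fgn.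
- by apply: ae_eq_nnintegral => //; apply: filterS fgn => x /esym.
Qed.

End unit_mass.

(** * Continuous functions and derivatives on the torus *)

Section torus_calculus.
Context {R : realType} (n : nat).
Local Notation mu := (torus_measure n).

(** Exhibits an open set as a countable union of cubes, which ties the topology to the product
    sigma-algebra and makes continuous functions measurable. *)
Lemma hbox_grid (O : set 'rV[R]_n) : open O ->
  O = \bigcup_(i in [set i : nat * 'rV[int]_n |
      hbox (\row_j ((i.2 ord0 j)%:~R / i.1.+1%:R)) (i.1.+1%:R^-1) `<=` O])
    hbox (\row_j ((i.2 ord0 j)%:~R / i.1.+1%:R)) (i.1.+1%:R^-1).
Proof.
move=> oO; apply/seteqP; split; last by move=> x [i]; exact.
move=> x Ox; have /nbhs_ballP[e /= e0 eO] : nbhs x O by exact: open_nbhs_nbhs.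
pose N := Num.bound e^-1.
have Ne : N.+1%:R^-1 < e.
  rewrite invf_plt ?posrE ?ltr0n//.
  have e1 : 0 <= e^-1 by rewrite invr_ge0 ltW.
  by apply: lt_trans (archi_boundP e1) _; rewrite ltr_nat.
have N0 : 0 < N.+1%:R :> R by rewrite ltr0n.
pose z : 'rV[int]_n := \row_j Num.floor (x ord0 j * N.+1%:R).
have zx : hbox (\row_j ((z ord0 j)%:~R / N.+1%:R)) (N.+1%:R^-1) x.
  move=> j; have := floor_itv (x ord0 j * N.+1%:R); rewrite !mxE intrD.
  rewrite (_ : _ + N.+1%:R^-1 =
    ((Num.floor (x ord0 j * N.+1%:R))%:~R + 1) / N.+1%:R); last first.
    by rewrite mulrDl mul1r.
  by rewrite ler_pdivrMr// ltr_pdivlMr.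
exists (N, z) => //= y yz; apply: eO; split=> // i j; rewrite ord1.
apply: lt_trans Ne => /=; have := zx j; have := yz j; rewrite !mxE ltr_norml.
by move: (_%:~R / _) => a; move: (_^-1) => b; lra.
Qed.

Lemma open_measurable_rV (O : set 'rV[R]_n) : open O -> measurable O.
Proof.
move=> /hbox_grid ->; rewrite bigcup_mkcond.
apply: countable_bigcupT_measurable => [|i]; first exact: countableP.
by case: ifP => // _; exact: measurable_hbox.
Qed.

Lemma continuous_measurable_rV (g : 'rV[R]_n -> R) :
  continuous g -> measurable_fun setT g.
Proof.
move=> cg; apply: (measurability (@RGenOpens.G R)).
  exact: RGenOpens.measurableE.
move=> _ [_ [a [b ->]] <-]; rewrite setTI; apply: open_measurable_rV.
by apply: open_comp; [move=> x _; exact: cg|exact: interval_open].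
Qed.

Lemma continuous_periodic_bounded (g : 'rV[R]_n -> R) :
  continuous g -> Zn_periodic g -> exists M, forall x, `|g x| <= M.
Proof.
move=> cg gper.
have cK : compact [set v : 'rV[R]_n | forall i, `[0, 1]%classic (v ord0 i)].
  by apply: (@rV_compact R n (fun=> `[0, 1]%classic)) => i; exact: segment_compact.
have /compact_bounded [M [_ /(_ (M + 1))]] := continuous_compact (continuous_subspaceT cg) cK.
rewrite ltrDl ltr01 => /(_ isT) gM; exists (M + 1) => x.
have -> : g x = g (x - intrV (floorV x)).
  by rewrite -[in LHS](subrK (intrV (floorV x)) x) periodicB.
apply: gM; exists (x - intrV (floorV x)) => //= i.
have := floor_itv (x ord0 i); rewrite in_itv/= !mxE intrD; lra.
Qed.

Lemma integral_torus_translateR (y : 'rV[R]_n) (g : 'rV[R]_n -> R) :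
  measurable_fun setT g -> Zn_periodic g ->
  \int[mu]_x g (x + y) = \int[mu]_x g x.
Proof.
move=> mg gper; congr fine; rewrite integralE [RHS]integralE.
have mE : measurable_fun setT (EFin \o g) by exact/measurable_EFinP.
have pper : Zn_periodic ((EFin \o g)^\+)%E by move=> x z; rewrite !funeposE /= gper.
have nper : Zn_periodic ((EFin \o g)^\-)%E by move=> x z; rewrite !funenegE /= gper.
congr (_ - _)%E.
- rewrite -(integral_torus_translate y (measurable_funepos mE) _ pper)//.
  by apply: eq_integral => x _; rewrite !funeposE.
- rewrite -(integral_torus_translate y (measurable_funeneg mE) _ nper)//.
  by apply: eq_integral => x _; rewrite !funenegE.
Qed.

Lemma derive_line (V : normedModType R) (g : 'rV[R]_n -> V) (x v : 'rV[R]_n) (t : R) :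
  derivable g (x + t *: v) v ->
  is_derive t 1 (fun s => g (x + s *: v)) ('D_v g (x + t *: v)).
Proof.
have E : (fun h : R => h^-1 *: (((fun s => g (x + s *: v)) \o shift t) (h *: 1)
    - g (x + t *: v))) = fun h => h^-1 *: ((g \o shift (x + t *: v)) (h *: v) - g (x + t *: v)).
  apply/funext => h /=; congr (_ *: (g _ - _)).
  by rewrite [_ *: 1]mulr1 scalerDl addrCA.
by move=> dg; split; rewrite /derivable /derive E.
Qed.

Lemma periodic_derive (V : normedModType R) (g : 'rV[R]_n -> V) v :
  Zn_periodic g -> Zn_periodic (fun x => 'D_v g x).
Proof.
move=> gper x z.
have E : (fun h : R => h^-1 *: ((g \o shift (x + map_mx intr z)) (h *: v)
    - g (x + map_mx intr z))) = fun h => h^-1 *: ((g \o shift x) (h *: v) - g x).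
  by apply/funext => h /=; rewrite addrA !gper.
by rewrite /derive E.
Qed.

(** Difference quotients have integral zero by translation invariance, and the mean value theorem
    bounds them uniformly by the supremum of the derivative; dominated convergence does the rest. No
    iterated integral or boundary term appears. *)
Lemma integral_derive0 (g : 'rV[R]_n -> R) (v : 'rV[R]_n) :
  continuous g -> Zn_periodic g -> (forall x, derivable g x v) ->
  continuous (fun x => 'D_v g x) ->
  \int[mu]_x 'D_v g x = 0.
Proof.
move=> cg gper dg cdg.
have mg := continuous_measurable_rV cg.
have mdg := continuous_measurable_rV cdg.
have [M dgM] := continuous_periodic_bounded cdg (periodic_derive v gper).
have [M' gM] := continuous_periodic_bounded cg gper.
have mu1 : (mu setT = 1)%E := @torus_measureT R n.
pose h k : R := k.+1%:R^-1.
have h0 k : 0 < h k by rewrite invr_gt0 ltr0n.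
pose q k (x : 'rV[R]_n) := (h k)^-1 * (g (x + h k *: v) - g x).
have mgs k : measurable_fun setT (fun x : 'rV[R]_n => g (x + h k *: v)).
  by apply: measurableT_comp => //; exact: measurable_rV_add.
have mq k : measurable_fun setT (q k).
  by apply: measurable_funM => //; exact: measurable_funB.
have qM k x : `|q k x| <= M.
  have [|||c _ E] := @MVT R (fun s => g (x + s *: v)) (fun s => 'D_v g (x + s *: v)) 0 (h k) => //.
  - by move=> s _; exact: derive_line.
  - apply: continuous_subspaceT => s; apply: continuous_comp; last exact: cg.
    apply: continuousD; first exact: cst_continuous.
    exact: scalel_continuous.
  rewrite /q; move: E; rewrite scale0r addr0 subr0 => ->.
  by rewrite mulrCA mulVf ?gt_eqF// mulr1.
have qcvg x : q ^~ x @ \oo --> 'D_v g x.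
  have h_cvg : h @ \oo --> 0^'.
    move=> B nB; have H : \forall k \near \oo, h k != 0 -> B (h k) := cvg_harmonic nB.
    suff : \forall k \near \oo, B (h k) by [].
    by apply: filterS H => k; apply; rewrite gt_eqF.
  have dgx : h^-1 *: ((g \o shift x) (h *: v) - g x) @[h --> 0^'] --> 'D_v g x := dg x.
  have := cvg_comp _ _ h_cvg dgx.
  apply: cvg_trans; apply: near_eq_cvg; apply: nearW => k /=.
  by rewrite /q [x + _]addrC.
have q0 k : (\int[mu]_x (q k x)%:E = 0)%E.
  have gL : mu.-integrable setT (EFin \o g) by exact: integrable_bounded gM.
  have gsL : mu.-integrable setT (EFin \o fun x : 'rV[R]_n => g (x + h k *: v)).
    by apply: (integrable_bounded mu1 (mgs k)) => x; exact: gM.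
  rewrite -EFin_Rintegral; last by apply: integrable_scale; exact: integrable_sub.
  rewrite RintegralZl//; last exact: integrable_sub.
  by rewrite RintegralB// integral_torus_translateR// subrr mulr0.
have ML : mu.-integrable setT (fun=> M%:E) by exact: integrable_cst_unit.
have : (\int[mu]_x (q k x)%:E)%E @[k --> \oo] --> (\int[mu]_x ('D_v g x)%:E)%E.
  apply: (@dominated_cvg _ _ _ mu setT measurableT (fun k x => (q k x)%:E)
    (fun x => ('D_v g x)%:E) (fun=> M%:E)) => //.
  - by move=> k; exact/measurable_EFinP.
  - by move=> x _; apply: cvg_EFin => //; [exact: nearW|exact: qcvg].
  - by move=> k x _; rewrite lee_fin.
rewrite (_ : (fun k => _) = fun=> 0%E); last by apply/funext => k; exact: q0.
move=> /(cvg_unique _ (cvg_cst 0%E)) dc.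
by rewrite /Rintegral -dc.
Qed.

End torus_calculus.

(** * Weakly A-free fields *)

Section weak_free.
Context {R : realType} {n m l k : nat}.
Local Notation mu := (@torus_measure R n).
Implicit Type A : multi_index n k -> 'M[R]_(m, l).

(** Translates a multi-index into a list of directions, the form in which [smooth] provides iterated
    derivatives. *)
Definition index_seq (a : 'I_n -> nat) : seq 'I_n :=
  flatten [seq nseq (a i) i | i <- enum 'I_n].

Lemma partial_multiE p (a : 'I_n -> nat) (g : 'rV[R]_n -> 'rV[R]_p) :
  partial_multi a g = partials (index_seq a) g.
Proof.
rewrite /partial_multi /index_seq; elim: (enum 'I_n) => //= i s ->.
by rewrite /partials foldr_cat; elim: (a i) => //= b ->.
Qed.

Lemma size_index_seq (a : 'I_n -> nat) : size (index_seq a) = (\sum_i a i)%N.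
Proof.
rewrite /index_seq size_flatten /shape -map_comp sumnE big_map big_enum /=.
by apply: eq_bigr => i _; rewrite size_nseq.
Qed.

Lemma partials_periodic p s (g : 'rV[R]_n -> 'rV[R]_p) :
  Zn_periodic g -> Zn_periodic (partials s g).
Proof. by move=> gper; elim: s => //= i s IH; exact: periodic_derive. Qed.

Lemma partials_coord_continuous p (g : 'rV[R]_n -> 'rV[R]_p) s j :
  smooth g -> continuous (fun x => partials s g x ord0 j).
Proof.
move=> /(_ s)[cg _] x.
apply: (@continuous_comp _ _ _ (partials s g) (fun w : 'rV[R]_p => w ord0 j)).
  exact: cg.
exact: coord_continuous.
Qed.

Lemma partials_coord_measurable p (g : 'rV[R]_n -> 'rV[R]_p) s j :
  smooth g -> measurable_fun setT (fun x => partials s g x ord0 j).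
Proof. by move=> sg; apply: continuous_measurable_rV; exact: partials_coord_continuous. Qed.

Lemma partials_coord_bounded p (g : 'rV[R]_n -> 'rV[R]_p) s j :
  torus_smooth g -> exists M, forall x, `|partials s g x ord0 j| <= M.
Proof.
move=> [gper sg]; apply: continuous_periodic_bounded.
  exact: partials_coord_continuous.
by move=> x z; rewrite partials_periodic.
Qed.

Lemma integral_partials0 p (g : 'rV[R]_n -> 'rV[R]_p) s j :
  torus_smooth g -> s != [::] -> \int[mu]_x partials s g x ord0 j = 0.
Proof.
move=> [gper sg]; case: s => // i s _.
have dg x : derivable (partials s g) x (delta_mx ord0 i) := (sg s).2 i x.
have E : (fun x => partials (i :: s) g x ord0 j) =
    fun x => 'D_(delta_mx ord0 i) (fun y => partials s g y ord0 j) x.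
  by apply/funext => x /=; rewrite /partial derive_mx// mxE.
rewrite E; apply: integral_derive0.
- exact: partials_coord_continuous.
- by move=> x z; rewrite partials_periodic.
- by move=> x; have /derivable_mxP := dg x; exact.
- by rewrite -E; exact: partials_coord_continuous.
Qed.

Local Notation ixs a := (index_seq (fun i => nat_of_ord (a i))).

Lemma dotrv_diffop_adj A (w : 'rV[R]_m) (phi : 'rV[R]_n -> 'rV[R]_l) x :
  dotrv w (diffop_adj A phi x) =
  \sum_(a : multi_index n k | multi_order a == k) \sum_(i < m) \sum_(j < l)
    A a i j * (w ord0 i * partials (ixs a) phi x ord0 j).
Proof.
rewrite /dotrv /diffop_adj exchange_big /=; apply: eq_bigr => i _.
rewrite summxE mulr_sumr; apply: eq_bigr => a _.
rewrite mxE mulr_sumr; apply: eq_bigr => j _.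
by rewrite partial_multiE mxE; ring.
Qed.

Lemma diffop_adj_integrable A (u : 'rV[R]_n -> 'rV[R]_m) phi :
  (forall i, mu.-integrable setT (EFin \o fun x => u x ord0 i)) ->
  torus_smooth phi ->
  mu.-integrable setT (EFin \o fun x => dotrv (u x) (diffop_adj A phi x)).
Proof.
move=> uL sphi; under [fun x => dotrv _ _]eq_fun do rewrite dotrv_diffop_adj.
apply: integrable_bigsum => a _; apply: integrable_bigsum => i _.
apply: integrable_bigsum => j _; apply: integrable_scale.
have [M phiM] := partials_coord_bounded (ixs a) j sphi.
have uiL := uL i.
apply: (integrable_dominated _ _ (integrable_scale M (integrable_abs uiL))).
  apply: measurable_funM; first exact: integrable_measurable.
  by apply: partials_coord_measurable; case: sphi.
by move=> x; rewrite normrM mulrC ler_wpM2r.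
Qed.

(** A derivative of positive order of a test field has mean zero. In order zero the operator is a
    matrix, which may fail to annihilate constants. *)
Lemma weak_free_cst A (c : 'rV[R]_m) : (0 < k)%N -> weak_free A (fun=> c).
Proof.
move=> k0 phi sphi; have mu1 := @torus_measureT R n.
rewrite -EFin_Rintegral; last first.
  by apply: (@diffop_adj_integrable A (fun=> c)) => // i; exact: integrable_cst_unit.
under eq_Rintegral do rewrite dotrv_diffop_adj.
have phiL a i j : mu.-integrable setT
    (EFin \o fun x => c ord0 i * partials (ixs a) phi x ord0 j).
  have [M phiM] := partials_coord_bounded (ixs a) j sphi.
  apply: integrable_scale; apply: (integrable_bounded mu1 _ phiM).
  by apply: partials_coord_measurable; case: sphi.
rewrite Rintegral_bigsum; last first.
  by do 2 (move=> *; apply: integrable_bigsum); move=> *; exact: integrable_scale.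
rewrite big1// => a /eqP ak.
rewrite Rintegral_bigsum; last first.
  by move=> *; apply: integrable_bigsum => *; exact: integrable_scale.
rewrite big1// => i _.
rewrite Rintegral_bigsum; last by move=> *; exact: integrable_scale.
rewrite big1// => j _.
have [M phiM] := partials_coord_bounded (ixs a) j sphi.
rewrite RintegralZl// RintegralZl//; last first.
  apply: (integrable_bounded mu1 _ phiM).
  by apply: partials_coord_measurable; case: sphi.
rewrite integral_partials0 ?mulr0//.
by rewrite -size_eq0 size_index_seq -/(multi_order a) ak -lt0n.
Qed.

Lemma weak_free_add A (u v : 'rV[R]_n -> 'rV[R]_m) :
  (forall i, mu.-integrable setT (EFin \o fun x => u x ord0 i)) ->
  (forall i, mu.-integrable setT (EFin \o fun x => v x ord0 i)) ->
  weak_free A u -> weak_free A v -> weak_free A (fun x => u x + v x).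
Proof.
move=> uL vL fu fv phi sphi.
have uphi := diffop_adj_integrable A uL sphi.
have vphi := diffop_adj_integrable A vL sphi.
rewrite -[RHS]adde0 -{1}(fu _ sphi) -(fv _ sphi) -integralD//.
apply: eq_integral => x _; rewrite -EFinD; congr (_%:E).
by rewrite /dotrv -big_split; apply: eq_bigr => i _; rewrite mxE mulrDl.
Qed.

End weak_free.

Lemma ereal_cvg_lt {R : realType} (u : (\bar R)^nat) (l r : \bar R) :
  u @ \oo --> l -> (l < r)%E -> exists N, forall k, (N <= k)%N -> (u k < r)%E.
Proof.
move=> ul lr; have : nbhs l [set y | (y < r)%E].
  by apply: open_nbhs_nbhs; split => //; exact: open_ereal_lt_ereal.
by move=> /ul [N _ NP]; exists N => k Nk; exact: NP.
Qed.

(** * Mollification *)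

Section translation_continuity.
Context {R : realType} (n : nat).
Local Notation mu := (@torus_measure R n).

Definition shift_diff (A : set 'rV[R]_n) (y : 'rV[R]_n) : set 'rV[R]_n :=
  [set x | ~ (A (x + y) <-> A x)].

Lemma shift_diffE A y : shift_diff A y =
  (((fun x => x + y) @^-1` A) `\` A) `|` (A `\` ((fun x => x + y) @^-1` A)).
Proof.
apply/seteqP; split=> x; rewrite /shift_diff /=; last by tauto.
by have [|] := pselect (A x); have [|] := pselect (A (x + y)); tauto.
Qed.

Lemma measurable_shift A (y : 'rV[R]_n) : measurable A ->
  measurable ((fun x => x + y) @^-1` A).
Proof. by move=> mA; rewrite -[X in measurable X]setTI; exact: measurable_rV_add. Qed.

Lemma measurable_shift_diff A y : measurable A -> measurable (shift_diff A y).
Proof.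
move=> mA; have mS := measurable_shift y mA; rewrite shift_diffE.
by apply: measurableU; exact: measurableD.
Qed.

(** Continuity in L^1 of the translates of an indicator. The sets with this property form a
    sigma-algebra that contains the coordinate half-spaces, hence all measurable sets; this replaces
    the density of continuous functions. *)
Definition shift_continuous (A : set 'rV[R]_n) := measurable A /\
  forall e : R, 0 < e -> exists2 d : R, 0 < d & forall y : 'rV[R]_n,
    (forall i, `|y ord0 i| < d) -> (mu (shift_diff A y) <= e%:E)%E.

Lemma shift_continuousC A : shift_continuous A -> shift_continuous (~` A).
Proof.
move=> [mA cA]; split=> [|e /cA[d d0 dA]]; first exact: measurableC.
exists d => // y /dA; congr (mu _ <= _)%E; apply/seteqP.
by split=> x; rewrite /shift_diff /=; [|have := pselect (A x); have := pselect (A (x + y))]; tauto.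
Qed.

Lemma shift_continuousU A B :
  shift_continuous A -> shift_continuous B -> shift_continuous (A `|` B).
Proof.
move=> [mA cA] [mB cB]; split=> [|e e0]; first exact: measurableU.
have e2 : 0 < e / 2 by rewrite divr_gt0.
have [d d0 dA] := cA _ e2; have [d' d'0 dB] := cB _ e2.
exists (Num.min d d'); first by rewrite lt_min d0.
move=> y yd; have mDA := measurable_shift_diff y mA.
have mDB := measurable_shift_diff y mB.
apply: (@le_trans _ _ (mu (shift_diff A y `|` shift_diff B y))).
  apply: le_measure; rewrite ?inE//; last 2 first.
  - exact: measurableU.
  - move=> x; rewrite /shift_diff /=.
    case: (pselect (A x <-> A (x + y))) => [HA|]; last by tauto.
    by case: (pselect (B x <-> B (x + y))) => [HB|]; tauto.
  by apply: measurable_shift_diff; exact: measurableU.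
apply: le_trans (measureU2 _ mDA mDB) _; rewrite (splitr e) EFinD leeD//.
- by apply: dA => i; have := yd i; rewrite lt_min => /andP[].
- by apply: dB => i; have := yd i; rewrite lt_min => /andP[].
Qed.

(** A finite partial union has the property, and the rest of the union is small in measure.
    Membership in the union can change under the shift only if it changes for the partial union or
    if one of the two points lies in the rest, hence the three thirds of e. *)
Lemma shift_continuous_bigcup (F : (set 'rV[R]_n)^nat) :
  (forall i, shift_continuous (F i)) -> shift_continuous (\bigcup_i F i).
Proof.
move=> cF; set A := \bigcup_i F i.
have mA : measurable A by apply: bigcup_measurable => i _; have [] := cF i.
split=> // e e0.
pose B J := \big[setU/set0]_(j < J) F j.
have cB J : shift_continuous (B J).
  rewrite /B; elim: J => [|J IH].
    rewrite big_ord0; split=> // d d0; exists 1 => // y _.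
    rewrite (_ : shift_diff _ _ = set0) ?measure0 ?lee_fin ?ltW//.
    by apply/seteqP; split=> x //; rewrite /shift_diff /=; tauto.
  by rewrite big_ord_recr; apply: shift_continuousU.
(* [-1, 2)^n also contains the points of the unit cube shifted by less than 1, and its finite
   measure permits continuity from above. *)
pose W : set 'rV[R]_n := hbox (\row_i (-1)) 3.
pose C J := (A `\` B J) `&` W.
have mW : measurable W by exact: measurable_hbox.
have mAB J : measurable (A `\` B J) by apply: measurableD => //; have [] := cB J.
have mC J : measurable (C J) by exact: measurableI.
have BA J : B J `<=` A.
  by rewrite /B => x; rewrite -bigcup_mkord => -[j _ Fj]; exists j.
have C_cvg : lebesgue_rV n (C J) @[J --> \oo] --> 0%E.
  have <- : lebesgue_rV n (\bigcap_J C J) = 0%E.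
    rewrite (_ : \bigcap_J C J = set0) ?measure0//.
    apply/seteqP; split=> // x Cx; have [[[j _ Fj] _] _] := Cx 0 I.
    have [[_ +] _] := Cx j.+1 I; apply.
    by rewrite /B -bigcup_mkord; exists j => /=.
  apply: nonincreasing_cvg_mu => //.
  - apply: le_lt_trans (_ : _ <= lebesgue_rV n W)%E _; last by rewrite lebesgue_hbox// ltry.
    by apply: le_measure; rewrite ?inE// => x [].
  - exact: bigcap_measurable.
  - move=> a b ab; apply/subsetPset => x [[Ax nB] Wx]; split=> //; split=> // Bx.
    apply: nB; move: Bx; rewrite /B -!bigcup_mkord => -[j /= ja Fj].
    by exists j => //=; exact: leq_trans ab.
have e3 : 0 < e / 3 by rewrite divr_gt0.
have [J CJ] : exists J, (lebesgue_rV n (C J) <= (e / 3)%:E)%E.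
  have [J JP] := @ereal_cvg_lt _ _ _ (e / 3)%:E C_cvg ltac:(by rewrite lte_fin).
  by exists J; exact: ltW (JP _ (leqnn _)).
have [d d0 dB] := (cB J).2 _ e3.
exists (Num.min d 1); first by rewrite lt_min d0 ltr01.
move=> y yd.
have mDB := measurable_shift_diff y (cB J).1.
have mAy := measurable_shift y (mAB J).
apply: (@le_trans _ _ (mu (shift_diff (B J) y `|` (A `\` B J) `|`
    (fun x => x + y) @^-1` (A `\` B J)))).
  apply: le_measure; rewrite ?inE//.
  - exact: measurable_shift_diff.
  - by do 2 (apply: measurableU => //).
  move=> x; rewrite /shift_diff /=; have := BA J x; have := BA J (x + y).
  case: (pselect (A x)) => [Ax|nAx]; case: (pselect (A (x + y))) => [Axy|nAxy];
    case: (pselect (B J x)) => [Bx|nBx]; case: (pselect (B J (x + y))) => [Bxy|nBxy]; tauto.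
have m1 : measurable (shift_diff (B J) y `|` (A `\` B J)) by exact: measurableU.
apply: le_trans (measureU2 _ m1 mAy) _.
rewrite (_ : e%:E = (e / 3)%:E + (e / 3)%:E + (e / 3)%:E)%E; last first.
  by rewrite -!EFinD; congr (_%:E); field.
apply: leeD; last first.
  apply: le_trans CJ; rewrite -(lebesgue_rV_translate y)//.
  rewrite /torus_measure /= /mrestr unit_cubeE; apply: le_measure; rewrite ?inE//.
  - by apply: measurableI => //; exact: measurable_hbox.
  - exact: measurable_shift.
  move=> x [xAB xQ]; split => //; move=> i; have := yd i; have := xQ i.
  by rewrite !mxE lt_min => ? /andP[_]; rewrite ltr_norml; lra.
apply: le_trans (measureU2 _ mDB (mAB J)) _; apply: leeD.
  by apply: dB => i; have := yd i; rewrite lt_min => /andP[].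
apply: le_trans CJ; rewrite /torus_measure /= /mrestr unit_cubeE.
apply: le_measure; rewrite ?inE//.
  by apply: measurableI => //; exact: measurable_hbox.
by move=> x [xAB xQ]; split => // i; have := xQ i; rewrite !mxE; lra.
Qed.

Lemma shift_continuous_ray i (a : R) :
  shift_continuous [set x : 'rV[R]_n | x ord0 i < a].
Proof.
have -> : [set x : 'rV[R]_n | x ord0 i < a] = Defs.coord i @^-1` `]-oo, a[.
  by apply/seteqP; split=> x /=; rewrite in_itv.
have mA : measurable (Defs.coord i @^-1` `]-oo, a[ : set 'rV[R]_n).
  by rewrite -[X in measurable X]setTI; exact: measurable_coord.
split=> // e e0; exists (e / 2); first by rewrite divr_gt0.
move=> y yd.
pose S j : set (measurableTypeR R) :=
  if j == i then `[a - e / 2, a + e / 2]%classic else `[0, 1[%classic.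
have mS j : measurable (S j) by rewrite /S; case: ifP => _; exact: measurable_itv.
apply: (@le_trans _ _ (lebesgue_rV n [set x | forall j, S j (Defs.coord j x)])).
  rewrite /torus_measure /= /mrestr unit_cubeE; apply: le_measure; rewrite ?inE//.
  - apply: measurableI; last exact: measurable_hbox.
    exact: measurable_shift_diff.
  - exact: measurable_box.
  move=> x [xD xQ] j; rewrite /S /Defs.coord; case: eqP => [->|_] /=; last first.
    by have := xQ j; rewrite in_itv/= !mxE; lra.
  move: xD; rewrite /shift_diff /= !in_itv/= /Defs.coord !mxE.
  have := yd i; rewrite ltr_norml => /andP[y1 y2] xD.
  have [xa|ax] := ltP (x ord0 i) a.
    have : ~~ (x ord0 i + y ord0 i < a).
      by apply/negP => h; apply: xD.
    by rewrite -leNgt; lra.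
  have : x ord0 i + y ord0 i < a.
    rewrite ltNge; apply/negP => h; apply: xD; split=> h'; lra.
  lra.
rewrite lebesgue_rV_box// (bigD1 i)//= [X in (_ * X)%E]big1 => [|j /negPf ji]; last first.
  by rewrite /S ji lebesgue_measure_itv /= lte01 sube0.
rewrite /S eqxx mule1 lebesgue_measure_itv /= lte_fin; case: ifP => _; last by rewrite lee_fin ltW.
by rewrite -EFinB lee_fin; lra.
Qed.

Lemma measurable_shift_continuous A : measurable A -> shift_continuous A.
Proof.
have sA : sigma_algebra setT shift_continuous.
  split.
  - split=> // e e0; exists 1 => // y _.
    rewrite (_ : shift_diff _ _ = set0) ?measure0 ?lee_fin ?ltW//.
    by apply/seteqP; split=> x //; rewrite /shift_diff /=; tauto.
  - by move=> B /shift_continuousC; rewrite setTD.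
  - exact: shift_continuous_bigcup.
rewrite measurable_rV_coords => gA; move: A gA.
apply: smallest_sub => //; rewrite -bigcup_seq => _ [i _ [B mB <-]].
have : measurable `<=` image_set_system setT (@Defs.coord R n i) shift_continuous.
  rewrite RGenInftyO.measurableE; apply: smallest_sub.
    exact: sigma_algebra_image.
  move=> _ [a ->]; rewrite /image_set_system /= setTI.
  rewrite (_ : _ @^-1` _ = [set x : 'rV[R]_n | x ord0 i < a]).
    exact: shift_continuous_ray.
  by apply/seteqP; split=> x /=; rewrite in_itv.
by apply.
Qed.

End translation_continuity.

Section tonelli_unit.
Context d (T : measurableType d) {R : realType} (mu : {measure set T -> \bar R}).
Hypothesis mu1 : mu setT = 1%E.

(** A copy of mu whose name carries the proof of unit mass, so that a probability structure can be
    attached to it and Tonelli's theorem applies. *)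
Definition unit_mass_measure (_ : mu setT = 1%E) : set T -> \bar R := mu.

HB.instance Definition _ := isMeasure.Build _ _ _ (unit_mass_measure mu1)
  (measure0 mu) (measure_ge0 mu) (@measure_semi_sigma_additive _ _ _ mu).

HB.instance Definition _ := Measure_isProbability.Build _ _ _ (unit_mass_measure mu1) mu1.

Lemma tonelli_unit (f : T * T -> \bar R) :
  measurable_fun setT f -> (forall p, 0 <= f p)%E ->
  (\int[mu]_x \int[mu]_y f (x, y) = \int[mu]_y \int[mu]_x f (x, y))%E.
Proof.
move=> mf f0.
exact: (@fubini_tonelli _ _ _ _ R (unit_mass_measure mu1) (unit_mass_measure mu1) f mf f0).
Qed.
Lemma measurable_tonelli_unit (f : T * T -> \bar R) :
  measurable_fun setT f -> (forall p, 0 <= f p)%E ->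
  measurable_fun setT (fun x => \int[mu]_y f (x, y))%E.
Proof.
move=> mf f0.
exact: (@measurable_fun_fubini_tonelli_F _ _ _ _ R (unit_mass_measure mu1) f mf f0).
Qed.

End tonelli_unit.

(** * Approximate identities from powers of a bump *)

Section approximate_identity.
Context {R : realType} (n : nat).
Local Notation mu := (@torus_measure R n).
Let mu1 : mu setT = 1%E := @torus_measureT R n.

Lemma shift_continuous_uniform (P : nat -> set 'rV[R]_n) J (e : R) :
  (forall j, shift_continuous (P j)) -> 0 < e ->
  exists2 d : R, 0 < d & forall y : 'rV[R]_n, (forall i, `|y ord0 i| < d) ->
    forall j, (j < J)%N -> (mu (shift_diff (P j) y) <= e%:E)%E.
Proof.
move=> cP e0; elim: J => [|J [d d0 dP]]; first by exists 1.
have [d' d'0 d'P] := (cP J).2 _ e0.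
exists (Num.min d d'); first by rewrite lt_min d0.
move=> y yd j; rewrite ltnS leq_eqVlt => /predU1P[->|jJ].
  by apply: d'P => i; have := yd i; rewrite lt_min => /andP[].
by apply: dP => // i; have := yd i; rewrite lt_min => /andP[].
Qed.

Lemma Rintegral_indic (A : set 'rV[R]_n) : measurable A ->
  \int[mu]_x (\1_A x : R) = fine (mu A).
Proof. by move=> mA; rewrite /Rintegral integral_indic// setIT. Qed.

Lemma indic_integrable (A : set 'rV[R]_n) : measurable A ->
  mu.-integrable setT (EFin \o (\1_A : _ -> R)).
Proof.
move=> mA; apply: (integrable_bounded (M := 1) mu1); first exact: measurable_indic.
by move=> x; rewrite indicE; case: (_ \in _); rewrite ?normr1 ?normr0.
Qed.

Lemma fine_le_cst (A : set 'rV[R]_n) (e : R) : (mu A <= e%:E)%E -> fine (mu A) <= e.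
Proof.
move=> Ae; rewrite -lee_fin fineK// ge0_fin_numE ?measure_ge0//.
by rewrite (le_lt_trans Ae)// ltry.
Qed.

(** The range of h is cut into slabs of height 1 / N. If x and x + y fall into the same slab, the
    difference is at most 1 / N; otherwise x lies in the shift difference of a level set, and the
    cost is at most 2 M. *)
Lemma shift_L1_continuous (h : 'rV[R]_n -> R) M (e : R) :
  measurable_fun setT h -> (forall x, `|h x| <= M) -> 0 < e ->
  exists2 d : R, 0 < d & forall y : 'rV[R]_n, (forall i, `|y ord0 i| < d) ->
    \int[mu]_x `|h (x + y) - h x| <= e.
Proof.
move=> mh hM e0.
have M0 : 0 <= M by apply: le_trans (hM 0).
have [N N0 Ne] : exists2 N : nat, (0 < N)%N & N%:R^-1 <= e / 2.
  have e2 : 0 < e / 2 by rewrite divr_gt0.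
  have e20 : 0 <= (e / 2)^-1 by rewrite invr_ge0 ltW.
  have := archi_boundP e20; set N := Num.bound _ => eN.
  have NR : 0 < N%:R :> R by apply: le_lt_trans eN.
  exists N; first by rewrite -(ltr0n R).
  by rewrite invf_ple ?posrE// ltW.
have NR : 0 < N%:R :> R by rewrite ltr0n.
pose t x := N%:R * (h x + M).
pose J := (Num.truncn (N%:R * (2 * M))).+1.
pose P j : set 'rV[R]_n := [set x | j%:R <= t x < j.+1%:R].
have mP j : measurable (P j).
  rewrite (_ : P j = t @^-1` `[j%:R, j.+1%:R[%classic); last first.
    by apply/seteqP; split=> x /=; rewrite in_itv.
  rewrite -[X in measurable X]setTI.
  have mt : measurable_fun setT t by apply: measurable_funM => //; exact: measurable_funD.
  exact: (mt measurableT).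
have cP j : shift_continuous (P j) by exact: measurable_shift_continuous.
(* The J level sets together may cost e / 2; 2 M + 1 in place of 2 M keeps the divisor positive when
   M = 0. *)
have e'0 : 0 < e / (2 * (2 * M + 1) * J%:R).
  by rewrite divr_gt0// mulr_gt0 ?ltr0n// mulr_gt0// ltr_wpDl// mulr_ge0.
have [d d0 dP] := shift_continuous_uniform J cP e'0.
exists d => // y yd.
have mhy : measurable_fun setT (fun x : 'rV[R]_n => h (x + y)).
  by apply: measurableT_comp => //; exact: measurable_rV_add.
have mD j : measurable (shift_diff (P j) y) by exact: measurable_shift_diff.
have SL : mu.-integrable setT (EFin \o fun x : 'rV[R]_n =>
    \sum_(j < J) (\1_(shift_diff (P j) y) x : R)).
  by apply: integrable_bigsum => j _; exact: indic_integrable.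
apply: (@le_trans _ _ (\int[mu]_x (N%:R^-1 +
    (2 * M + 1) * \sum_(j < J) (\1_(shift_diff (P j) y) x : R)))).
  apply: le_Rintegral => //.
  - apply: (integrable_bounded (M := M + M) mu1).
      by apply: measurableT_comp => //; exact: measurable_funB.
    by move=> x; rewrite normr_id (le_trans (ler_normB _ _))// lerD.
  - apply: integrable_add; first exact: integrable_cst_unit.
    exact: integrable_scale.
  move=> x _; pose j := Num.truncn (t x).
  have tx0 : 0 <= t x.
    rewrite mulr_ge0// -lerBlDr sub0r.
    by have := hM x; rewrite ler_norml => /andP[].
  have xP : P j x by rewrite /P /= /j; apply: truncn_itv.
  have jJ : (j < J)%N.
    rewrite /J ltnS /j; apply: le_truncn; rewrite ler_wpM2l// mulr2n mulrDl mul1r lerD2r.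
    exact: le_trans (ler_norm _) (hM x).
  have S0 : 0 <= \sum_(j < J) (\1_(shift_diff (P j) y) x : R).
    by apply: sumr_ge0 => i _; rewrite indicE.
  have [yP|nyP] := pselect (P j (x + y)).
    apply: ler_wpDr; first by rewrite mulr_ge0// addr_ge0// mulr_ge0.
    rewrite -(ler_pM2l NR) mulfV ?gt_eqF// -[X in X * _]gtr0_norm// -normrM.
    move: xP yP; rewrite /P /t /= -!natr1 => /andP[x1 x2] /andP[y1 y2].
    by rewrite ler_norml; nra.
  have Dx : x \in shift_diff (P j) y by rewrite inE /shift_diff /= => -[_ /(_ xP)].
  rewrite (bigD1 (Ordinal jJ))//= indicE Dx /=.
  have := ler_normB (h (x + y)) (h x); have := hM (x + y); have := hM x.
  have : 0 <= \sum_(i < J | i != Ordinal jJ) (\1_(shift_diff (P i) y) x : R).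
    by apply: sumr_ge0 => i _; rewrite indicE.
  have : 0 < N%:R^-1 :> R by rewrite invr_gt0.
  move: (\sum_(i < J | _) _) => s; move: (N%:R^-1) => r; nra.
rewrite RintegralD//; last 2 first.
- exact: integrable_cst_unit.
- exact: integrable_scale.
rewrite Rintegral_cst_unit// RintegralZl// [leRHS]splitr lerD//.
rewrite Rintegral_bigsum; last by move=> j _; exact: indic_integrable.
apply: (@le_trans _ _ ((2 * M + 1) * \sum_(j < J) (e / (2 * (2 * M + 1) * J%:R)))).
  rewrite ler_wpM2l ?addr_ge0 ?mulr_ge0//; apply: ler_sum => j _.
  by rewrite Rintegral_indic//; apply: fine_le_cst; exact: dP.
rewrite sumr_const card_ord -[_ *+ J]mulr_natr le_eqVlt; apply/orP; left; apply/eqP.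
by field; rewrite gt_eqF ?ltr0n//= gt_eqF// ltr_wpDl// mulr_ge0.
Qed.

Lemma geometric_small (r c e : R) : 0 <= r -> r < 1 -> 0 < e ->
  exists N0 : nat, forall N, (N0 <= N)%N -> c * r ^+ N <= e.
Proof.
move=> r0 r1 e0; have rn : `|r| < 1 by rewrite ger0_norm.
have /cvgrPdist_le /(_ e e0) [N _ NP] := @cvg_geometric R c r rn.
exists N => k Nk; have /= := NP k Nk.
by rewrite sub0r normrN; apply: le_trans; exact: ler_norm.
Qed.

Variable q : 'rV[R]_n -> R.
Hypothesis mq : measurable_fun setT q.
Hypothesis q01 : forall y, 0 <= q y <= 1.
Hypothesis qper : Zn_periodic q.
Hypothesis q_near1 : forall d : R, 0 < d -> exists2 a : R, 0 <= a < 1 &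
  forall y, a < q y -> exists z : 'rV[int]_n, forall i, `|y ord0 i - (z ord0 i)%:~R| < d.
Hypothesis q_mass : forall b : R, b < 1 -> (0 < mu [set y | (b < q y)%R])%E.

(** The normalised powers of q concentrate where q is close to 1: where q <= a they are at most a^N
    over the mass, and the mass is at least b^N times the measure of {b < q}. For a < b the quotient
    decays geometrically. *)
Definition kernel_mass N : R := \int[mu]_y (q y ^+ N).
Definition kernel N y : R := q y ^+ N / kernel_mass N.

Let qN_bounded N y : `|q y ^+ N| <= 1.
Proof. by have /andP[? ?] := q01 y; rewrite ger0_norm ?exprn_ge0// exprn_ile1. Qed.

Let qN_integrable N : mu.-integrable setT (EFin \o fun y => q y ^+ N).
Proof. by apply: (integrable_bounded mu1 _ (qN_bounded N)); exact: measurable_funX. Qed.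

Lemma kernel_mass_ge N (b : R) : 0 < b < 1 ->
  b ^+ N * fine (mu [set y | b < q y]) <= kernel_mass N.
Proof.
move=> /andP[b0 b1].
have mA : measurable [set y | b < q y].
  rewrite (_ : mkset _ = q @^-1` `]b, +oo[%classic); last first.
    by apply/seteqP; split=> x /=; rewrite in_itv/= andbT.
  by rewrite -[X in measurable X]setTI; exact: mq.
rewrite -Rintegral_indic// -RintegralZl//; last exact: indic_integrable.
apply: le_Rintegral => //; first exact/integrable_scale/indic_integrable.
move=> y _; rewrite indicE; have /andP[qy0 _] := q01 y.
have [|_] := boolP (y \in _); last by rewrite mulr0 exprn_ge0.
by rewrite inE /= mulr1 => bq; rewrite lerXn2r ?nnegrE// ltW.
Qed.

Lemma mass_gt0 (b : R) : b < 1 -> 0 < fine (mu [set y | b < q y]).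
Proof.
move=> b1; apply: fine_gt0; rewrite q_mass//=.
apply: (@le_lt_trans _ _ (mu setT)); last by rewrite mu1 ltry.
apply: le_measure; rewrite ?inE//.
rewrite (_ : mkset _ = q @^-1` `]b, +oo[%classic); last first.
  by apply/seteqP; split=> x /=; rewrite in_itv/= andbT.
by rewrite -[X in measurable X]setTI; exact: mq.
Qed.

Lemma kernel_mass_gt0 N : 0 < kernel_mass N.
Proof.
apply: lt_le_trans (@kernel_mass_ge N (1 / 2) _); last by apply/andP; split; lra.
by rewrite mulr_gt0 ?exprn_gt0// mass_gt0//; lra.
Qed.

Lemma kernel_ge0 N y : 0 <= kernel N y.
Proof.
have /andP[qy0 _] := q01 y.
by rewrite divr_ge0 ?exprn_ge0//; exact/ltW/kernel_mass_gt0.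
Qed.

Lemma measurable_kernel N : measurable_fun setT (kernel N).
Proof. by apply: measurable_funM => //; exact: measurable_funX. Qed.

Lemma kernel_integrable N : mu.-integrable setT (EFin \o kernel N).
Proof.
rewrite (_ : kernel N = fun y => (kernel_mass N)^-1 * q y ^+ N).
  exact: integrable_scale.
by apply/funext => y; rewrite mulrC.
Qed.

Lemma integral_kernel N : \int[mu]_y kernel N y = 1.
Proof.
rewrite (_ : kernel N = fun y => (kernel_mass N)^-1 * q y ^+ N); last first.
  by apply/funext => y; rewrite mulrC.
by rewrite RintegralZl// mulVf// gt_eqF// kernel_mass_gt0.
Qed.

Lemma kernel_mul_integrable N (h : 'rV[R]_n -> R) M :
  measurable_fun setT h -> (forall x, `|h x| <= M) ->
  mu.-integrable setT (EFin \o fun y => h y * kernel N y).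
Proof.
move=> mh hM; apply: (integrable_dominated _ _ (integrable_scale M (kernel_integrable N))).
  by apply: measurable_funM => //; exact: measurable_kernel.
by move=> y; rewrite normrM (ger0_norm (kernel_ge0 _ _)) ler_wpM2r// kernel_ge0.
Qed.

Definition mollify N (h : 'rV[R]_n -> R) x := \int[mu]_y (h y * kernel N (y - x)).

Lemma mollifyE N (h : 'rV[R]_n -> R) x : measurable_fun setT h -> Zn_periodic h ->
  mollify N h x = \int[mu]_y (h (y + x) * kernel N y).
Proof.
move=> mh hper; rewrite /mollify.
rewrite -(@integral_torus_translateR _ _ x (fun y => h y * kernel N (y - x))).
- by apply: eq_Rintegral => y _; rewrite addrK.
- apply: measurable_funM => //.
  by apply: measurableT_comp; [exact: measurable_kernel|exact: measurable_rV_add].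
by move=> y z; rewrite hper /kernel addrAC qper.
Qed.

Lemma mollify_bounded N (h : 'rV[R]_n -> R) M x :
  measurable_fun setT h -> Zn_periodic h -> (forall x, `|h x| <= M) ->
  `|mollify N h x| <= M.
Proof.
move=> mh hper hM; rewrite mollifyE//.
have mhx : measurable_fun setT (fun y : 'rV[R]_n => h (y + x)).
  by apply: measurableT_comp => //; exact: measurable_rV_add.
apply: le_trans (le_normr_Rintegral _ _) _ => //.
  exact: (kernel_mul_integrable N mhx (fun y => hM _)).
rewrite -[leRHS]mulr1 -(integral_kernel N) -RintegralZl//; last exact: kernel_integrable.
apply: le_Rintegral => //.
- apply: integrable_abs; exact: (kernel_mul_integrable N mhx (fun y => hM _)).
- exact/integrable_scale/kernel_integrable.
by move=> y _; rewrite normrM (ger0_norm (kernel_ge0 _ _)) ler_wpM2r// kernel_ge0.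
Qed.

(** By Tonelli the left-hand side is at most the average, against the kernel, of the L^1 modulus of
    continuity [w y] of h. Where q y > a, the point y is close to the lattice, and periodicity makes
    [w y] small; elsewhere the kernel itself is small. *)
Lemma mollify_cvg (h : 'rV[R]_n -> R) M (e : R) :
  measurable_fun setT h -> Zn_periodic h -> (forall x, `|h x| <= M) ->
  (forall N, measurable_fun setT (mollify N h)) -> 0 < e ->
  exists N0, forall N, (N0 <= N)%N -> \int[mu]_x `|mollify N h x - h x| <= e.
Proof.
move=> mh hper hM mmol e0.
have M0 : 0 <= M by apply: le_trans (hM 0).
have e2 : 0 < e / 2 by rewrite divr_gt0.
have [d d0 hd] := shift_L1_continuous mh hM e2.
have [a /andP[a0 a1] aP] := q_near1 d0.
pose w y := \int[mu]_x `|h (x + y) - h x|.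
have hsL y : mu.-integrable setT (EFin \o fun x : 'rV[R]_n => `|h (x + y) - h x|).
  apply: (integrable_bounded (M := M + M) mu1).
    apply: measurableT_comp => //; apply: measurable_funB => //.
    by apply: measurableT_comp => //; exact: measurable_rV_add.
  by move=> x; rewrite normr_id (le_trans (ler_normB _ _))// lerD.
have w2M y : w y <= 2 * M.
  rewrite -[leRHS](Rintegral_cst_unit mu1); apply: le_Rintegral => //.
    exact: integrable_cst_unit.
  by move=> x _; rewrite (le_trans (ler_normB _ _))// mulr2n mulrDl mul1r lerD.
have w_small y : a < q y -> w y <= e / 2.
  move=> /aP[z yz]; have {}yz i : `|(y - intrV z) ord0 i| < d by rewrite !mxE.
  apply: le_trans (hd _ yz); rewrite /w le_eqVlt; apply/orP; left; apply/eqP.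
  by apply: eq_Rintegral => x _; rewrite -{1}(subrK (intrV z) y) addrA periodicB.
(* Any b strictly between a and 1 would do: a / b < 1, and {b < q} has positive measure. *)
pose b := (a + 1) / 2.
have b0 : 0 < b by rewrite /b; lra.
have b1 : b < 1 by rewrite /b; lra.
have ab : a / b < 1 by rewrite ltr_pdivrMr// mul1r /b; lra.
pose m := fine (mu [set y | b < q y]).
have m0 : 0 < m by exact: mass_gt0.
have ab0 : 0 <= a / b by rewrite divr_ge0// ltW.
have [N0 N0P] := geometric_small (2 * M / m) ab0 ab e2.
exists N0 => N /N0P {}N0P.
(* The bounds of the two regions are added, so that the integral need not be split. *)
have kw y : kernel N y * w y <= e / 2 * kernel N y + e / 2.
  have [aq|qa] := ltP a (q y).
    apply: ler_wpDr; first exact: ltW.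
    by rewrite mulrC ler_wpM2r ?kernel_ge0// w_small.
  apply: ler_wpDl; first by rewrite mulr_ge0 ?kernel_ge0// ltW.
  apply: le_trans N0P; have /andP[qy0 _] := q01 y.
  have bm : 0 < b ^+ N * m by rewrite mulr_gt0// exprn_gt0.
  have k_le : kernel N y <= a ^+ N / (b ^+ N * m).
    rewrite /kernel; apply: ler_pM; rewrite ?exprn_ge0//.
    - by rewrite invr_ge0 ltW// kernel_mass_gt0.
    - by rewrite lerXn2r ?nnegrE.
    rewrite lef_pV2 ?posrE ?kernel_mass_gt0//.
    by apply: kernel_mass_ge; rewrite b0.
  apply: (@le_trans _ _ (a ^+ N / (b ^+ N * m) * (2 * M))).
    by rewrite ler_pM ?kernel_ge0//; apply: Rintegral_ge0.
  rewrite [(a / b) ^+ N]expr_div_n le_eqVlt; apply/orP; left; apply/eqP.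
  have bN : b ^+ N != 0 by rewrite expf_neq0// gt_eqF.
  have mn : m != 0 by rewrite gt_eqF.
  clear -bN mn; move: (a ^+ N) (b ^+ N) bN => A B B0; clearbody m.
  by field; rewrite mn B0.
have mF : measurable_fun setT (fun p : 'rV[R]_n * 'rV[R]_n =>
    (`|h (p.1 + p.2) - h p.1| * kernel N p.2)%:E).
  apply/measurable_EFinP; apply: measurable_funM; last first.
    by apply: measurableT_comp; [exact: measurable_kernel|exact: measurable_snd].
  apply: measurableT_comp => //; apply: measurable_funB; last first.
    by apply: measurableT_comp => //; exact: measurable_fst.
  apply: measurableT_comp => //; apply: measurable_fun_rV => i.
  rewrite (_ : _ \o _ = fun p => Defs.coord i p.1 + Defs.coord i p.2); last first.
    by apply/funext => p; rewrite /= /Defs.coord mxE.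
  by apply: measurable_funD; apply: (measurableT_comp (measurable_coord i)).
have F0 p : (0 <= (`|h (p.1 + p.2) - h p.1| * kernel N p.2)%:E)%E.
  by rewrite lee_fin mulr_ge0// kernel_ge0.
have mdiff : measurable_fun setT (fun x => `|mollify N h x - h x|).
  by apply: measurableT_comp => //; exact: measurable_funB.
rewrite -lee_fin EFin_Rintegral; last first.
  apply: (integrable_bounded (M := M + M) mu1) => // x.
  rewrite normr_id (le_trans (ler_normB _ _))// lerD//.
  exact: mollify_bounded.
apply: (@le_trans _ _ (\int[mu]_x \int[mu]_y
    (`|h (x + y) - h x| * kernel N y)%:E)%E).
  apply: ge0_le_integral => //.
  - exact/measurable_EFinP.
  - exact: (measurable_tonelli_unit mu1 mF F0).
  move=> x _; have mhx : measurable_fun setT (fun y : 'rV[R]_n => h (y + x) - h x).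
    apply: measurable_funB => //.
    by apply: measurableT_comp => //; exact: measurable_rV_add.
  have hxM y : `|h (y + x) - h x| <= M + M by rewrite (le_trans (ler_normB _ _))// lerD.
  have mhy : measurable_fun setT (fun y : 'rV[R]_n => h (y + x)).
    by apply: measurableT_comp => //; exact: measurable_rV_add.
  have L1 := kernel_mul_integrable N mhx hxM.
  have -> : mollify N h x - h x = \int[mu]_y ((h (y + x) - h x) * kernel N y).
    rewrite mollifyE// -[X in _ - X]mulr1 -(integral_kernel N).
    rewrite -RintegralZl//; last exact: kernel_integrable.
    rewrite -RintegralB//; last 2 first.
    - exact: (kernel_mul_integrable N mhy (fun y => hM _)).
    - exact/integrable_scale/kernel_integrable.
    by apply: eq_Rintegral => y _; rewrite mulrBl.
  apply: le_trans (_ : (\int[mu]_y `|(h (y + x) - h x) * kernel N y|)%:E <= _)%E.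
    by rewrite lee_fin; exact: le_normr_Rintegral.
  rewrite EFin_Rintegral; last exact: integrable_abs.
  rewrite le_eqVlt; apply/orP; left; apply/eqP/eq_integral => y _.
  by rewrite normrM (ger0_norm (kernel_ge0 _ _)) [y + x]addrC.
rewrite (tonelli_unit mu1 mF F0) /=.
apply: (@le_trans _ _ (\int[mu]_y (e / 2 * kernel N y + e / 2)%:E)%E).
  apply: ge0_le_integral => //.
  - by move=> y _; apply: integral_ge0 => x _; exact: (F0 (x, y)).
  - have mF' : measurable_fun setT (fun p : 'rV[R]_n * 'rV[R]_n =>
        (`|h (p.2 + p.1) - h p.2| * kernel N p.1)%:E).
      have := measurableT_comp mF (@measurable_swap _ _ 'rV[R]_n 'rV[R]_n).
      by apply: eq_measurable_fun => -[].
    exact: (measurable_tonelli_unit mu1 mF' (fun p => F0 (p.2, p.1))).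
  - apply/measurable_EFinP; apply: measurable_funD => //.
    by apply: measurable_funM => //; exact: measurable_kernel.
  move=> y _; rewrite -EFin_Rintegral; last first.
    by under [fun x => _ * _]eq_fun do rewrite mulrC; exact: integrable_scale.
  rewrite lee_fin RintegralZr//; apply: le_trans (kw y).
  by rewrite mulrC.
rewrite -EFin_Rintegral; last first.
  apply: integrable_add; last exact: integrable_cst_unit.
  exact/integrable_scale/kernel_integrable.
rewrite lee_fin RintegralD//; last 2 first.
- exact/integrable_scale/kernel_integrable.
- exact: integrable_cst_unit.
rewrite Rintegral_cst_unit// RintegralZl//; last exact: kernel_integrable.
by rewrite integral_kernel mulr1 -splitr.
Qed.

End approximate_identity.

(* Trigonometric polynomials on the torus, as syntax: derivatives and the
   separation of variables below are computed symbolically. *)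
Inductive tpoly (R : Type) (n : nat) :=
| TCst of R
| TCos of 'I_n
| TSin of 'I_n
| TAdd of tpoly R n & tpoly R n
| TMul of tpoly R n & tpoly R n.
Arguments TCst {R n}.
Arguments TCos {R n}.
Arguments TSin {R n}.

Section trigonometric_polynomials.
Context {R : realType} {n : nat}.
Local Notation mu := (@torus_measure R n).
Let mu1 : mu setT = 1%E := @torus_measureT R n.
Implicit Types (t : tpoly R n) (x y : 'rV[R]_n).

Let tau : R := pi *+ 2.

Fixpoint teval t x : R :=
  match t with
  | TCst c => c
  | TCos i => cos (tau * x ord0 i)
  | TSin i => sin (tau * x ord0 i)
  | TAdd a b => teval a x + teval b x
  | TMul a b => teval a x * teval b x
  end.

Fixpoint tderiv (i : 'I_n) t : tpoly R n :=
  match t with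
  | TCst _ => TCst 0
  | TCos j => if i == j then TMul (TCst (- tau)) (TSin j) else TCst 0
  | TSin j => if i == j then TMul (TCst tau) (TCos j) else TCst 0
  | TAdd a b => TAdd (tderiv i a) (tderiv i b)
  | TMul a b => TAdd (TMul a (tderiv i b)) (TMul b (tderiv i a))
  end.

Lemma is_derive_line (V : normedModType R) (g : 'rV[R]_n -> V) x v d :
  is_derive (0 : R) 1 (fun s => g (x + s *: v)) d -> is_derive x v g d.
Proof.
have E : (fun h : R => h^-1 *: (((fun s => g (x + s *: v)) \o shift 0) (h *: 1)
    - g (x + 0 *: v))) = fun h => h^-1 *: ((g \o shift x) (h *: v) - g x).
  apply/funext => h /=.
  by rewrite [_ *: 1]mulr1 addr0 scale0r addr0 [x + _]addrC.
by move=> [d1 d2]; split; [move: d1; rewrite /derivable E|rewrite -d2 /derive E].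
Qed.

Lemma is_derive_affine (f : R -> R) (a b df : R) :
  is_derive a 1 f df -> is_derive (0 : R) 1 (fun s => f (a + s * b)) (df * b).
Proof.
move=> fa.
have d1 : is_derive (a + 0 * b : R) 1 f df by rewrite mul0r addr0.
have d2 : is_derive (0 : R) 1 (fun s : R => a + s * b) b.
  rewrite (_ : (fun s => _) = cst a + (b \*: id)); last first.
    by apply/funext => s; rewrite /= mulrC.
  by apply: is_derive_eq; rewrite add0r [b *: _]mulr1.
exact: (@is_derive1_comp R f (fun s => a + s * b) 0 df b d1 d2).
Qed.

Lemma is_derive_teval t x i :
  is_derive x (delta_mx ord0 i) (teval t) (teval (tderiv i t) x).
Proof.
elim: t => /= [c|j|j|a IHa b IHb|a IHa b IHb].
- exact: is_derive_cst.
- apply: is_derive_line.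
  rewrite (_ : (fun s => _) =
    fun s : R => cos (tau * x ord0 j + s * (tau * (i == j)%:R))); last first.
    by apply/funext => s; rewrite !mxE eqxx /= eq_sym mulrDr mulrCA.
  have D := is_derive_affine (tau * (i == j)%:R) (is_derive_cos (tau * x ord0 j)).
  rewrite [X in is_derive _ _ _ X](_ : _ = - sin (tau * x ord0 j) * (tau * (i == j)%:R))//.
  by case: eqP => _ /=; ring.
- apply: is_derive_line.
  rewrite (_ : (fun s => _) =
    fun s : R => sin (tau * x ord0 j + s * (tau * (i == j)%:R))); last first.
    by apply/funext => s; rewrite !mxE eqxx /= eq_sym mulrDr mulrCA.
  have D := is_derive_affine (tau * (i == j)%:R) (is_derive_sin (tau * x ord0 j)).
  rewrite [X in is_derive _ _ _ X](_ : _ = cos (tau * x ord0 j) * (tau * (i == j)%:R))//.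
  by case: eqP => _ /=; ring.
- exact: is_deriveD.
- exact: is_deriveM.
Qed.

Lemma periodic_intr (f : R -> R) (T a : R) (z : int) :
  periodic f T -> f (T * (a + z%:~R)) = f (T * a).
Proof.
move=> fT; case: z => k.
  by rewrite mulrDr -(periodicn fT k (T * a)) mulr_natr.
rewrite NegzE rmorphN -(periodicn fT k.+1 (T * _)) /=; congr f.
by rewrite -mulr_natr -mulrDr subrK.
Qed.

Lemma teval_periodic t : Zn_periodic (teval t).
Proof.
move=> x z; elim: t => /= [//|j|j|a -> b ->//|a -> b ->//]; rewrite !mxE.
  exact: periodic_intr (@cosD2pi R).
exact: periodic_intr (@sinD2pi R).
Qed.

Lemma teval_continuous t : continuous (teval t).
Proof.
elim: t => /= [c|j|j|a IHa b IHb|a IHa b IHb] x.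
- exact: cst_continuous.
- apply: (@continuous_comp _ _ _ (fun y : 'rV[R]_n => tau * y ord0 j) cos).
    apply: continuousM; first exact: cst_continuous.
    exact: coord_continuous.
  exact: continuous_cos.
- apply: (@continuous_comp _ _ _ (fun y : 'rV[R]_n => tau * y ord0 j) sin).
    apply: continuousM; first exact: cst_continuous.
    exact: coord_continuous.
  exact: continuous_sin.
- by apply: continuousD; [exact: IHa|exact: IHb].
- by apply: continuousM; [exact: IHa|exact: IHb].
Qed.

Lemma teval_measurable t : measurable_fun setT (teval t).
Proof. by apply: continuous_measurable_rV; exact: teval_continuous. Qed.

Lemma teval_bounded t : exists M, forall x, `|teval t x| <= M.
Proof.
by apply: continuous_periodic_bounded; [exact: teval_continuous|exact: teval_periodic].
Qed.

(** The addition formulas of cos and sin, pushed through sums and products. In each pair the first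
    factor is a function of x and the second a function of y. *)
Fixpoint tsep t : seq (tpoly R n * tpoly R n) :=
  match t with
  | TCst c => [:: (TCst c, TCst 1)]
  | TCos i => [:: (TCos i, TCos i); (TSin i, TSin i)]
  | TSin i => [:: (TCos i, TSin i); (TMul (TCst (-1)) (TSin i), TCos i)]
  | TAdd a b => tsep a ++ tsep b
  | TMul a b => [seq (TMul p.1 q.1, TMul p.2 q.2) | p <- tsep a, q <- tsep b]
  end.

Lemma tsepE t x y :
  teval t (y - x) = \sum_(p <- tsep t) teval p.1 x * teval p.2 y.
Proof.
elim: t => /= [c|j|j|a -> b ->|a -> b ->].
- by rewrite big_seq1 /= mulr1.
- by rewrite !big_cons big_nil /= !mxE mulrBr cosB addr0; ring.
- by rewrite !big_cons big_nil /= !mxE mulrBr sinB addr0; ring.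
- by rewrite big_cat.
rewrite big_allpairs_dep mulr_suml; apply: eq_bigr => p _.
by rewrite mulr_sumr; apply: eq_bigr => q _ /=; ring.
Qed.

Definition tderivs (s : seq 'I_n) t := foldr tderiv t s.

Lemma is_derive_bigsum (V : normedModType R) (I : Type) (r : seq I) (F : I -> V -> R)
    (dF : I -> R) (x v : V) :
  (forall i, is_derive x v (F i) (dF i)) ->
  is_derive x v (fun z => \sum_(i <- r) F i z) (\sum_(i <- r) dF i).
Proof.
move=> dFi; elim: r => [|i r IH].
  rewrite big_nil (_ : (fun z => _) = cst 0); first exact: is_derive_cst.
  by apply/funext => z; rewrite big_nil.
rewrite big_cons (_ : (fun z => _) = F i \+ (fun z => \sum_(j <- r) F j z)).
  exact: is_deriveD.
by apply/funext => z; rewrite big_cons.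
Qed.

Lemma tsep_derivr s t x y :
  \sum_(p <- tsep t) teval p.1 x * teval (tderivs s p.2) y =
  teval (tderivs s t) (y - x).
Proof.
elim: s y => /= [|i s IH] y; first by rewrite -tsepE.
have d1 : is_derive y (delta_mx ord0 i)
    (fun y => \sum_(p <- tsep t) teval p.1 x * teval (tderivs s p.2) y)
    (\sum_(p <- tsep t) teval p.1 x * teval (tderivs (i :: s) p.2) y).
  apply: is_derive_bigsum => p; apply: is_deriveZ.
  exact: is_derive_teval.
have d2 : is_derive y (delta_mx ord0 i) (fun y => teval (tderivs s t) (y - x))
    (teval (tderivs (i :: s) t) (y - x)).
  apply: is_derive_line.
  rewrite (_ : (fun z => _) = fun z : R =>
    teval (tderivs s t) ((y - x) + z *: delta_mx ord0 i)); last first.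
    by apply/funext => z; rewrite addrAC.
  have := @derive_line _ _ _ (teval (tderivs s t)) (y - x) (delta_mx ord0 i) 0.
  rewrite scale0r addr0 => D.
  have [dt <-] := is_derive_teval (tderivs s t) (y - x) i.
  exact: D.
by rewrite -(@derive_val _ _ _ _ _ _ _ d1) -(@derive_val _ _ _ _ _ _ _ d2);
  congr ('D_ _ _ _); apply/funext => z; rewrite IH.
Qed.

(** Obtained by differentiating the separated identity in x, each derivative giving a sign. Compared
    with [tsep_derivr], it turns derivatives of a convolution in x into derivatives of the kernel in
    y, as needed for a test field, without integration by parts. *)
Lemma tsep_derivl s t x y :
  \sum_(p <- tsep t) teval (tderivs s p.1) x * teval p.2 y =
  (-1) ^+ size s * teval (tderivs s t) (y - x).
Proof.
elim: s x => /= [|i s IH] x; first by rewrite mul1r -tsepE.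
have d1 : is_derive x (delta_mx ord0 i)
    (fun x => \sum_(p <- tsep t) teval (tderivs s p.1) x * teval p.2 y)
    (\sum_(p <- tsep t) teval (tderivs (i :: s) p.1) x * teval p.2 y).
  apply: is_derive_bigsum => p.
  rewrite (_ : (fun z => _) = (teval p.2 y \*: teval (tderivs s p.1))); last first.
    by apply/funext => z /=; rewrite mulrC.
  rewrite mulrC; apply: is_deriveZ; exact: is_derive_teval.
have d2 : is_derive x (delta_mx ord0 i)
    (fun x => (-1) ^+ size s * teval (tderivs s t) (y - x))
    ((-1) ^+ (size s).+1 * teval (tderivs (i :: s) t) (y - x)).
  rewrite exprSr -mulrA; apply: is_deriveZ; apply: is_derive_line.
  have := @derive_line _ _ _ (teval (tderivs s t)) (y - x) (delta_mx ord0 i) 0.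
  have [dt dE] := is_derive_teval (tderivs s t) (y - x) i.
  rewrite scale0r addr0 dE => /(_ dt) /(is_derive_affine (-1)).
  rewrite [in X in _ -> X]mulrC (_ : (fun z => _) = fun z : R =>
    teval (tderivs s t) (y - (x + z *: delta_mx ord0 i)))//.
  by apply/funext => z; rewrite add0r mulrN1 scaleNr opprD addrA.
by rewrite -(@derive_val _ _ _ _ _ _ _ d1) -(@derive_val _ _ _ _ _ _ _ d2);
  congr ('D_ _ _ _); apply/funext => z; rewrite IH.
Qed.

End trigonometric_polynomials.

(** * Trigonometric vector fields and convolution *)

Section vector_trigonometric.
Context {R : realType} {n : nat}.
Local Notation mu := (@torus_measure R n).
Let mu1 : mu setT = 1%E := @torus_measureT R n.

Lemma is_derive_scalel (V W : normedModType R) (f : V -> R) (w : W) (x v : V) (d : R) :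
  is_derive x v f d -> is_derive x v (fun z => f z *: w) (d *: w).
Proof.
move=> [df fd].
have E : (fun h : R => h^-1 *: (((fun z => f z *: w) \o shift x) (h *: v) - f x *: w)) =
    fun h => (h^-1 *: ((f \o shift x) (h *: v) - f x)) *: w.
  by apply/funext => h /=; rewrite -scalerBl scalerA.
have dcvg : h^-1 *: ((f \o shift x) (h *: v) - f x) @[h --> 0^'] --> d.
  by rewrite -fd; exact: df.
have wcvg : (h^-1 *: ((f \o shift x) (h *: v) - f x)) *: w @[h --> 0^'] --> d *: w.
  by apply: (@continuous_cvg _ _ _ _ _ _ (fun r : R => r *: w)) dcvg; exact: scalel_continuous.
split; first by rewrite /derivable E; exact: cvgP wcvg.
by rewrite /derive E; exact: cvg_lim wcvg.
Qed.

Definition tvec {m} (L : seq (tpoly R n * 'rV[R]_m)) (x : 'rV[R]_n) : 'rV[R]_m :=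
  \sum_(p <- L) teval p.1 x *: p.2.

Definition tvderivs {m} s (L : seq (tpoly R n * 'rV[R]_m)) :=
  [seq (tderivs s p.1, p.2) | p <- L].

Lemma is_derive_tvec m (L : seq (tpoly R n * 'rV[R]_m)) x i :
  is_derive x (delta_mx ord0 i) (tvec L) (tvec (tvderivs [:: i] L) x).
Proof.
elim: L => [|p L IH].
  rewrite /tvec big_nil (_ : (fun z => _) = cst 0); first exact: is_derive_cst.
  by apply/funext => z; rewrite big_nil.
rewrite (_ : tvec (p :: L) = (fun z => teval p.1 z *: p.2) + tvec L); last first.
  by apply/funext => z; rewrite /tvec big_cons.
rewrite /tvec /= big_cons; apply: is_deriveD => //.
by apply: is_derive_scalel; exact: is_derive_teval.
Qed.

Lemma partials_tvec m s (L : seq (tpoly R n * 'rV[R]_m)) :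
  partials s (tvec L) = tvec (tvderivs s L).
Proof.
elim: s => /= [|i s ->].
  by congr tvec; rewrite /tvderivs /tderivs; elim: L => //= -[a b] L <-.
apply/funext => x; rewrite /partial.
rewrite (@derive_val _ _ _ _ _ _ _ (is_derive_tvec (tvderivs s L) x i)).
by rewrite /tvderivs -map_comp.
Qed.

Lemma tvec_coord m (L : seq (tpoly R n * 'rV[R]_m)) x j :
  tvec L x ord0 j = \sum_(p <- L) teval p.1 x * p.2 ord0 j.
Proof. by rewrite /tvec summxE; apply: eq_bigr => p _; rewrite mxE. Qed.

Lemma tvec_continuous m (L : seq (tpoly R n * 'rV[R]_m)) : continuous (tvec L).
Proof.
elim: L => [|p L IH] x.
  rewrite (_ : tvec [::] = cst 0); first exact: cst_continuous.
  by apply/funext => z; rewrite /tvec big_nil.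
rewrite (_ : tvec (p :: L) = (fun z => teval p.1 z *: p.2) \+ tvec L); last first.
  by apply/funext => z; rewrite /tvec big_cons.
apply: continuousD; last exact: IH.
apply: (@continuous_comp _ _ _ (teval p.1) (fun r : R => r *: p.2)).
  exact: teval_continuous.
exact: scalel_continuous.
Qed.

Lemma tvec_torus_smooth m (L : seq (tpoly R n * 'rV[R]_m)) : torus_smooth (tvec L).
Proof.
split=> [x z|s].
  by rewrite /tvec; apply: eq_bigr => p _; rewrite teval_periodic.
rewrite partials_tvec; split; first exact: tvec_continuous.
by move=> i x; have [] := is_derive_tvec (tvderivs s L) x i.
Qed.

Lemma mul_teval_integrable (t : tpoly R n) (g : 'rV[R]_n -> R) :
  mu.-integrable setT (EFin \o g) ->
  mu.-integrable setT (EFin \o fun x => g x * teval t x).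
Proof.
move=> gL; have [M tM] := teval_bounded t.
apply: (integrable_dominated _ _ (integrable_scale M (integrable_abs gL))).
  by apply: measurable_funM; [exact: integrable_measurable gL|exact: teval_measurable].
by move=> x; rewrite normrM mulrC ler_wpM2r.
Qed.

(* The convolution of v with t as a combination of trigonometric polynomials,
   by separation of the variables in t (y - x). *)
Definition tconv {m} (t : tpoly R n) (v : 'rV[R]_n -> 'rV[R]_m) :
    seq (tpoly R n * 'rV[R]_m) :=
  [seq (p.1, \row_j \int[mu]_y (v y ord0 j * teval p.2 y)) | p <- tsep t].

Lemma tvec_tconv m t (v : 'rV[R]_n -> 'rV[R]_m) x j :
  (forall i, mu.-integrable setT (EFin \o fun x => v x ord0 i)) ->
  tvec (tconv t v) x ord0 j = \int[mu]_y (v y ord0 j * teval t (y - x)).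
Proof.
move=> vL; rewrite tvec_coord /tconv big_map.
under [RHS]eq_Rintegral do rewrite tsepE mulr_sumr.
have vpL (p : tpoly R n * tpoly R n) := mul_teval_integrable p.2 (vL j).
rewrite Rintegral_bigsum; last first.
  move=> p _; have := integrable_scale (teval p.1 x) (vpL p).
  by congr (_.-integrable _ (_ \o _)); apply/funext => y; rewrite mulrCA.
apply: eq_bigr => p _; rewrite mxE -RintegralZl//.
by apply: eq_Rintegral => y _; rewrite mulrCA.
Qed.

Lemma diffop_tvec m l k (A : multi_index n k -> 'M[R]_(m, l))
    (L : seq (tpoly R n * 'rV[R]_m)) x :
  diffop A (tvec L) x = \sum_(a : multi_index n k | multi_order a == k)
    \sum_(p <- L) teval (tderivs (index_seq (fun i => a i)) p.1) x *: (p.2 *m A a).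
Proof.
rewrite /diffop; apply: eq_bigr => a _.
rewrite partial_multiE partials_tvec /tvec /tvderivs big_map mulmx_suml.
by apply: eq_bigr => p _; rewrite -scalemxAl.
Qed.

(** For fixed x, component j of the operator applied to the convolution is, up to the sign (-1)^k,
    the weak equation tested with the field y |-> t (y - x) e_j. *)
Lemma diffop_tconv m l k (A : multi_index n k -> 'M[R]_(m, l)) t
    (v : 'rV[R]_n -> 'rV[R]_m) x :
  (forall i, mu.-integrable setT (EFin \o fun x => v x ord0 i)) ->
  weak_free A v -> diffop A (tvec (tconv t v)) x = 0.
Proof.
move=> vL fv; apply/rowP => j; rewrite [RHS]mxE.
(* The field y |-> t (y - x) e_j, written in separated form so that it is visibly a trigonometric
   polynomial in y. *)
pose phi := tvec [seq (p.2, teval p.1 x *: (delta_mx ord0 j : 'rV[R]_l)) | p <- tsep t].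
have phiE s y j' : partials s phi y ord0 j' = teval (tderivs s t) (y - x) * (j' == j)%:R.
  rewrite partials_tvec tvec_coord /tvderivs !big_map -(tsep_derivr s t x y) mulr_suml.
  by apply: eq_bigr => p _; rewrite !mxE eqxx /= mulrA [teval _ y * _]mulrC.
have := fv phi (tvec_torus_smooth _).
rewrite -EFin_Rintegral; last exact: diffop_adj_integrable (tvec_torus_smooth _).
move=> [] I0.
rewrite diffop_tvec summxE.
pose ds (a : multi_index n k) := index_seq (fun i => a i).
have dL a i : mu.-integrable setT (EFin \o fun y =>
    v y ord0 i * teval (tderivs (ds a) t) (y - x)).
  have [M phiM] := partials_coord_bounded (ds a) j (tvec_torus_smooth
    [seq (p.2, teval p.1 x *: (delta_mx ord0 j : 'rV[R]_l)) | p <- tsep t]).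
  apply: (integrable_dominated _ _ (integrable_scale M (integrable_abs (vL i)))).
    apply: measurable_funM; first exact: integrable_measurable (vL i).
    have := @partials_coord_measurable _ _ _ phi (ds a) j (tvec_torus_smooth _).2.
    by congr measurable_fun; apply/funext => y; rewrite phiE eqxx mulr1.
  move=> y; rewrite normrM mulrC ler_wpM2r//.
  by have := phiM y; rewrite -/phi phiE eqxx mulr1.
have key a i : multi_order a == k ->
    \sum_(p <- tsep t) teval (tderivs (ds a) p.1) x * \int[mu]_y (v y ord0 i * teval p.2 y) =
    (-1) ^+ k * \int[mu]_y (v y ord0 i * teval (tderivs (ds a) t) (y - x)).
  move=> /eqP ak; rewrite -RintegralZl//.
  have vpL (p : tpoly R n) := mul_teval_integrable p (vL i).
  under eq_bigr do rewrite -RintegralZl//.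
  rewrite -Rintegral_bigsum; last by move=> p _; exact: integrable_scale.
  apply: eq_Rintegral => y _.
  have := tsep_derivl (ds a) t x y; rewrite size_index_seq -/(multi_order a) ak => E.
  by rewrite mulrCA -E mulr_sumr; apply: eq_bigr => p _; rewrite mulrCA.
apply: (@etrans _ _ ((-1) ^+ k * \int[mu]_y dotrv (v y) (diffop_adj A phi y))); last first.
  by rewrite I0 mulr0.
have -> : \int[mu]_y dotrv (v y) (diffop_adj A phi y) =
    \sum_(a : multi_index n k | multi_order a == k) \sum_(i < m)
      A a i j * \int[mu]_y (v y ord0 i * teval (tderivs (ds a) t) (y - x)).
  rewrite (_ : (fun y => _) = fun y => \sum_(a : multi_index n k | multi_order a == k)
      \sum_(i < m) A a i j * (v y ord0 i * teval (tderivs (ds a) t) (y - x))); last first.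
    apply/funext => y; rewrite dotrv_diffop_adj; apply: eq_bigr => a _.
    apply: eq_bigr => i _; rewrite (bigD1 j)//= phiE eqxx mulr1 big1 ?addr0// => j' /negPf j'j.
    by rewrite phiE j'j !mulr0.
  rewrite Rintegral_bigsum; last first.
    by move=> a _; apply: integrable_bigsum => i _; exact: integrable_scale.
  apply: eq_bigr => a _; rewrite Rintegral_bigsum; last first.
    by move=> i _; exact: integrable_scale.
  by apply: eq_bigr => i _; rewrite RintegralZl.
rewrite mulr_sumr; apply: eq_bigr => a ak.
rewrite summxE /tconv big_map mulr_sumr.
under eq_bigr do rewrite mxE mxE mulr_sumr.
rewrite exchange_big; apply: eq_bigr => i _ /=.
rewrite mulrCA -key// mulr_sumr; apply: eq_bigr => p _.
by rewrite mxE; ring.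
Qed.

End vector_trigonometric.

(** * Null Lagrangians *)

Section null_lagrangian.
Context {R : realType} {n : nat}.
Local Notation mu := (@torus_measure R n).
Let mu1 : mu setT = 1%E := @torus_measureT R n.

Definition tbump_factor (i : 'I_n) : tpoly R n :=
  TMul (TCst (1 / 2)) (TAdd (TCst 1) (TCos i)).

(* prod_i (1 + cos (2 pi y_i)) / 2 = prod_i cos (pi y_i) ^ 2 *)
Definition tbump : tpoly R n :=
  foldr (fun i t => TMul (tbump_factor i) t) (TCst 1) (enum 'I_n).

Lemma tbumpE y : teval tbump y = \prod_i teval (tbump_factor i) y.
Proof.
rewrite -big_enum /tbump /=; elim: (enum 'I_n) => [|i s IH]; first by rewrite big_nil.
by rewrite big_cons /= -IH.
Qed.

Lemma tbump_factor01 i y : 0 <= teval (tbump_factor i) y <= 1.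
Proof.
rewrite /=; move: (pi *+ 2 * _) => z.
by have := cos_geN1 z; have := cos_le1 z; lra.
Qed.

Lemma tbump01 y : 0 <= teval tbump y <= 1.
Proof.
rewrite tbumpE; apply/andP; split.
  by apply: prodr_ge0 => i _; case/andP: (tbump_factor01 i y).
by apply: prodr_ile1 => i _; exact: tbump_factor01.
Qed.

Lemma tbump_le_factor y i : teval tbump y <= teval (tbump_factor i) y.
Proof.
rewrite tbumpE (bigD1 i)//= -/(teval (tbump_factor i) y).
apply: ler_piMr; first by case/andP: (tbump_factor01 i y).
by apply: prodr_ile1 => j _; exact: tbump_factor01.
Qed.

Lemma tbump_near1 (d : R) : 0 < d -> exists2 a : R, 0 <= a < 1 &
  forall y, a < teval tbump y ->
    exists z : 'rV[int]_n, forall i, `|y ord0 i - (z ord0 i)%:~R| < d.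
Proof.
(* The cap 1 / 2 keeps 2 pi d' in [0, pi], where cos decreases; 1 / 2 is also the largest distance
   to the nearest integer, which [Num.floor (y ord0 i + 1 / 2)] selects below. *)
move=> d0; pose d' := Num.min d (1 / 2).
have d'0 : 0 < d' by rewrite lt_min d0 /=; lra.
have d'2 : d' <= 1 / 2 by rewrite ge_min lexx orbT.
have pi0 : 0 < pi :> R := pi_gt0 R.
have in_pi s : 0 <= s -> s <= 1 / 2 -> pi *+ 2 * s \in `[0, pi :> R].
  by move=> s0 s2; rewrite in_itv /= mulr2n; nra.
exists ((1 + cos (pi *+ 2 * d')) / 2).
  have := cos_geN1 (pi *+ 2 * d').
  have : cos (pi *+ 2 * d') < cos (pi *+ 2 * 0).
    have p0 : pi *+ 2 * 0 \in `[0, pi :> R] by apply: in_pi => //; lra.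
    by rewrite ltr_cos ?in_pi ?(ltW d'0)// ltr_pM2l// mulrn_wgt0.
  by rewrite mulr0 cos0; lra.
move=> y ay; exists (\row_i Num.floor (y ord0 i + 1 / 2)) => i; rewrite mxE.
have /andP[z1 z2] := floor_itv (y ord0 i + 1 / 2).
set z := Num.floor _ in z1 z2 *.
have {z2} : y ord0 i + 1 / 2 < z%:~R + 1 by rewrite intrD in z2.
move=> z2; have sb : `|y ord0 i - z%:~R| <= 1 / 2 by rewrite ler_norml; lra.
apply: lt_le_trans (_ : d' <= d); last by rewrite ge_min lexx.
have := lt_le_trans ay (tbump_le_factor y i); rewrite /= => H.
have : cos (pi *+ 2 * d') < cos (pi *+ 2 * `|y ord0 i - z%:~R|).
  have -> : cos (pi *+ 2 * `|y ord0 i - z%:~R|) = cos (pi *+ 2 * (y ord0 i - z%:~R)).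
    by case: (ger0P (y ord0 i - z%:~R)) => _ //; rewrite mulrN cosN.
  by rewrite -rmorphN periodic_intr; [lra|exact: cosD2pi].
by rewrite ltr_cos ?in_pi ?(ltW d'0)// ltr_pM2l// mulrn_wgt0.
Qed.

Lemma tbump_mass (b : R) : b < 1 -> (0 < mu [set y | (b < teval tbump y)%R])%E.
Proof.
move=> b1.
have t0 : teval tbump 0 = 1.
  by rewrite tbumpE big1// => i _ /=; rewrite mxE mulr0 cos0; lra.
have : nbhs (0 : 'rV[R]_n) [set y | b < teval tbump y].
  have := @teval_continuous R n tbump 0; rewrite /continuous_at t0 => /cvgrPdist_lt.
  have b10 : 0 < 1 - b by lra.
  move=> /(_ _ b10); apply: filterS => y; rewrite ltr_norml /=; lra.
move=> /nbhs_ballP [e /= e0 eb].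
pose s := Num.min e 1.
have s0 : 0 < s by rewrite lt_min e0 ltr01.
have mb : measurable [set y | b < teval tbump y].
  rewrite (_ : mkset _ = teval tbump @^-1` `]b, +oo[%classic); last first.
    by apply/seteqP; split=> x /=; rewrite in_itv/= andbT.
  by rewrite -[X in measurable X]setTI; exact: teval_measurable.
apply: (@lt_le_trans _ _ (lebesgue_rV n (hbox 0 s))).
  by rewrite lebesgue_hbox ?ltW// lte_fin exprn_gt0.
rewrite /torus_measure /= /mrestr unit_cubeE.
apply: le_measure; rewrite ?inE//; first exact: measurable_hbox.
  by apply: measurableI => //; exact: measurable_hbox.
have [se s1] : s <= e /\ s <= 1 by rewrite !ge_min !lexx orbT.
move=> y ys; split; last by move=> i; have := ys i; rewrite !mxE; lra.
apply: eb; split=> // i j; rewrite ord1 /=; have := ys j.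
by rewrite /ball /= !mxE ltr_norml; lra.
Qed.

Definition tkernel N : tpoly R n :=
  TMul (TCst (kernel_mass (teval tbump) N)^-1) (iter N (TMul tbump) (TCst 1)).

Lemma tkernelE N y : teval (tkernel N) y = kernel (teval tbump) N y.
Proof.
rewrite /tkernel /kernel /= mulrC; congr (_ / _).
by elim: N => [|N IH] /=; rewrite ?expr0// IH exprS.
Qed.

(** The regularity of Pi that the limits rely on: it converts L^1 closeness of uniformly bounded
    fields, and closeness of their means, into closeness of the values of Pi. *)
Definition lipschitz_on_bounded {m} (Pi : 'rV[R]_m -> R) :=
  forall M, exists2 K, 0 <= K & forall a b : 'rV[R]_m,
    (forall i, `|a ord0 i| <= M) -> (forall i, `|b ord0 i| <= M) ->
    `|Pi a - Pi b| <= K * \sum_i `|a ord0 i - b ord0 i|.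

Lemma measurable_coord_fun m (u : 'rV[R]_n -> 'rV[R]_m) i :
  measurable_fun setT u -> measurable_fun setT (fun x => u x ord0 i).
Proof. by move=> mu'; exact: (measurableT_comp (measurable_coord i) mu'). Qed.

Lemma measurable_rows m (u : 'rV[R]_n -> 'rV[R]_m) :
  (forall i, measurable_fun setT (fun x => u x ord0 i)) -> measurable_fun setT u.
Proof. by move=> mui; apply: measurable_fun_rV. Qed.

Lemma bounded_comp_integrable m (Pi : 'rV[R]_m -> R) (u : 'rV[R]_n -> 'rV[R]_m) M :
  measurable_fun setT Pi -> lipschitz_on_bounded Pi ->
  measurable_fun setT u -> (forall x i, `|u x ord0 i| <= M) ->
  mu.-integrable setT (EFin \o (Pi \o u)).
Proof.
move=> mPi lPi mu' uM.
(* For m = 0 the bound on the coordinates is vacuous and M may be negative, but then the field is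
   identically zero. *)
have [m0|m0] := posnP m; last first.
  have M0 : 0 <= M by apply: le_trans (uM 0 (Ordinal m0)).
  have [K K0 KP] := lPi M.
  apply: (integrable_bounded (M := `|Pi 0| + K * \sum_(i < m) M) mu1).
    exact: measurableT_comp.
  move=> x /=; have KPx : `|Pi (u x) - Pi 0| <= K * \sum_(i < m) M.
    have := KP (u x) 0 (uM x) => /(_ _)/le_trans; apply.
      by move=> i; rewrite mxE normr0.
    by rewrite ler_wpM2l//; apply: ler_sum => i _; rewrite mxE subr0.
  by have := ler_normD (Pi (u x) - Pi 0) (Pi 0); rewrite subrK; lra.
apply: (integrable_bounded (M := `|Pi 0|) mu1); first exact: measurableT_comp.
move=> x; rewrite /= (_ : u x = 0)//; apply/rowP => i.
by exfalso; have := ltn_ord i; rewrite [X in (_ < X)%N]m0.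
Qed.

Lemma tderivs_cst s (c : R) :
  tderivs s (TCst c : tpoly R n) = TCst (if s is [::] then c else 0).
Proof. by elim: s => //= i s ->. Qed.

(** Subtracting the mean as one more constant term keeps the field a trigonometric polynomial, and
    an operator of positive order does not see it. Quasiconvexity of Pi and of -Pi at the mean then
    give the two opposite inequalities. *)
Lemma null_lagrangian_tvec m l k (A : multi_index n k -> 'M[R]_(m, l))
    (Pi : 'rV[R]_m -> R) (L : seq (tpoly R n * 'rV[R]_m)) M :
  (0 < k)%N -> quasiaffine A Pi -> lipschitz_on_bounded Pi ->
  (forall x, diffop A (tvec L) x = 0) ->
  (forall x i, `|tvec L x ord0 i| <= M) ->
  \int[mu]_x Pi (tvec L x) = Pi (torus_mean (tvec L)).
Proof.
move=> k0 [[mPi _ qPi] [_ _ qNPi]] lPi AL LM.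
set c := torus_mean (tvec L).
pose L' := (TCst 1, - c) :: L.
have L'E x : c + tvec L' x = tvec L x.
  by rewrite /L' /tvec big_cons /= scale1r addrA subrr add0r.
have mL : measurable_fun setT (tvec L).
  apply: measurable_rows => i; apply: continuous_measurable_rV => x.
  apply: (@continuous_comp _ _ _ (tvec L) (fun w : 'rV[R]_m => w ord0 i)).
    exact: tvec_continuous.
  exact: coord_continuous.
have LL i : mu.-integrable setT (EFin \o fun x => tvec L x ord0 i).
  by apply: (integrable_bounded mu1 (measurable_coord_fun i mL)) => x; exact: LM.
have AL' x : diffop A (tvec L') x = 0.
  rewrite diffop_tvec -[RHS](AL x) diffop_tvec; apply: eq_bigr => a /eqP ak.
  rewrite big_cons /=.
  have : index_seq (fun i => a i) != [::].
    by rewrite -size_eq0 size_index_seq -/(multi_order a) ak -lt0n.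
  by case: index_seq => // i s _; rewrite tderivs_cst /= scale0r add0r.
have mean0 : torus_mean (tvec L') = 0.
  apply/rowP => i; rewrite !mxE.
  rewrite (_ : (fun x => _) = fun x => tvec L x ord0 i - c ord0 i); last first.
    by apply/funext => x; rewrite -L'E !mxE; lra.
  by rewrite RintegralB//; [rewrite Rintegral_cst_unit// mxE subrr|exact: integrable_cst_unit].
have PiL : mu.-integrable setT (EFin \o (Pi \o tvec L)).
  exact: bounded_comp_integrable LM.
have := qPi c _ (tvec_torus_smooth L') AL' mean0.
have := qNPi c _ (tvec_torus_smooth L') AL' mean0.
rewrite (_ : (fun x => _) = fun x => (-1 * Pi (tvec L x))%:E); last first.
  by apply/funext => x; rewrite L'E mulN1r.
rewrite (_ : (fun x => (Pi (c + tvec L' x))%:E) = fun x => (Pi (tvec L x))%:E); last first.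
  by apply/funext => x; rewrite L'E.
rewrite -EFin_Rintegral; last exact: integrable_scale PiL.
rewrite -EFin_Rintegral// RintegralZl// mulN1r !lee_fin lerN2 => h1 h2.
by apply/eqP; rewrite eq_le h1.
Qed.

(** The mollified fields obey the same bound M as v, so one Lipschitz constant of Pi turns L^1
    convergence of the coordinates into convergence of both sides. *)
Lemma null_lagrangian_bounded m l k (A : multi_index n k -> 'M[R]_(m, l))
    (Pi : 'rV[R]_m -> R) (v : 'rV[R]_n -> 'rV[R]_m) M :
  (0 < k)%N -> quasiaffine A Pi -> lipschitz_on_bounded Pi ->
  Zn_periodic v -> measurable_fun setT v -> (forall x i, `|v x ord0 i| <= M) ->
  weak_free A v -> \int[mu]_x Pi (v x) = Pi (torus_mean v).
Proof.
move=> k0 qPi lPi vper mv vM fv.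
have mPi : measurable_fun setT Pi by case: qPi => -[].
have mvi i := measurable_coord_fun i mv.
have viper i : Zn_periodic (fun x => v x ord0 i) by move=> x z; rewrite vper.
have vL i : mu.-integrable setT (EFin \o fun x => v x ord0 i).
  exact: (integrable_bounded mu1 (mvi i) (fun x => vM x i)).
pose w N := tvec (tconv (tkernel N) v).
have wE N x i : w N x ord0 i = mollify (teval tbump) N (fun y => v y ord0 i) x.
  by rewrite /w tvec_tconv//; apply: eq_Rintegral => y _; rewrite tkernelE.
have wM N x i : `|w N x ord0 i| <= M.
  rewrite wE; apply: mollify_bounded => //.
  - exact: teval_measurable.
  - exact: tbump01.
  - exact: teval_periodic.
  - exact: tbump_mass.
have mwi N i : measurable_fun setT (fun x => w N x ord0 i).
  apply: continuous_measurable_rV => x.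
  apply: (@continuous_comp _ _ _ (w N) (fun u : 'rV[R]_m => u ord0 i)).
    exact: tvec_continuous.
  exact: coord_continuous.
have mw N : measurable_fun setT (w N) by apply: measurable_rows.
have wL N i : mu.-integrable setT (EFin \o fun x => w N x ord0 i).
  exact: (integrable_bounded mu1 (mwi N i) (fun x => wM N x i)).
have dL N i : mu.-integrable setT (EFin \o fun x => `|w N x ord0 i - v x ord0 i|).
  exact/integrable_abs/integrable_sub.
have [K K0 KP] := lPi M.
have mean_M (u : 'rV[R]_n -> 'rV[R]_m) i : measurable_fun setT u ->
    (forall x i, `|u x ord0 i| <= M) -> `|torus_mean u ord0 i| <= M.
  move=> mu' uM; have mui := measurable_coord_fun i mu'.
  have uL := integrable_bounded mu1 mui (fun x => uM x i).
  rewrite mxE -[leRHS](Rintegral_cst_unit mu1).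
  apply: le_trans (le_normr_Rintegral _ uL) _ => //.
  by apply: le_Rintegral => //; [exact: integrable_abs|exact: integrable_cst_unit].
have close N : `|\int[mu]_x Pi (v x) - Pi (torus_mean v)| <=
    2 * K * \sum_i \int[mu]_x `|w N x ord0 i - v x ord0 i|.
  have wN : \int[mu]_x Pi (w N x) = Pi (torus_mean (w N)).
    apply: (null_lagrangian_tvec k0 qPi lPi _ (wM N)) => x.
    exact: diffop_tconv.
  have PvL := bounded_comp_integrable mPi lPi mv vM.
  have PwL := bounded_comp_integrable mPi lPi (mw N) (wM N).
  have h1 : `|\int[mu]_x Pi (v x) - \int[mu]_x Pi (w N x)| <=
      K * \sum_i \int[mu]_x `|w N x ord0 i - v x ord0 i|.
    rewrite -RintegralB//; apply: le_trans (le_normr_Rintegral _ (integrable_sub PvL PwL)) _ => //.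
    rewrite -Rintegral_bigsum; last by move=> i _.
    rewrite -RintegralZl//; last by apply: integrable_bigsum => i _.
    apply: le_Rintegral => //.
    - exact/integrable_abs/integrable_sub.
    - by apply: integrable_scale; apply: integrable_bigsum => i _.
    by move=> x _; rewrite distrC; exact: KP.
  have h2 : `|Pi (torus_mean (w N)) - Pi (torus_mean v)| <=
      K * \sum_i \int[mu]_x `|w N x ord0 i - v x ord0 i|.
    apply: le_trans (KP _ _ _ _) _; [by move=> i; exact: mean_M..|].
    rewrite ler_wpM2l//; apply: ler_sum => i _.
    rewrite !mxE -RintegralB//.
    by apply: le_normr_Rintegral => //; exact: integrable_sub.
  have := ler_normD (\int[mu]_x Pi (v x) - \int[mu]_x Pi (w N x))
    (Pi (torus_mean (w N)) - Pi (torus_mean v)).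
  rewrite wN in h1 *; rewrite addrA subrK; lra.
apply/eqP; rewrite -subr_eq0 -normr_le0; apply/ler_addgt0Pr => e e0; rewrite add0r.
pose e' := e / (2 * K * m%:R + 1).
have c0 : 0 < 2 * K * m%:R + 1 by rewrite ltr_wpDl// !mulr_ge0.
have e'0 : 0 < e' by rewrite divr_gt0.
have [N NP] : exists N, forall i, \int[mu]_x `|w N x ord0 i - v x ord0 i| <= e'.
  have H i : exists N0, forall N, (N0 <= N)%N ->
      \int[mu]_x `|w N x ord0 i - v x ord0 i| <= e'.
    have [||||||N0 N0P] := @mollify_cvg R n (teval tbump) _ _ _ _ _ _ M e' (mvi i) (viper i)
      (fun x => vM x i) _ e'0.
    - exact: teval_measurable.
    - exact: tbump01.
    - exact: teval_periodic.
    - exact: tbump_near1.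
    - exact: tbump_mass.
    - move=> N; rewrite (_ : mollify _ _ _ = fun x => w N x ord0 i)//.
      by apply/funext => x; rewrite wE.
    exists N0 => N /N0P; congr (_ <= _).
    by apply: eq_Rintegral => x _; rewrite wE.
  have [f fP] := choice H.
  exists (\max_i f i)%N => i; apply: fP.
  exact: leq_bigmax.
apply: le_trans (close N) _.
apply: (@le_trans _ _ (2 * K * \sum_(i < m) e')).
  by rewrite ler_wpM2l ?mulr_ge0//; apply: ler_sum => i _; exact: NP.
have eE : e = e' * (2 * K * m%:R + 1) by rewrite divfK// gt_eqF.
rewrite sumr_const card_ord -[_ *+ m]mulr_natr [leRHS]eE.
rewrite (_ : 2 * K * (e' * m%:R) = e' * (2 * K * m%:R)); last by ring.
by rewrite ler_pM2l// lerDl.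
Qed.

End null_lagrangian.

(** * Higher integrability *)

Section gehring.
Context d (T : measurableType d) {R : realType} (mu : {measure set T -> \bar R}).
Hypothesis mu1 : (mu setT = 1)%E.
Local Notation L1 f := (mu.-integrable setT (EFin \o f)).

Definition upper_power (p : R) (w : T -> R) (s : R) (x : T) : R :=
  if s < w x then w x `^ p else 0.

Variables (w : T -> R) (p : R).
Hypotheses (mw : measurable_fun setT w) (w0 : forall x, 0 <= w x) (p1 : 1 < p).
Hypothesis wp : L1 (fun x => w x `^ p).

Local Notation phi s := (\int[mu]_x upper_power p w s x).

Lemma measurable_upper_power s : measurable_fun setT (upper_power p w s).
Proof.
apply: measurable_fun_ifT => //; first exact: measurable_fun_ltr.
exact: integrable_measurable wp.
Qed.

Lemma upper_power_ge0 s x : 0 <= upper_power p w s x.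
Proof. by rewrite /upper_power; case: ifP => // _; exact: powR_ge0. Qed.

Lemma upper_power_le s x : upper_power p w s x <= w x `^ p.
Proof. by rewrite /upper_power; case: ifP => // _; exact: powR_ge0. Qed.

Lemma upper_power_integrable s : L1 (upper_power p w s).
Proof.
apply: (integrable_dominated _ _ wp); first exact: measurable_upper_power.
by move=> x; rewrite ger0_norm ?upper_power_ge0// upper_power_le.
Qed.

Lemma phi_anti s t : s <= t -> phi t <= phi s.
Proof.
move=> st; apply: le_Rintegral => //; try exact: upper_power_integrable.
move=> x _; rewrite /upper_power; case: ifPn => [tw|_].
  by rewrite (le_lt_trans st tw).
by case: ifP => // _; exact: powR_ge0.
Qed.

Variables (a K : R).
Hypotheses (a1 : 1 <= a) (K0 : 0 < K).

(** At least a, and large enough that its power p - 1 is at least 2 K: the part of the tail beyond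
    [ratio * t] then returns with factor at most 1 / 2. *)
Definition ratio : R := a + (2 * K) `^ (p - 1)^-1.

(** With k = K 2^(p-1), hole filling gives phi (ratio t) <= k (phi (t/2) - phi (ratio t)) + phi
    (ratio t) / 2; solving for phi (ratio t) yields k / (k + 1/2). *)
Definition decay : R := K * 2 `^ (p - 1) / (K * 2 `^ (p - 1) + 1 / 2).

Lemma ratio_ge1 : 1 <= ratio.
Proof. by rewrite (le_trans a1)// lerDl powR_ge0. Qed.

Lemma ratio_power : 2 * K <= ratio `^ (p - 1).
Proof.
have p10 : 0 < p - 1 by rewrite subr_gt0.
have -> : 2 * K = ((2 * K) `^ (p - 1)^-1) `^ (p - 1).
  by rewrite -powRrM mulVf ?gt_eqF// powRr1// mulr_ge0// ltW.
rewrite ge0_ler_powR ?nnegrE ?powR_ge0//; first exact: ltW.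
  by apply: le_trans ratio_ge1.
by rewrite lerDr (le_trans _ a1).
Qed.

Lemma hole_filling t : 0 < t ->
  phi (a * t) <= K * t `^ (p - 1) * \int[mu]_x upper_part w (t / 2) x ->
  phi (ratio * t) <= decay * phi (t / 2).
Proof.
move=> t0 H; have := p1; have := a1; have := K0 => k0 a1' p1'.
have p10 : 0 < p - 1 by lra.
have B1 := ratio_ge1; have B0 : 0 < ratio by lra.
have [p10' B0' t0'] : [/\ 0 <= p - 1, 0 <= ratio & 0 <= t] by split; exact: ltW.
have wpE x : 0 < w x -> w x `^ p = w x `^ (p - 1) * w x.
  move=> wx; rewrite -[X in _ = _ * X](powRr1 (w0 x)) -powRD ?subrK//.
  by apply/implyP => _; rewrite gt_eqF.
(* Between t / 2 and [ratio * t] one uses t <= 2 w; above [ratio * t] the sharper t <= w / ratio. *)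
have pt x : t `^ (p - 1) * upper_part w (t / 2) x <=
    2 `^ (p - 1) * (upper_power p w (t / 2) x - upper_power p w (ratio * t) x) +
    (ratio `^ (p - 1))^-1 * upper_power p w (ratio * t) x.
  rewrite /upper_part /upper_power; case: ifPn => [tw|]; last first.
    rewrite -leNgt => wt; rewrite ltNge (le_trans wt) /=; last by nra.
    by rewrite subr0 !mulr0 addr0.
  have wx0 : 0 < w x by lra.
  case: ifPn => [Btw|_].
    rewrite subrr mulr0 add0r wpE// mulrA ler_wpM2r//.
    rewrite ler_pdivlMl ?powR_gt0// -powRM//.
    by apply: ge0_ler_powR; rewrite ?nnegrE ?mulr_ge0//; exact: ltW.
  rewrite subr0 mulr0 addr0 wpE// mulrA ler_wpM2r// -powRM//.
  by apply: ge0_ler_powR; rewrite ?nnegrE ?mulr_ge0//; lra.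
have oneL : L1 (upper_part w (t / 2)).
  apply: (integrable_dominated _ _ (integrable_scale ((t / 2) `^ (p - 1))^-1
    (upper_power_integrable (t / 2)))).
    by apply: measurable_fun_ifT => //; exact: measurable_fun_ltr.
  move=> x; rewrite /upper_part /upper_power; case: ifPn => [tw|]; last first.
    by rewrite normr0 mulr0.
  rewrite ger0_norm// wpE; last by lra.
  rewrite mulrA ler_peMl// ler_pdivlMl ?powR_gt0 ?divr_gt0// mulr1.
  by rewrite ge0_ler_powR ?nnegrE//; lra.
have upL := upper_power_integrable.
have H2 : t `^ (p - 1) * \int[mu]_x upper_part w (t / 2) x <=
    2 `^ (p - 1) * (phi (t / 2) - phi (ratio * t)) +
    (ratio `^ (p - 1))^-1 * phi (ratio * t).
  rewrite -RintegralB// -!RintegralZl//; last exact: integrable_sub.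
  rewrite -RintegralD//; last 2 first.
  - exact/integrable_scale/integrable_sub.
  - exact: integrable_scale.
  apply: le_Rintegral => //; first exact: integrable_scale.
  apply: integrable_add; last exact: integrable_scale.
  exact/integrable_scale/integrable_sub.
have phi_at : phi (ratio * t) <= phi (a * t).
  by apply: phi_anti; rewrite ler_pM2r// /ratio lerDl powR_ge0.
have phi0 : 0 <= phi (ratio * t).
  by apply: Rintegral_ge0 => x _; exact: upper_power_ge0.
have KB : K * (ratio `^ (p - 1))^-1 <= 1 / 2.
  by rewrite ler_pdivrMr ?powR_gt0//; have := ratio_power; lra.
have c0 : 0 <= K * 2 `^ (p - 1) by rewrite mulr_ge0 ?powR_ge0// ltW.
rewrite /decay mulrAC ler_pdivlMr; last by lra.
have H3 : phi (ratio * t) <= K * 2 `^ (p - 1) * (phi (t / 2) - phi (ratio * t)) +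
    K * (ratio `^ (p - 1))^-1 * phi (ratio * t).
  apply: le_trans phi_at _; apply: (le_trans H).
  by rewrite -!mulrA -mulrDr ler_pM2l.
nra.
Qed.

Lemma geometric_decay s0 b th : 0 < s0 -> 1 < b -> 0 <= th ->
  (forall s, s0 <= s -> phi (b * s) <= th * phi s) ->
  forall j, phi (s0 * b ^+ j) <= th ^+ j * phi s0.
Proof.
move=> s00 b1 th0 H; elim=> [|j IH]; first by rewrite !expr0 mulr1 mul1r.
rewrite exprS mulrCA; apply: le_trans (H _ _) _.
  by rewrite ler_peMr ?exprn_ege1 ?ltW.
by rewrite exprS -mulrA ler_wpM2l.
Qed.

Lemma geometric_layer (s0 b x : R) : 0 < s0 -> 1 < b -> s0 < x ->
  exists j, s0 * b ^+ j < x <= s0 * b ^+ j.+1.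
Proof.
move=> s00 b1 s0x.
have ex : exists j, x <= s0 * b ^+ j.+1.
  have b0 : 0 < b by apply: lt_trans b1.
  have [||N0 /(_ N0.+1 (leqnSn _))] := @geometric_small R b^-1 (x / s0) 1 _ _ ltr01.
  - by rewrite invr_ge0 ltW.
  - by rewrite invf_lt1.
  rewrite exprVn ler_pdivrMr ?exprn_gt0// mul1r ler_pdivrMr// mulrC => h.
  by exists N0.
exists (ex_minn ex); case: ex_minnP => j xj jmin; rewrite xj andbT.
case: j xj jmin => [|j] xj jmin; first by rewrite expr0 mulr1.
by rewrite ltNge; apply/negP => /jmin; rewrite ltnn.
Qed.

Lemma geometric_sum_le (r : R) k : 0 <= r -> r < 1 -> \sum_(j < k) r ^+ j <= (1 - r)^-1.
Proof.
move=> r0 r1; have r10 : 0 < 1 - r by rewrite subr_gt0.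
elim: k => [|k IH]; first by rewrite big_ord0 invr_ge0 ltW.
rewrite big_ord_recl expr0; under eq_bigr do rewrite exprS.
rewrite -mulr_sumr; have : r * \sum_(j < k) r ^+ j <= r * (1 - r)^-1 by rewrite ler_wpM2l.
have : (1 - r) * (1 - r)^-1 = 1 by rewrite divff ?gt_eqF.
by move: (\sum_(_ < _) _) (_^-1) => S q; lra.
Qed.

(** On the layer between s0 b^j and s0 b^(j+1), w^e is at most the e-th power of the upper end, so
    w^(p+e) is dominated by a weighted sum of truncated powers w^p whose integrals are the tails. *)
Lemma gehring_integrability s0 b th e : 0 < s0 -> 1 < b -> 0 <= th -> 0 < e ->
  b `^ e * th < 1 ->
  (forall s, s0 <= s -> phi (b * s) <= th * phi s) ->
  L1 (fun x => w x `^ (p + e)).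
Proof.
move=> s00 b1 th0 e0 bth H.
have b0 : 0 < b by apply: lt_trans b1.
have mwe : measurable_fun setT (fun x => w x `^ (p + e)).
  exact: (measurableT_comp (measurable_powR _) mw).
pose c j := (s0 * b ^+ j.+1) `^ e.
have c0 j : 0 <= c j by exact: powR_ge0.
pose F j x := (c j * upper_power p w (s0 * b ^+ j) x)%:E.
have F0 j x : (0 <= F j x)%E by rewrite lee_fin mulr_ge0 ?upper_power_ge0.
have mF j : measurable_fun setT (F j).
  by apply/measurable_EFinP/measurable_funM => //; exact: measurable_upper_power.
have wle x : ((w x `^ (p + e))%:E <= (s0 `^ e * w x `^ p)%:E + \sum_(0 <= j <oo) F j x)%E.
  have wpe : w x `^ (p + e) = w x `^ e * w x `^ p.
    rewrite addrC powRD//; apply/implyP => /eqP pe0; exfalso.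
    by have := addr_gt0 e0 (lt_trans ltr01 p1); rewrite pe0 ltxx.
  have e0' := ltW e0.
  have [ws|sw] := leP (w x) s0.
    apply: (@le_trans _ _ (s0 `^ e * w x `^ p)%:E).
      rewrite lee_fin wpe ler_wpM2r ?powR_ge0//.
      by apply: ge0_ler_powR; rewrite ?nnegrE// ltW.
    by rewrite leeDl// nneseries_ge0.
  have [j /andP[j1 j2]] := geometric_layer s00 b1 sw.
  apply: (@le_trans _ _ (F j x)).
    rewrite /F lee_fin /upper_power j1 wpe ler_wpM2r ?powR_ge0//.
    apply: ge0_ler_powR; rewrite ?nnegrE//.
    by rewrite mulr_ge0 ?exprn_ge0// ltW.
  apply: (@le_trans _ _ (\sum_(0 <= j <oo) F j x)%E).
    by rewrite (nneseriesD1 (n := j))// leeDl// nneseries_ge0.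
  by rewrite leeDr// lee_fin mulr_ge0 ?powR_ge0.
apply/integrableP; split; first exact/measurable_EFinP.
(* Passing to the next layer multiplies the weight by b^e and the tail bound by th. *)
pose r := b `^ e * th.
have r0 : 0 <= r by rewrite mulr_ge0 ?powR_ge0.
pose D := (s0 * b) `^ e * phi s0.
have phi0 : 0 <= phi s0 by apply: Rintegral_ge0 => x _; exact: upper_power_ge0.
have D0 : 0 <= D by rewrite mulr_ge0 ?powR_ge0.
have FD j : (\int[mu]_x F j x <= (D * r ^+ j)%:E)%E.
  have upL := upper_power_integrable (s0 * b ^+ j).
  rewrite -EFin_Rintegral; last exact: integrable_scale.
  rewrite lee_fin RintegralZl//.
  have -> : D * r ^+ j = c j * (th ^+ j * phi s0).
    have [s0' b0'] := (ltW s00, ltW b0).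
    have cE : c j = (s0 * b) `^ e * (b `^ e) ^+ j.
      rewrite /c exprS mulrA powRM ?mulr_ge0 ?exprn_ge0//; congr (_ * _).
      by rewrite -(powR_mulrn j b0') -(powR_mulrn j (powR_ge0 b e)) -!powRrM mulrC.
    by rewrite cE /D /r exprMn; ring.
  by rewrite ler_wpM2l//; apply: geometric_decay.
apply: (@le_lt_trans _ _ (((s0 `^ e * \int[mu]_x w x `^ p)%:E + (D * (1 - r)^-1)%:E))%E);
  last by rewrite -EFinD ltry.
apply: (@le_trans _ _ (\int[mu]_x ((s0 `^ e * w x `^ p)%:E + \sum_(0 <= j <oo) F j x))%E).
  apply: ge0_le_integral => //.
  - by apply: measurableT_comp => //; exact/measurable_EFinP.
  - apply: emeasurable_funD; last exact: ge0_emeasurable_sum.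
    by apply/measurable_EFinP/measurable_funM => //; exact: integrable_measurable wp.
  by move=> x _; rewrite /= ger0_norm ?powR_ge0.
rewrite ge0_integralD//; last 4 first.
- by move=> x _; rewrite lee_fin mulr_ge0 ?powR_ge0.
- by apply/measurable_EFinP/measurable_funM => //; exact: integrable_measurable wp.
- by move=> x _; exact: nneseries_ge0.
- exact: ge0_emeasurable_sum.
apply: leeD.
  rewrite -EFin_Rintegral; last exact: integrable_scale.
  by rewrite RintegralZl.
rewrite integral_nneseries//.
apply: lime_le.
  by apply: is_cvg_nneseries => j _ _; exact: integral_ge0.
apply: nearW => k.
apply: (@le_trans _ _ (\sum_(0 <= j < k) (D * r ^+ j)%:E)%E); first exact: lee_sum.
rewrite sumEFin lee_fin -mulr_sumr ler_wpM2l// big_mkord.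
exact: geometric_sum_le.
Qed.

End gehring.

(** * Local Lipschitz bounds for polynomials *)

Section polynomials_lipschitz.
Context {R : realType} {m : nat}.
Implicit Types f g : 'rV[R]_m -> R.

Lemma lipschitz_bounded f M : lipschitz_on_bounded f -> 0 <= M ->
  exists2 B, 0 <= B & forall a : 'rV[R]_m, (forall i, `|a ord0 i| <= M) -> `|f a| <= B.
Proof.
move=> lf M0; have [K K0 KP] := lf M.
exists (`|f 0| + K * \sum_(i < m) M); first by rewrite addr_ge0// mulr_ge0// sumr_ge0.
move=> a aM; have KPa : `|f a - f 0| <= K * \sum_(i < m) M.
  have := KP a 0 aM => /(_ _)/le_trans; apply; first by move=> i; rewrite mxE normr0.
  by rewrite ler_wpM2l//; apply: ler_sum => i _; rewrite mxE subr0.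
by have := ler_normD (f a - f 0) (f 0); rewrite subrK; lra.
Qed.

Lemma lipschitz_cst c : lipschitz_on_bounded (fun _ : 'rV[R]_m => c).
Proof. by move=> M; exists 0 => // a b _ _; rewrite subrr normr0 mul0r. Qed.

Lemma lipschitz_coord i : lipschitz_on_bounded (fun a : 'rV[R]_m => a ord0 i).
Proof.
move=> M; exists 1 => // a b _ _; rewrite mul1r (bigD1 i)//= lerDl.
by apply: sumr_ge0.
Qed.

Lemma lipschitz_add f g : lipschitz_on_bounded f -> lipschitz_on_bounded g ->
  lipschitz_on_bounded (fun a => f a + g a).
Proof.
move=> lf lg M; have [K K0 KP] := lf M; have [K' K'0 KP'] := lg M.
exists (K + K'); first exact: addr_ge0.
move=> a b aM bM; rewrite opprD addrACA (le_trans (ler_normD _ _))// mulrDl lerD//.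
  exact: KP.
exact: KP'.
Qed.

Lemma lipschitz_mul f g : lipschitz_on_bounded f -> lipschitz_on_bounded g ->
  lipschitz_on_bounded (fun a => f a * g a).
Proof.
(* A negative M admits points only for m = 0, where all points coincide. *)
move=> lf lg M; have [M0|M0] := leP 0 M; last first.
  exists 0 => // a b aM bM; have [m0|m0] := posnP m; last first.
    by have := le_lt_trans (aM (Ordinal m0)) M0; rewrite normr_lt0.
  rewrite (_ : a = b) ?subrr ?normr0 ?mul0r//; apply/rowP => i.
  by exfalso; have := ltn_ord i; rewrite [X in (_ < X)%N]m0.
have [K K0 KP] := lf M; have [K' K'0 KP'] := lg M.
have [B B0 BP] := lipschitz_bounded lf M0; have [B' B'0 BP'] := lipschitz_bounded lg M0.
exists (B * K' + B' * K); first by rewrite addr_ge0 ?mulr_ge0.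
move=> a b aM bM.
rewrite (_ : _ - _ = f a * (g a - g b) + g b * (f a - f b)); last by ring.
rewrite (le_trans (ler_normD _ _))// mulrDl !normrM -!mulrA lerD//.
  by rewrite ler_pM// ?BP ?KP'.
by rewrite ler_pM// ?BP' ?KP.
Qed.

Lemma lipschitz_polynomial p (Pi : 'rV[R]_m -> R) :
  homogeneous_polynomial p Pi -> lipschitz_on_bounded Pi.
Proof.
move=> [q [_ PiE]].
rewrite (_ : Pi = fun w : 'rV[R]_m => \sum_(a <- mpoly.msupp q)
    mpoly.mcoeff a q * \prod_i w ord0 i ^+ (mpoly.fun_of_multinom a i)); last first.
  by apply/funext => w; rewrite PiE mpoly.mevalE.
elim: (mpoly.msupp _) => [|a s IH].
  rewrite (_ : (fun w => _) = fun=> 0); first exact: lipschitz_cst.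
  by apply/funext => w; rewrite big_nil.
rewrite (_ : (fun w => _) = fun w : 'rV[R]_m =>
    mpoly.mcoeff a q * \prod_i w ord0 i ^+ (mpoly.fun_of_multinom a i) +
    \sum_(a <- s) mpoly.mcoeff a q * \prod_i w ord0 i ^+ (mpoly.fun_of_multinom a i)).
  apply: lipschitz_add IH; apply: lipschitz_mul; first exact: lipschitz_cst.
  elim: (index_enum _) => [|i r IHr].
    rewrite (_ : (fun w => _) = fun=> 1); first exact: lipschitz_cst.
    by apply/funext => w; rewrite big_nil.
  rewrite (_ : (fun w => _) = fun w : 'rV[R]_m =>
      w ord0 i ^+ (mpoly.fun_of_multinom a i) *
      \prod_(j <- r) w ord0 j ^+ (mpoly.fun_of_multinom a j)).
    apply: lipschitz_mul IHr; elim: (mpoly.fun_of_multinom a i) => [|k IHk].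
      exact: lipschitz_cst.
    rewrite (_ : (fun w => _) = fun w : 'rV[R]_m => w ord0 i * w ord0 i ^+ k).
      by apply: lipschitz_mul IHk; exact: lipschitz_coord.
    by apply/funext => w; rewrite exprS.
  by apply/funext => w; rewrite big_cons.
by apply/funext => w; rewrite big_cons.
Qed.

End polynomials_lipschitz.

(** * The Euclidean norm *)

Section euclidean_norm.
Context {R : realType} {m : nat}.
Implicit Types a b : 'rV[R]_m.

Lemma enorm_ge0 a : 0 <= enorm a.
Proof. exact: sqrtr_ge0. Qed.

Lemma enorm0 : enorm (0 : 'rV[R]_m) = 0.
Proof. by rewrite /enorm big1 ?sqrtr0// => i _; rewrite mxE expr0n. Qed.

Lemma enorm_eq0 a : enorm a = 0 -> a = 0.
Proof.
move=> a0; apply/rowP => i; rewrite mxE; apply/eqP; rewrite -normr_le0 -a0.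
exact: coord_le_enorm.
Qed.

Lemma sqr_enorm a : enorm a ^+ 2 = dotrv a a.
Proof.
rewrite sqr_sqrtr; first by apply: eq_bigr => i _; rewrite expr2.
by apply: sumr_ge0 => i _; exact: sqr_ge0.
Qed.

Lemma dotrv_le a b : dotrv a b <= enorm a * enorm b.
Proof.
have A := enorm_ge0 a; have B := enorm_ge0 b.
have [a0|a0] := eqVneq (enorm a) 0.
  rewrite (enorm_eq0 a0) enorm0 mul0r /dotrv big1// => i _.
  by rewrite mxE mul0r.
have [b0|b0] := eqVneq (enorm b) 0.
  rewrite (enorm_eq0 b0) enorm0 mulr0 /dotrv big1// => i _.
  by rewrite mxE mulr0.
have A0 : 0 < enorm a by rewrite lt_def a0.
have B0 : 0 < enorm b by rewrite lt_def b0.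
have : 0 <= \sum_i (enorm b * a ord0 i - enorm a * b ord0 i) ^+ 2.
  by apply: sumr_ge0 => i _; exact: sqr_ge0.
rewrite (_ : \sum_i _ = enorm b ^+ 2 * enorm a ^+ 2 * 2 -
    2 * (enorm a * enorm b) * dotrv a b).
  by move=> H; rewrite -(ler_pM2l (mulr_gt0 A0 B0)); nra.
rewrite !sqr_enorm /dotrv.
rewrite (eq_bigr (fun i => enorm b ^+ 2 * (a ord0 i * a ord0 i) +
  enorm a ^+ 2 * (b ord0 i * b ord0 i) - 2 * (enorm a * enorm b) * (a ord0 i * b ord0 i))).
  by rewrite sumrB big_split /= -!mulr_sumr -!/(dotrv _ _) -!sqr_enorm; ring.
by move=> i _; ring.
Qed.

Lemma enormD a b : enorm (a + b) <= enorm a + enorm b.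
Proof.
have A := enorm_ge0 a; have B := enorm_ge0 b.
rewrite -(@ler_pXn2r _ 2) ?nnegrE ?enorm_ge0 ?addr_ge0// sqr_enorm.
rewrite (_ : dotrv _ _ = enorm a ^+ 2 + 2 * dotrv a b + enorm b ^+ 2).
  by have := dotrv_le a b; nra.
rewrite !sqr_enorm /dotrv mulr_sumr -!big_split /=; apply: eq_bigr => i _.
by rewrite !mxE; ring.
Qed.

End euclidean_norm.

(** * Fields in L^p and their truncation *)

Section torus_Lp.
Context {R : realType} {n m : nat}.
Local Notation mu := (@torus_measure R n).
Let mu1 : mu setT = 1%E := @torus_measureT R n.
Local Notation L1 f := (mu.-integrable setT (EFin \o f)).
Implicit Types u v : 'rV[R]_n -> 'rV[R]_m.

Lemma measurable_enorm_comp u : measurable_fun setT u ->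
  measurable_fun setT (fun x => enorm (u x)).
Proof. by move=> mu'; exact: (measurableT_comp (@measurable_enorm R m) mu'). Qed.

Lemma measurable_enorm_powR u p : measurable_fun setT u ->
  measurable_fun setT (fun x => enorm (u x) `^ p).
Proof.
move=> mu'; exact: (measurableT_comp (measurable_powR _) (measurable_enorm_comp mu')).
Qed.

Lemma finite_norm_powR u p : 0 < p -> measurable_fun setT u ->
  finite_norm mu p%:E (fun x => enorm (u x)) <-> L1 (fun x => enorm (u x) `^ p).
Proof.
move=> p0 mu'.
have E : (\int[mu]_x (`|(EFin \o fun x => enorm (u x)) x| `^ p) =
    \int[mu]_x `|(enorm (u x) `^ p)%:E|)%E.
  apply: eq_integral => x _ /=.
  by rewrite (ger0_norm (enorm_ge0 _)) ger0_norm// powR_ge0.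
rewrite /finite_norm unlock /Lnorm E; split=> [H|/integrableP[_ H]].
  apply/integrableP; split.
    by apply/measurable_EFinP; exact: measurable_enorm_powR.
  by apply: lty_poweRy H; rewrite invr_neq0// gt_eqF.
exact: poweR_lty.
Qed.

Lemma ess_bounded u c :
  (Lnorm mu +oo (fun x => (enorm (u x))%:E) <= c%:E)%E ->
  {ae mu, forall x, enorm (u x) <= c}.
Proof.
rewrite unlock /Lnorm mu1 lte01 => /ess_supP; apply: filterS => x /=.
by rewrite lee_fin ger0_norm// enorm_ge0.
Qed.

Lemma powR_le1D p (a : R) : 1 <= p -> 0 <= a -> a <= 1 + a `^ p.
Proof.
move=> p1 a0; have [a1|a1] := leP a 1; first by have := powR_ge0 a p; lra.
apply: ler_wpDl => //; rewrite -{1}(powRr1 a0); apply: ler_powR => //; exact: ltW.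
Qed.

Lemma powR_sub1_le p (a : R) : 1 <= p -> 0 <= a -> a `^ (p - 1) <= 1 + a `^ p.
Proof.
move=> p1 a0; have [a1|a1] := leP a 1.
  apply: ler_wpDr; first exact: powR_ge0.
  rewrite [leRHS](_ : 1 = 1 `^ (p - 1)); last by rewrite powR1.
  by apply: ge0_ler_powR; rewrite ?nnegrE//; lra.
by apply: ler_wpDl => //; apply: ler_powR; [exact: ltW|lra].
Qed.

Lemma powRD_le p (a b : R) : 0 <= p -> 0 <= a -> 0 <= b ->
  (a + b) `^ p <= 2 `^ p * (a `^ p + b `^ p).
Proof.
move=> p0 a0 b0; wlog ab : a b a0 b0 / a <= b.
  move=> H; have [/H->//|/ltW ba] := leP a b.
  by rewrite addrC [X in _ * X]addrC; exact: H.
apply: (@le_trans _ _ ((2 * b) `^ p)).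
  by apply: ge0_ler_powR; rewrite ?nnegrE ?addr_ge0 ?mulr_ge0//; lra.
by rewrite powRM// ler_wpM2l ?powR_ge0// lerDr powR_ge0.
Qed.

Lemma Lp_L1 u p : 1 <= p -> measurable_fun setT u ->
  L1 (fun x => enorm (u x) `^ p) -> L1 (fun x => enorm (u x)).
Proof.
move=> p1 mu' up.
apply: (integrable_dominated _ _ (integrable_add (integrable_cst_unit mu1 1) up)).
  exact: measurable_enorm_comp.
by move=> x; rewrite ger0_norm ?enorm_ge0//; apply: powR_le1D => //; exact: enorm_ge0.
Qed.

Lemma L1_coord u i : measurable_fun setT u -> L1 (fun x => enorm (u x)) ->
  L1 (fun x => u x ord0 i).
Proof.
move=> mu' uL; apply: (integrable_dominated _ _ uL); first exact: measurable_coord_fun.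
by move=> x; exact: coord_le_enorm.
Qed.

Lemma weak_free_ae l k (A : multi_index n k -> 'M[R]_(m, l)) u v :
  measurable_fun setT u -> measurable_fun setT v ->
  {ae mu, forall x, u x = v x} -> weak_free A u -> weak_free A v.
Proof.
move=> mu' mv uv fu phi sphi; rewrite -(fu _ sphi).
have mdot w : measurable_fun setT w ->
    measurable_fun setT (fun x => (dotrv (w x) (diffop_adj A phi x))%:E).
  move=> mw; apply/measurable_EFinP.
  rewrite (_ : (fun x => _) = fun x =>
      \sum_(a <- [seq a : multi_index n k <- index_enum _ | multi_order a == k])
      \sum_(i < m) \sum_(j < l) A a i j * (w x ord0 i *
        partials (index_seq (fun i => nat_of_ord (a i))) phi x ord0 j)); last first.
    by apply/funext => x; rewrite dotrv_diffop_adj big_filter.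
  apply: measurable_sum => a; apply: measurable_sum => i; apply: measurable_sum => j.
  apply: measurable_funM => //; apply: measurable_funM.
    exact: measurable_coord_fun.
  by apply: partials_coord_measurable; case: sphi.
apply: ae_eq_integral => //; [exact: mdot|exact: mdot|].
by apply: filterS uv => x -> _.
Qed.

(** The field provided by the truncation property is reset to 0 where its essential bound fails.
    This null modification keeps it periodic, Borel and A-free, and makes the bound valid at every
    point, as the pointwise estimates require. *)
Lemma truncation_step l k (A : multi_index n k -> 'M[R]_(m, l)) p C u lam :
  1 <= p -> 0 <= C -> truncation_property A p C ->
  in_Lp p%:E u -> weak_free A u ->
  4 * (2 * n.+1%:R) ^+ n * \int[mu]_x enorm (u x) < lam ->
  exists v, [/\ Zn_periodic v, measurable_fun setT v, weak_free A v,
    forall x, enorm (v x) <= C * lam &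
    measurable [set x | u x <> v x] /\
    lam * fine (mu [set x | u x <> v x]) <=
      weak_const n * \int[mu]_x upper_part (fun x => enorm (u x)) (lam / 2) x].
Proof.
move=> p1 C0 tp uLp fu lamu; have p0 : 0 < p by lra.
have [uper mu' ufin] := uLp.
have upL : L1 (fun x => enorm (u x) `^ p) by exact/finite_norm_powR.
have uL := Lp_L1 p1 mu' upL.
have wI : 0 <= \int[mu]_x enorm (u x).
  by apply: Rintegral_ge0 => x _; exact: enorm_ge0.
have lam0 : 0 < lam.
  by apply: le_lt_trans lamu; rewrite !mulr_ge0// exprn_ge0// mulr_ge0.
have [v' [[v'per mv' _] fv' /ess_bounded v'b v'M]] := tp u uLp fu lam lam0.
have mnv' := measurable_enorm_comp mv'.
pose v x := if enorm (v' x) <= C * lam then v' x else 0.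
have mv : measurable_fun setT v.
  apply: measurable_fun_ifT => //.
  exact: measurable_fun_ler.
have vv' : {ae mu, forall x, v' x = v x}.
  by apply: filterS v'b => x; rewrite /v => ->.
have mE : measurable [set x | u x <> v x].
  rewrite (_ : mkset _ = (fun x => enorm (u x - v x)) @^-1` `]0, +oo[%classic).
    rewrite -[X in measurable X]setTI.
    have mB : measurable_fun setT (fun x => u x - v x).
      apply: measurable_rows => i.
      rewrite (_ : (fun x => _) = fun x => u x ord0 i - v x ord0 i); last first.
        by apply/funext => x; rewrite !mxE.
      by apply: measurable_funB; exact: measurable_coord_fun.
    exact: (measurable_enorm_comp mB).
  apply/seteqP; split=> x /=; rewrite in_itv /= andbT.
    move=> uv; rewrite lt_def enorm_ge0 andbT; apply/eqP => /enorm_eq0 /eqP.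
    by rewrite subr_eq0 => /eqP.
  by move=> + uv; rewrite uv subrr enorm0 ltxx.
exists v; split => //.
- by move=> x z; rewrite /v v'per.
- exact: weak_free_ae fv'.
- move=> x; rewrite /v; case: ifPn => // _.
  by rewrite enorm0 mulr_ge0// ltW.
split=> //.
have wper : Zn_periodic (fun x => enorm (u x)) by move=> x z; rewrite uper.
have wE : (\int[mu]_x (enorm (u x))%:E = (\int[mu]_x enorm (u x))%:E)%E.
  by rewrite EFin_Rintegral.
have upp : L1 (upper_part (fun x => enorm (u x)) (lam / 2)).
  apply: (integrable_dominated _ _ uL).
    by apply: measurable_upper_part; exact: measurable_enorm_comp.
  move=> x; rewrite /upper_part; case: ifP => _; rewrite ?normr0 ?enorm_ge0//.
  by rewrite ger0_norm// enorm_ge0.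
rewrite -lee_fin !EFinM fineK; last first.
  rewrite ge0_fin_numE ?measure_ge0//.
  by apply: (@le_lt_trans _ _ (mu setT)); [apply: le_measure; rewrite ?inE|rewrite mu1 ltry].
rewrite EFin_Rintegral//; apply: weak_type => //.
- exact: measurable_enorm_comp.
- by move=> x; exact: enorm_ge0.
- by rewrite wE ltry.
apply: filterS2 v'M vv' => x vM vx; rewrite /= -vx => /vM.
(* The maximal function is only known to be at least lam; lowering the level to 3 lam / 4 makes the
   inequality strict, so that some radius attains it. *)
move=> lamM; have : ((3 / 4 * lam)%:E < maximal_function u x)%E.
  by apply: lt_le_trans lamM; rewrite lte_fin; lra.
move=> /ereal_sup_gt [_ [r /= r0 <-] H]; exists r => //.
by move: r0; rewrite in_itv /= andbT.
Qed.

End torus_Lp.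

(** * Truncation errors measured by the tail *)

Section truncation_estimates.
Context {R : realType} {n m : nat}.
Local Notation mu := (@torus_measure R n).
Let mu1 : mu setT = 1%E := @torus_measureT R n.
Local Notation L1 f := (mu.-integrable setT (EFin \o f)).
Implicit Types u v : 'rV[R]_n -> 'rV[R]_m.

Lemma indic_mul_integrable (E : set 'rV[R]_n) (f : 'rV[R]_n -> R) :
  measurable E -> L1 f -> L1 (fun x => \1_E x * f x).
Proof.
move=> mE fL; apply: (integrable_dominated _ _ (integrable_abs fL)).
  by apply: measurable_funM; [exact: measurable_indic|exact: integrable_measurable fL].
move=> x; rewrite indicE; case: (x \in E); rewrite ?mul1r//.
by rewrite mul0r normr0.
Qed.

Lemma upper_part_integrable (w : 'rV[R]_n -> R) t : L1 w -> L1 (upper_part w t).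
Proof.
move=> wL; apply: (integrable_dominated _ _ (integrable_abs wL)).
  by apply: measurable_upper_part; exact: integrable_measurable wL.
by move=> x; rewrite /upper_part; case: ifP; rewrite ?normr0.
Qed.

Lemma upper_part_powR_le p (t : R) (w : 'rV[R]_n -> R) x :
  1 < p -> 0 <= w x -> 0 < t ->
  t `^ (p - 1) * upper_part w (t / 2) x <= 2 `^ (p - 1) * upper_power p w (t / 2) x.
Proof.
move=> p1 wx t0; rewrite /upper_part /upper_power; case: ifPn => [tw|]; last by rewrite !mulr0.
have wx0 : 0 < w x by apply: lt_trans tw; lra.
have -> : w x `^ p = w x `^ (p - 1) * w x.
  rewrite -[X in _ = _ * X](powRr1 wx) -powRD ?subrK//.
  by apply/implyP => _; rewrite gt_eqF.
rewrite mulrA ler_wpM2r// -powRM//.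
by apply: ge0_ler_powR; rewrite ?nnegrE ?mulr_ge0//; lra.
Qed.

(** All errors are reduced to the tail [psi] above lam / 2. The weak-type bound, multiplied by
    lam^(p-1), gives the first estimate since lam < 2 |u| on the tail. The quantity D controls the
    change of the mean because u and v differ only on E. *)
Lemma truncation_estimates p C lam u v (w := fun x => enorm (u x))
    (E := [set x | u x <> v x]) (e := fine (mu E))
    (psi := \int[mu]_x upper_power p w (lam / 2) x)
    (c2 := weak_const n * 2 `^ (p - 1))
    (D := \int[mu]_x (\1_E x * w x) + C * lam * e) :
  1 < p -> 1 <= C -> 2 <= lam -> measurable_fun setT u -> measurable_fun setT v ->
  L1 (fun x => w x `^ p) -> (forall x, enorm (v x) <= C * lam) -> measurable E ->
  lam * e <= weak_const n * \int[mu]_x upper_part w (lam / 2) x ->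
  [/\ lam `^ p * e <= c2 * psi,
     0 <= D /\ D <= (1 + (1 / 2 + C) * c2) * psi,
     forall i, `|torus_mean u ord0 i - torus_mean v ord0 i| <= D &
     \int[mu]_x (\1_E x * w x `^ p) <= (1 + c2) * psi].
Proof.
move=> p1 C1 lam2 mu' mv wp vC mE lamE.
have p1' : 1 <= p by exact: ltW.
have lam0 : 0 < lam by lra.
have wL : L1 w := Lp_L1 p1' mu' wp.
have w0 x : 0 <= w x by exact: enorm_ge0.
have e0 : 0 <= e by exact: fine_ge0.
have mw : measurable_fun setT w by exact: measurable_enorm_comp.
have upL := upper_power_integrable mw wp.
have upartL t : L1 (upper_part w t) by exact: upper_part_integrable.
have EL (f : 'rV[R]_n -> R) : L1 f -> L1 (fun x => \1_E x * f x).
  exact: indic_mul_integrable.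
have indL : L1 (\1_E : _ -> R) by exact: indic_integrable.
have intE : \int[mu]_x (\1_E x : R) = e by exact: Rintegral_indic.
have weak0 : 0 < weak_const n :> R by exact: weak_const_gt0.
have psi0 : 0 <= psi by apply: Rintegral_ge0 => x _; exact: upper_power_ge0.
have c20 : 0 <= c2 by rewrite mulr_ge0 ?powR_ge0// ltW.
have lamp : lam `^ p = lam `^ (p - 1) * lam.
  rewrite -[X in _ = _ * X](powRr1 (ltW lam0)) -powRD ?subrK//.
  by apply/implyP => _; rewrite gt_eqF.
have lamp1 : lam <= lam `^ p.
  by rewrite -{1}(powRr1 (ltW lam0)); apply: ler_powR => //; lra.
have T1 : lam `^ p * e <= c2 * psi.
  rewrite lamp -mulrA.
  apply: (@le_trans _ _ (lam `^ (p - 1) *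
      (weak_const n * \int[mu]_x upper_part w (lam / 2) x))).
    by rewrite ler_wpM2l ?powR_ge0.
  rewrite mulrCA /c2 -mulrA ler_wpM2l ?(ltW weak0)//.
  rewrite -!RintegralZl//; apply: le_Rintegral => //; try exact: integrable_scale.
  by move=> x _; exact: upper_part_powR_le.
have T1' : lam * e <= c2 * psi by apply: le_trans T1; rewrite ler_wpM2r.
have ww : L1 (fun x => w x) by [].
(* E is split at height lam / 2: above it w > 1, because lam >= 2, and so w <= w^p; below it w <=
   lam / 2. *)
have IEw : \int[mu]_x (\1_E x * w x) <= psi + lam / 2 * e.
  rewrite -intE -RintegralZl// -RintegralD//; last exact: integrable_scale.
  apply: le_Rintegral => //; first exact: EL.
    by apply: integrable_add => //; exact: integrable_scale.
  move=> x _; rewrite indicE /upper_power; have := w0 x; have := powR_ge0 (w x) p.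
  case: (x \in E) => /=; case: ifPn; rewrite -?leNgt; try nra.
  move=> lw wp0 wx; have : w x <= w x `^ p; last by nra.
  by rewrite -{1}(powRr1 wx); apply: ler_powR => //; lra.
have D0 : 0 <= D.
  rewrite addr_ge0//; last by rewrite !mulr_ge0//; lra.
  by apply: Rintegral_ge0 => x _; rewrite mulr_ge0// indicE.
split => //.
- by split => //; rewrite /D; nra.
- move=> i; rewrite !mxE.
  have uiL := L1_coord i mu' wL.
  have vL : L1 (fun x => v x ord0 i).
    apply: (integrable_bounded (M := C * lam) mu1); first exact: measurable_coord_fun.
    by move=> x; apply: le_trans (vC x); exact: coord_le_enorm.
  rewrite -RintegralB//; apply: le_trans (le_normr_Rintegral _ (integrable_sub uiL vL)) _ => //.
  rewrite /D -intE -RintegralZl// -RintegralD//; [|exact: EL|exact: integrable_scale].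
  apply: le_Rintegral => //.
  + exact/integrable_abs/integrable_sub.
  + by apply: integrable_add; [exact: EL|exact: integrable_scale].
  move=> x _; rewrite indicE; have [|] := boolP (x \in E).
    move=> _; rewrite mul1r mulr1 (le_trans (ler_normB _ _))// lerD//.
      exact: coord_le_enorm.
    by apply: le_trans (vC x); exact: coord_le_enorm.
  move=> xE; have -> : u x = v x.
    by apply: contrapT => uv; move/negP: xE; apply; rewrite inE.
  by rewrite subrr normr0 mul0r mulr0 addr0.
have -> : (1 + c2) * psi = psi + c2 * psi by ring.
apply: (@le_trans _ _ (psi + lam `^ p * e)); last by rewrite lerD2l.
rewrite -intE -RintegralZl// -RintegralD//; last exact: integrable_scale.
apply: le_Rintegral => //; first exact: EL.
  by apply: integrable_add => //; exact: integrable_scale.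
move=> x _; rewrite indicE /upper_power; have wx := powR_ge0 (w x) p.
have lx := powR_ge0 lam p.
case: (x \in E) => /=; case: ifPn; rewrite -?leNgt; try lra.
move=> wl; rewrite mul1r mulr1 add0r.
by apply: ge0_ler_powR; rewrite ?nnegrE//; lra.
Qed.

End truncation_estimates.

Section tails.
Context d (T : measurableType d) {R : realType} (mu : {measure set T -> \bar R}).

Lemma upper_power_tail (w : T -> R) p (e : R) :
  measurable_fun setT w -> (forall x, 0 <= w x) ->
  mu.-integrable setT (EFin \o fun x => w x `^ p) -> 0 < e ->
  exists t0, forall t, t0 <= t -> \int[mu]_x upper_power p w t x <= e.
Proof.
move=> mw w0 wp e0.
have upL t := @upper_power_integrable _ _ _ mu w p mw wp t.
have : (\int[mu]_x (upper_power p w k%:R x)%:E)%E @[k --> \oo] --> (\int[mu]_x 0)%E.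
  apply: (@dominated_cvg _ _ _ mu setT measurableT
    (fun k x => (upper_power p w k%:R x)%:E) (fun=> 0%E) (fun x => (w x `^ p)%:E)) => //.
  - by move=> k; have /integrableP[] := upL k%:R.
  - move=> x _; apply: cvg_near_cst.
    exists (Num.bound (w x)) => // k /= wk.
    rewrite /upper_power ltNge (le_trans (ltW (archi_boundP (w0 x))))//.
    by rewrite ler_nat.
  - move=> k x _; rewrite lee_fin ger0_norm ?upper_power_ge0//.
    exact: upper_power_le.
have e0' : (0 < e%:E)%E by rewrite lte_fin.
rewrite integral0 => /ereal_cvg_lt /(_ e0') [N NP].
exists N%:R => t Nt; apply: le_trans (phi_anti mw wp Nt) _.
by rewrite -lee_fin EFin_Rintegral//; exact/ltW/NP.
Qed.

End tails.

(** * Null Lagrangians on L^p fields *)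

Section null_lagrangian_Lp.
Context {R : realType} {n m : nat}.
Local Notation mu := (@torus_measure R n).
Let mu1 : mu setT = 1%E := @torus_measureT R n.
Local Notation L1 f := (mu.-integrable setT (EFin \o f)).
Implicit Types u v : 'rV[R]_n -> 'rV[R]_m.

Lemma torus_mean_bound u i : measurable_fun setT u -> L1 (fun x => enorm (u x)) ->
  `|torus_mean u ord0 i| <= \int[mu]_x enorm (u x).
Proof.
move=> mu' uL; have uiL := L1_coord i mu' uL.
rewrite mxE; apply: le_trans (le_normr_Rintegral _ uiL) _ => //.
apply: le_Rintegral => //; first exact: integrable_abs.
by move=> x _; exact: coord_le_enorm.
Qed.

Lemma Pi_comp_integrable (Pi : 'rV[R]_m -> R) p u :
  measurable_fun setT Pi -> (forall w, `|Pi w| <= enorm w `^ p) ->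
  measurable_fun setT u -> L1 (fun x => enorm (u x) `^ p) -> L1 (fun x => Pi (u x)).
Proof.
move=> mPi Pip mu' up; apply: (integrable_dominated _ _ up).
  exact: (measurableT_comp mPi mu').
by move=> x; exact: Pip.
Qed.

(** Truncating at height lam changes the integral of Pi only on E, where both integrands have
    p-growth, and changes Pi of the mean by a multiple of D; both changes are bounded by the tail,
    which vanishes as lam grows. *)
Lemma null_lagrangian_Lp l k (A : multi_index n k -> 'M[R]_(m, l))
    (Pi : 'rV[R]_m -> R) p C u :
  (0 < k)%N -> 1 < p -> 1 <= C -> quasiaffine A Pi -> lipschitz_on_bounded Pi ->
  (forall w, `|Pi w| <= enorm w `^ p) -> truncation_property A p C ->
  in_Lp p%:E u -> weak_free A u ->
  \int[mu]_x Pi (u x) = Pi (torus_mean u).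
Proof.
move=> k0 p1 C1 qPi lPi Pip tp uLp fu.
have p1' : 1 <= p by exact: ltW.
have C0 : 0 <= C by apply: le_trans C1.
have [uper mu' ufin] := uLp.
have mPi : measurable_fun setT Pi by case: qPi => -[].
have up : L1 (fun x => enorm (u x) `^ p) by apply/finite_norm_powR => //; lra.
have uL := Lp_L1 p1' mu' up.
have PiuL := Pi_comp_integrable mPi Pip mu' up.
have mw := measurable_enorm_comp mu'.
pose w x := enorm (u x).
have w0 x : 0 <= w x by exact: enorm_ge0.
pose c2 : R := weak_const n * 2 `^ (p - 1).
have c20 : 0 <= c2 by rewrite mulr_ge0 ?powR_ge0// ltW// weak_const_gt0.
pose cD := 1 + (1 / 2 + C) * c2.
have cD0 : 0 <= cD by rewrite addr_ge0// mulr_ge0// addr_ge0.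
pose P0 := \int[mu]_x w x `^ p.
(* Bounds the coordinates of the means of u and of all its truncations, so that the Lipschitz
   constant of Pi is fixed before lam. *)
pose M := \int[mu]_x w x + cD * P0.
have P00 : 0 <= P0 by apply: Rintegral_ge0 => x _; exact: powR_ge0.
have [Kl Kl0 KlP] := lPi M.
pose Q := 1 + c2 + C `^ p * c2 + Kl * (m%:R * cD).
have Q0 : 0 <= Q by rewrite !addr_ge0 ?mulr_ge0 ?powR_ge0.
have key lam : 2 <= lam -> 4 * (2 * n.+1%:R) ^+ n * \int[mu]_x enorm (u x) < lam ->
    `|\int[mu]_x Pi (u x) - Pi (torus_mean u)| <= Q * \int[mu]_x upper_power p w (lam / 2) x.
  move=> lam2 lamu.
  have [v [vper mv fv vC [mE lamE]]] := truncation_step p1' C0 tp uLp fu lamu.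
  have := truncation_estimates p1 C1 lam2 mu' mv up vC mE lamE.
  rewrite -/c2 -/w; set E := [set x | u x <> v x] in mE *.
  set psi := \int[mu]_x upper_power p _ _ x; set e := fine _.
  set D := _ + C * lam * e => -[T1 [D0 DP] T4 T5].
  have psiP0 : psi <= P0.
    apply: le_Rintegral => //; first exact: upper_power_integrable.
    by move=> x _; exact: upper_power_le.
  have DP0 : D <= cD * P0 by apply: (le_trans DP); rewrite ler_wpM2l.
  have vCi x i : `|v x ord0 i| <= C * lam by apply: le_trans (vC x); exact: coord_le_enorm.
  have NLv := null_lagrangian_bounded k0 qPi lPi vper mv vCi fv.
  have PivL := bounded_comp_integrable mPi lPi mv vCi.
  have indL : L1 (\1_E : _ -> R) by exact: indic_integrable.
  have EwL : L1 (fun x => \1_E x * w x `^ p) by exact: indic_mul_integrable.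
  have h1 : `|\int[mu]_x Pi (u x) - \int[mu]_x Pi (v x)| <= (1 + c2 + C `^ p * c2) * psi.
    rewrite -RintegralB//.
    apply: le_trans (le_normr_Rintegral _ (integrable_sub PiuL PivL)) _ => //.
    apply: (@le_trans _ _ (\int[mu]_x (\1_E x * w x `^ p + (C * lam) `^ p * \1_E x))).
      apply: le_Rintegral => //.
      - exact/integrable_abs/integrable_sub.
      - by apply: integrable_add => //; exact: integrable_scale.
      move=> x _; rewrite indicE; have [|xE] := boolP (x \in E).
        move=> _; rewrite mul1r mulr1 (le_trans (ler_normB _ _))// lerD//.
        apply: le_trans (Pip _) _; apply: ge0_ler_powR; rewrite ?nnegrE ?enorm_ge0//.
          lra.
        by apply: le_trans (vC x); exact: enorm_ge0.
      have -> : u x = v x.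
        by apply: contrapT => uv; move/negP: xE; apply; rewrite inE.
      by rewrite subrr normr0 mul0r mulr0 addr0.
    rewrite RintegralD//; last exact: integrable_scale.
    rewrite RintegralZl// Rintegral_indic// mulrDl lerD//.
    rewrite powRM//; last by lra.
    rewrite -(mulrA (C `^ p) (lam `^ p)) -(mulrA (C `^ p) c2).
    by apply: ler_wpM2l; [exact: powR_ge0|exact: T1].
  have meanu i : `|torus_mean u ord0 i| <= \int[mu]_x w x by exact: torus_mean_bound.
  have h2 : `|Pi (torus_mean v) - Pi (torus_mean u)| <= Kl * (m%:R * cD) * psi.
    apply: le_trans (KlP _ _ _ _) _.
    - move=> i; have := T4 i; have := meanu i; rewrite !ler_norml /M.
      move: (torus_mean u _ _) (torus_mean v _ _) => a b; lra.
    - move=> i; apply: le_trans (meanu i) _; rewrite /M lerDl.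
      by rewrite mulr_ge0.
    rewrite -mulrA ler_wpM2l// -mulrA mulrC.
    apply: (@le_trans _ _ (\sum_(i < m) D)).
      by apply: ler_sum => i _; rewrite distrC.
    by rewrite sumr_const card_ord -[_ *+ m]mulr_natr ler_wpM2r.
  have -> : \int[mu]_x Pi (u x) - Pi (torus_mean u) =
      (\int[mu]_x Pi (u x) - \int[mu]_x Pi (v x)) + (Pi (torus_mean v) - Pi (torus_mean u)).
    by rewrite NLv addrA subrK.
  by apply: le_trans (ler_normD _ _) _; rewrite /Q mulrDl lerD.
apply/eqP; rewrite -subr_eq0 -normr_le0; apply/ler_addgt0Pr => e e0; rewrite add0r.
have eQ : 0 < e / (Q + 1) by rewrite divr_gt0// ltr_wpDl.
have [t0 t0P] := upper_power_tail mw w0 up eQ.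
pose lam := 2 + `|2 * t0| + `|4 * (2 * n.+1%:R) ^+ n * \int[mu]_x enorm (u x)|.
have l1 := ler_norm (2 * t0).
have l2 := ler_norm (4 * (2 * n.+1%:R) ^+ n * \int[mu]_x enorm (u x)).
have l3 := normr_ge0 (2 * t0).
have l4 := normr_ge0 (4 * (2 * n.+1%:R) ^+ n * \int[mu]_x enorm (u x)).
apply: le_trans (key lam _ _) _.
- by rewrite /lam; lra.
- by rewrite /lam; lra.
apply: (@le_trans _ _ (Q * (e / (Q + 1)))).
  by rewrite ler_wpM2l//; apply: t0P; rewrite /lam; lra.
by rewrite mulrCA ler_piMr ?ltW// ltr_pdivrMr ?ltr_wpDl// mul1r ltrDl.
Qed.

End null_lagrangian_Lp.

(** * Energy comparison *)

Section minimisers.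
Context {R : realType} {n m : nat}.
Local Notation mu := (@torus_measure R n).
Let mu1 : mu setT = 1%E := @torus_measureT R n.
Local Notation L1 f := (mu.-integrable setT (EFin \o f)).
Implicit Types u v z : 'rV[R]_n -> 'rV[R]_m.

(** The Borel representative [h] carries the energy through the real-valued integral calculus, since
    f x (z x) is only almost everywhere equal to a Borel function. *)
Lemma integrand_integrable (f : 'rV[R]_n -> 'rV[R]_m -> R) (Pi : 'rV[R]_m -> R)
    p alpha nu c z :
  0 <= alpha -> 0 <= nu -> 0 <= c ->
  (forall w, `|Pi w| <= enorm w `^ p) -> measurable_integrand f ->
  {ae mu, forall x, forall w,
      enorm w `^ p - alpha * Pi w <= f x w <= nu * enorm w `^ p + c} ->
  Zn_periodic z -> measurable_fun setT z -> L1 (fun x => enorm (z x) `^ p) ->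
  exists h, [/\ L1 h, {ae mu, forall x, f x (z x) = h x} &
    (\int[mu]_x (f x (z x))%:E = (\int[mu]_x h x)%:E)%E].
Proof.
move=> al0 nu0 c0 Pip mf fb zper mz zp.
have [h mh fh] := mf z zper mz.
have gL : L1 (fun x => (1 + alpha + nu) * enorm (z x) `^ p + c).
  by apply: integrable_add; [exact: integrable_scale|exact: integrable_cst_unit].
have mgE := integrable_measurable gL.
have hL : L1 h.
  apply/integrableP; split; first exact/measurable_EFinP.
  have /integrableP[_] := gL; apply: le_lt_trans; apply: ae_ge0_le_integral => //.
  - by apply: measurableT_comp => //; exact/measurable_EFinP.
  - by apply: measurableT_comp => //; exact/measurable_EFinP.
  apply: filterS2 fb fh => x fbx fhx _; rewrite /= lee_fin.
  have := fbx (z x); rewrite fhx; have := Pip (z x); have P0 := powR_ge0 (enorm (z x)) p.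
  rewrite ler_norml => /andP[Pi1 Pi2] /andP[h1 h2].
  have aPi1 : - (alpha * enorm (z x) `^ p) <= alpha * Pi (z x) <= alpha * enorm (z x) `^ p.
    by rewrite -mulrN !ler_wpM2l.
  have nP : 0 <= nu * enorm (z x) `^ p by exact: mulr_ge0.
  have aP : 0 <= alpha * enorm (z x) `^ p by exact: mulr_ge0.
  rewrite (le_trans _ (ler_norm _))// ler_norml.
  by move: (enorm _ `^ _) (Pi _) (h x) h1 h2 Pi1 Pi2 aPi1 nP aP P0 => P q r; lra.
exists h; split => //.
rewrite EFin_Rintegral//; apply: ae_eq_integral_nonmeasurable.
by apply: filterS fh => x ->.
Qed.

Lemma in_Lp_bounded p z c : 0 < p -> Zn_periodic z -> measurable_fun setT z ->
  (forall x, enorm (z x) <= c) ->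
  in_Lp p%:E z /\ L1 (fun x => enorm (z x) `^ p).
Proof.
move=> p0 zper mz zc; suff zp : L1 (fun x => enorm (z x) `^ p).
  by split => //; split => //; exact/finite_norm_powR.
apply: (integrable_bounded (M := c `^ p) mu1); first exact: measurable_enorm_powR.
move=> x; rewrite ger0_norm ?powR_ge0//.
apply: ge0_ler_powR; rewrite ?nnegrE ?enorm_ge0 ?(ltW p0)//.
by apply: le_trans (zc x); exact: enorm_ge0.
Qed.

Lemma torus_mean_add u (c : 'rV[R]_m) :
  (forall i, L1 (fun x => u x ord0 i)) ->
  torus_mean (fun x => u x + c) = torus_mean u + c.
Proof.
move=> uL; apply/rowP => i; rewrite !mxE.
under eq_Rintegral do rewrite mxE.
by rewrite RintegralD//; [rewrite Rintegral_cst_unit|exact: integrable_cst_unit].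
Qed.

Lemma functional_admissible l k (A : multi_index n k -> 'M[R]_(m, l))
    (f : 'rV[R]_n -> 'rV[R]_m -> R)
    (u0 : 'rV[R]_m) u :
  weak_free A u -> torus_mean u = u0 ->
  functional A f u0 u = (\int[mu]_x (f x (u x))%:E)%E.
Proof.
by move=> fu mu0; rewrite /functional; case: ifPn => // /asboolP[].
Qed.

(** The constant field u_0 is admissible with finite energy, so the minimal value is finite and the
    minimiser cannot fall into the infinite branch. *)
Lemma minimiser_admissible l k (A : multi_index n k -> 'M[R]_(m, l)) (f : 'rV[R]_n -> 'rV[R]_m -> R)
    (u0 : 'rV[R]_m) u p
    (Pi : 'rV[R]_m -> R) alpha nu c :
  (0 < k)%N -> 0 < p -> 0 <= alpha -> 0 <= nu -> 0 <= c ->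
  (forall w, `|Pi w| <= enorm w `^ p) -> measurable_integrand f ->
  {ae mu, forall x, forall w,
      enorm w `^ p - alpha * Pi w <= f x w <= nu * enorm w `^ p + c} ->
  is_minimiser A f u0 p u -> weak_free A u /\ torus_mean u = u0.
Proof.
move=> k0 p0 al0 nu0 c0 Pip mf fb [uLp umin].
have cper : Zn_periodic (fun _ : 'rV[R]_n => u0) by [].
have mc : measurable_fun setT (fun _ : 'rV[R]_n => u0) by exact: measurable_cst.
have [cLp cp] := in_Lp_bounded p0 cper mc (fun=> lexx (enorm u0)).
have [h [_ _ hE]] := integrand_integrable al0 nu0 c0 Pip mf fb cper mc cp.
have cfree := weak_free_cst A u0 k0.
have cmean : torus_mean (fun _ : 'rV[R]_n => u0) = u0.
  by apply/rowP => i; rewrite mxE Rintegral_cst_unit.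
have := umin _ cLp; rewrite (functional_admissible f cfree cmean) hE /functional.
by case: ifPn => [/asboolP//|_]; rewrite leye_eq.
Qed.

(* The competitor v + (u0 - mean v), where v truncates u at height lam. *)
Lemma minimiser_comparison l k (A : multi_index n k -> 'M[R]_(m, l))
    (f : 'rV[R]_n -> 'rV[R]_m -> R)
    (u0 : 'rV[R]_m) u v p L C lam
    (Pi : 'rV[R]_m -> R) alpha nu c
    (w := fun x => enorm (u x)) (E := [set x | u x <> v x])
    (e := fine (mu E)) (d := u0 - torus_mean v) :
  (0 < k)%N -> 1 < p -> 0 <= L -> 0 <= alpha -> 0 <= nu -> 0 <= c ->
  0 <= C * lam ->
  measurable_fun setT Pi -> lipschitz_on_bounded Pi ->
  (forall w, `|Pi w| <= enorm w `^ p) -> measurable_integrand f ->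
  {ae mu, forall x, forall w,
      enorm w `^ p - alpha * Pi w <= f x w <= nu * enorm w `^ p + c} ->
  {ae mu, forall x, forall w w', `|f x w - f x w'| <=
      L * (1 + enorm w `^ (p - 1) + enorm w' `^ (p - 1)) * enorm (w - w')} ->
  is_minimiser A f u0 p u ->
  Zn_periodic v -> measurable_fun setT v -> weak_free A v ->
  (forall x, enorm (v x) <= C * lam) -> measurable E ->
  \int[mu]_x (\1_E x * w x `^ p) <=
    ((nu + alpha) * (C * lam) `^ p + c) * e +
    alpha * (\int[mu]_x Pi (u x) - \int[mu]_x Pi (v x)) +
    L * enorm d * \int[mu]_x (3 + 2 `^ p * (enorm (v x) `^ p + enorm d `^ p) +
      enorm (v x) `^ p).
Proof.
move=> k0 p1 L0 al0 nu0 c0 Clam0 mPi lPi Pip mf fb fL umin vper mv fv vC mE.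
have p0 : 0 < p by lra.
have [fu meanu] := minimiser_admissible k0 p0 al0 nu0 c0 Pip mf fb umin.
have [uLp minu] := umin; have [uper mu' ufin] := uLp.
have up : L1 (fun x => enorm (u x) `^ p) by exact/finite_norm_powR.
have [vLp vp] := in_Lp_bounded p0 vper mv vC.
have vL i : L1 (fun x => v x ord0 i).
  apply: (integrable_bounded (M := C * lam) mu1); first exact: measurable_coord_fun.
  by move=> x; apply: le_trans (vC x); exact: coord_le_enorm.
pose z x := v x + d.
have zper : Zn_periodic z by move=> x t; rewrite /z vper.
have mz : measurable_fun setT z.
  apply: measurable_rows => i; rewrite (_ : (fun x => _) = fun x => v x ord0 i + d ord0 i).
    by apply: measurable_funD => //; exact: measurable_coord_fun.
  by apply/funext => x; rewrite mxE.
have zC x : enorm (z x) <= C * lam + enorm d by rewrite (le_trans (enormD _ _))// lerD.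
have [zLp zp] := in_Lp_bounded p0 zper mz zC.
have fz : weak_free A z.
  apply: weak_free_add => //; first by move=> i; exact: integrable_cst_unit.
  exact: weak_free_cst.
have meanz : torus_mean z = u0 by rewrite torus_mean_add// addrC subrK.
have [h1 [h1L h1E h1I]] := integrand_integrable al0 nu0 c0 Pip mf fb uper mu' up.
have [h3 [h3L h3E h3I]] := integrand_integrable al0 nu0 c0 Pip mf fb zper mz zp.
have h13 : \int[mu]_x h1 x <= \int[mu]_x h3 x.
  have := minu _ zLp; rewrite !functional_admissible// h1I h3I lee_fin; exact.
have PiuL := Pi_comp_integrable mPi Pip mu' up.
have PivL := Pi_comp_integrable mPi Pip mv vp.
have indL : L1 (\1_E : _ -> R) by exact: indic_integrable.
have EwL : L1 (fun x => \1_E x * w x `^ p) := indic_mul_integrable mE up.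
(* Dominates 1 + |z|^(p-1) + |v|^(p-1), by a^(p-1) <= 1 + a^p for both powers and |v + d|^p <= 2^p
   (|v|^p + |d|^p). *)
pose g x := 3 + 2 `^ p * (enorm (v x) `^ p + enorm d `^ p) + enorm (v x) `^ p.
have g1 := integrable_scale (2 `^ p)
  (integrable_add vp (integrable_cst_unit mu1 (enorm d `^ p))).
have gL : L1 g := integrable_add (integrable_add (integrable_cst_unit mu1 3) g1) vp.
pose S x := ((nu + alpha) * (C * lam) `^ p + c) * \1_E x +
  alpha * (Pi (u x) - Pi (v x)) + L * enorm d * g x.
have S1 : L1 (fun x => ((nu + alpha) * (C * lam) `^ p + c) * (\1_E x : R)).
  exact: integrable_scale.
have S2 : L1 (fun x => alpha * (Pi (u x) - Pi (v x))).
  exact/integrable_scale/integrable_sub.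
have S3 : L1 (fun x => L * enorm d * g x) by exact: integrable_scale.
have S12 := integrable_add S1 S2.
have SL : L1 S := integrable_add S12 S3.
have -> : ((nu + alpha) * (C * lam) `^ p + c) * e +
    alpha * (\int[mu]_x Pi (u x) - \int[mu]_x Pi (v x)) +
    L * enorm d * \int[mu]_x g x = \int[mu]_x S x.
  have <- : \int[mu]_x (((nu + alpha) * (C * lam) `^ p + c) * (\1_E x : R)) =
      ((nu + alpha) * (C * lam) `^ p + c) * e.
    by rewrite (RintegralZl _ measurableT indL) Rintegral_indic.
  have <- : \int[mu]_x (alpha * (Pi (u x) - Pi (v x))) =
      alpha * (\int[mu]_x Pi (u x) - \int[mu]_x Pi (v x)).
    rewrite (RintegralZl _ measurableT (integrable_sub PiuL PivL)).
    by rewrite (RintegralB measurableT PiuL PivL).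
  have <- : \int[mu]_x (L * enorm d * g x) = L * enorm d * \int[mu]_x g x.
    exact: (RintegralZl _ measurableT gL).
  by rewrite -(RintegralD measurableT S1 S2) -(RintegralD measurableT S12 S3).
(* Minimality holds only for integrals; with h1 and h3 on opposite sides, what remains is an
   inequality that holds at almost every point. *)
suff : \int[mu]_x (h3 x + \1_E x * w x `^ p) <= \int[mu]_x (S x + h1 x).
  rewrite (RintegralD measurableT h3L EwL) (RintegralD measurableT SL h1L).
  by move: (\int[mu]_x h1 x) (\int[mu]_x h3 x) h13 => a b; lra.
apply: (ae_le_Rintegral (integrable_add h3L EwL) (integrable_add SL h1L)).
apply: filterS2 (filterI fb fL) (filterI h1E h3E) => x [fbx fLx] [h1x h3x].
have d0 := enorm_ge0 d; have v0 := enorm_ge0 (v x).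
have lip : h3 x - f x (v x) <= L * enorm d * g x.
  apply: le_trans (ler_norm _) _; rewrite -h3x; apply: le_trans (fLx _ _) _.
  rewrite /z [v x + d]addrC addrK -/(z x) mulrAC ler_wpM2l ?mulr_ge0//.
  have := powR_sub1_le (ltW p1) (enorm_ge0 (d + v x)).
  have := powR_sub1_le (ltW p1) v0.
  have : enorm (d + v x) `^ p <= 2 `^ p * (enorm (v x) `^ p + enorm d `^ p).
    apply: le_trans (powRD_le (ltW p0) v0 d0).
    apply: ge0_ler_powR; rewrite ?nnegrE ?enorm_ge0 ?addr_ge0 ?(ltW p0)//.
    by rewrite addrC enormD.
  rewrite /g; move: (enorm (d + v x) `^ (p - 1)) (enorm (v x) `^ (p - 1)) (enorm (d + v x) `^ p)
    (2 `^ p * (enorm (v x) `^ p + enorm d `^ p)) (enorm (v x) `^ p) => a b r q s; lra.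
have [xE|xE] := boolP (x \in E); last first.
  have uv : u x = v x.
    by apply: contrapT => uv; move/negP: xE; apply; rewrite inE.
  rewrite /S indicE (negbTE xE) mulr0 mul0r addr0 uv subrr mulr0 !add0r -h1x uv; lra.
rewrite /S indicE xE mulr1 mul1r.
have vCp : enorm (v x) `^ p <= (C * lam) `^ p.
  by apply: ge0_ler_powR; rewrite ?nnegrE ?enorm_ge0 ?(ltW p0).
have /andP[_ fv2] := fbx (v x); have /andP[fu1 _] := fbx (u x).
(* S contains -alpha Pi (v x), which has to be compensated on E; this adds alpha to the growth
   constant nu of f at v. *)
have Piv : alpha * Pi (v x) <= alpha * (C * lam) `^ p.
  by rewrite ler_wpM2l// (le_trans _ vCp)// (le_trans (ler_norm _))// Pip.
have nuv : nu * enorm (v x) `^ p <= nu * (C * lam) `^ p by rewrite ler_wpM2l.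
rewrite h1x in fu1; rewrite -/(w x) in fu1.
move: (L * _ * _) lip => G lip; move: ((C * lam) `^ p) (enorm (v x) `^ p) (w x `^ p)
  Piv nuv fv2 fu1 => a b r; rewrite mulrBr mulrDl; lra.
Qed.

End minimisers.

(** * Reverse Hölder inequality and conclusion *)

Section higher_integrability.
Context {R : realType} {n m : nat}.
Local Notation mu := (@torus_measure R n).
Let mu1 : mu setT = 1%E := @torus_measureT R n.
Local Notation L1 f := (mu.-integrable setT (EFin \o f)).
Implicit Types u v z : 'rV[R]_n -> 'rV[R]_m.

Lemma truncation_propertyW l k (A : multi_index n k -> 'M[R]_(m, l)) p C C' :
  C <= C' -> truncation_property A p C -> truncation_property A p C'.
Proof.
move=> CC' tp u uLp fu lam lam0; have [v [vLp fv vC vM]] := tp u uLp fu lam lam0.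
exists v; split => //; apply: (le_trans vC).
by rewrite lee_fin ler_wpM2r// ltW.
Qed.

(** Split where a^(p-1) = 2 M: above, M a is at most half of a^p; below, a is bounded by the
    threshold. *)
Lemma young_linear p (M a : R) : 1 < p -> 0 <= M -> 0 <= a ->
  M * a <= 1 / 2 * a `^ p + M * (2 * M) `^ (p - 1)^-1.
Proof.
move=> p1 M0 a0; have p10 : 0 < p - 1 by lra.
have ap0 := powR_ge0 a p.
have [h|h] := leP a ((2 * M) `^ (p - 1)^-1).
  by apply: ler_wpDl; [lra|rewrite ler_wpM2l].
apply: ler_wpDr; first by rewrite mulr_ge0 ?powR_ge0.
have M20 : 0 <= 2 * M by lra.
have a1 : 2 * M <= a `^ (p - 1).
  have -> : 2 * M = ((2 * M) `^ (p - 1)^-1) `^ (p - 1).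
    by rewrite -powRrM mulVf ?gt_eqF// powRr1.
  by apply: ge0_ler_powR; rewrite ?nnegrE ?powR_ge0 ?(ltW p10) ?(ltW h).
have a00 : 0 < a by apply: le_lt_trans h; exact: powR_ge0.
have -> : a `^ p = a `^ (p - 1) * a.
  rewrite -[X in _ = _ * X](powRr1 a0) -powRD ?subrK//.
  by apply/implyP => _; rewrite gt_eqF.
nra.
Qed.

Lemma reverse_hoelder l k (A : multi_index n k -> 'M[R]_(m, l))
    (f : 'rV[R]_n -> 'rV[R]_m -> R) (u0 : 'rV[R]_m) u p L C
    (Pi : 'rV[R]_m -> R) alpha nu c (w := fun x => enorm (u x)) :
  (0 < k)%N -> 1 < p -> 0 <= L -> 0 <= alpha -> 0 <= nu -> 1 <= nu + alpha -> 0 <= c ->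
  1 <= C -> quasiaffine A Pi -> lipschitz_on_bounded Pi ->
  (forall w, `|Pi w| <= enorm w `^ p) -> measurable_integrand f ->
  {ae mu, forall x, forall w,
      enorm w `^ p - alpha * Pi w <= f x w <= nu * enorm w `^ p + c} ->
  {ae mu, forall x, forall w w', `|f x w - f x w'| <=
      L * (1 + enorm w `^ (p - 1) + enorm w' `^ (p - 1)) * enorm (w - w')} ->
  truncation_property A p C -> is_minimiser A f u0 p u ->
  exists2 t0, 0 < t0 & forall t, t0 <= t ->
    \int[mu]_x upper_power p w (C * t) x <=
    4 * (nu + alpha) * C `^ p * weak_const n * t `^ (p - 1) *
      \int[mu]_x upper_part w (t / 2) x.
Proof.
move=> k0 p1 L0 al0 nu0 K1 c0 C1 qPi lPi Pip mf fb fL tp umin.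
have p1' : 1 <= p by exact: ltW.
have p0 : 0 < p by apply: lt_trans p1.
have C0 : 0 <= C by apply: le_trans C1.
have [fu meanu] := minimiser_admissible k0 p0 al0 nu0 c0 Pip mf fb umin.
have [uLp _] := umin; have [uper mu' ufin] := uLp.
have mPi : measurable_fun setT Pi by case: qPi => -[].
have up : L1 (fun x => enorm (u x) `^ p) by exact/finite_norm_powR.
have uL := Lp_L1 p1' mu' up.
have mw := measurable_enorm_comp mu'.
have w0 x : 0 <= w x by exact: enorm_ge0.
pose c2 : R := weak_const n * 2 `^ (p - 1).
have weak0 : 0 < weak_const n :> R by exact: weak_const_gt0.
have c20 : 0 <= c2 by rewrite mulr_ge0 ?powR_ge0// ltW.
pose cD := 1 + (1 / 2 + C) * c2.
have cD0 : 0 <= cD by rewrite addr_ge0// mulr_ge0// addr_ge0.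
pose P0 := \int[mu]_x w x `^ p.
have P00 : 0 <= P0 by apply: Rintegral_ge0 => x _; exact: powR_ge0.
pose MM := \int[mu]_x w x + cD * P0.
have [Kl Kl0 KlP] := lPi MM.
pose V0 := P0 + C `^ p * (c2 * P0).
have Cp0 := powR_ge0 C p.
have V00 : 0 <= V0 by rewrite addr_ge0 ?mulr_ge0.
pose Del := m%:R * (cD * P0).
have Del0 : 0 <= Del by rewrite !mulr_ge0.
pose G0 := 3 + 2 `^ p * (V0 + Del `^ p) + V0.
have G00 : 0 <= G0.
  have a1 := powR_ge0 2 p; have a2 := powR_ge0 Del p.
  by rewrite /G0 addr_ge0// addr_ge0// mulr_ge0// addr_ge0.
(* The coefficient of D: Kl m bounds the change of Pi between the two means, and m G0 bounds the
   added constant times the integral in the Lipschitz term. *)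
pose M := alpha * (Kl * m%:R) + L * (m%:R * G0).
have KG0 : 0 <= L * (m%:R * G0) by rewrite !mulr_ge0.
have aK0 : 0 <= alpha * (Kl * m%:R) by rewrite !mulr_ge0.
have M0 : 0 <= M by exact: addr_ge0.
pose M2 := M * (2 * M) `^ (p - 1)^-1.
have M20 : 0 <= M2 by rewrite mulr_ge0 ?powR_ge0.
(* Once t >= 1 and t^(p-1) >= N0, the lower-order sum c + M2 + M C t is at most N0 t <= t^p. *)
pose N0 := c + M2 + M * C.
have MC0 : 0 <= M * C by exact: mulr_ge0.
have N00 : 0 <= N0 by rewrite /N0 addr_ge0// addr_ge0.
pose J := 4 * (2 * n.+1%:R) ^+ n * \int[mu]_x enorm (u x).
have [t0 t02 [tN0 tJ0]] : exists2 t0, 2 <= t0 & N0 `^ (p - 1)^-1 <= t0 /\ J < t0.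
  exists (2 + N0 `^ (p - 1)^-1 + `|J|); have := powR_ge0 N0 (p - 1)^-1.
    by have := normr_ge0 J; clear; lra.
  by have := normr_ge0 J; have := ler_norm J; clear; lra.
exists t0; first exact: lt_le_trans t02.
move=> t t0t.
have t2 : 2 <= t by apply: le_trans t0t.
have tJ : J < t by apply: lt_le_trans t0t.
have tN : N0 `^ (p - 1)^-1 <= t by apply: le_trans t0t.
have t00 : 0 < t by apply: lt_le_trans t2.
have [v [vper mv fv vC [mE lamE]]] := truncation_step p1' C0 tp uLp fu tJ.
have := truncation_estimates p1 C1 t2 mu' mv up vC mE lamE.
rewrite -/c2 -/w; set E := [set x | u x <> v x] in mE lamE *.
set psi := \int[mu]_x upper_power p _ _ x; set e := fine _ in lamE *.
set D := _ + C * t * e => -[T1 [D0 DP] T4 _].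
have e0 : 0 <= e by exact: fine_ge0.
have psiP0 : psi <= P0.
  apply: le_Rintegral => //; first exact: upper_power_integrable mw up _.
  by move=> x _; exact: upper_power_le.
have DP0 : D <= cD * P0 by apply: (le_trans DP); rewrite ler_wpM2l.
have Ct0 : 0 <= C * t by rewrite mulr_ge0// ltW.
have vCi x i : `|v x ord0 i| <= C * t by apply: le_trans (vC x); exact: coord_le_enorm.
have NLv := null_lagrangian_bounded k0 qPi lPi vper mv vCi fv.
have NLu := null_lagrangian_Lp k0 p1 C1 qPi lPi Pip tp uLp fu.
have := minimiser_comparison k0 p1 L0 al0 nu0 c0 Ct0 mPi lPi Pip mf fb fL umin vper mv fv vC mE.
rewrite -/E -/e -/w NLu NLv; set X := \int[mu]_x (\1_E x * _).
set del := enorm _; set G := \int[mu]_x _ => XP.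
have dcoord i : `|(u0 - torus_mean v) ord0 i| <= D.
  by rewrite -meanu; have := T4 i; rewrite !mxE.
have sumD (F : 'I_m -> R) : (forall i, F i <= D) -> \sum_i F i <= m%:R * D.
  move=> FD; apply: (@le_trans _ _ (\sum_(i < m) D)); first exact: ler_sum.
  by rewrite sumr_const card_ord -[_ *+ m]mulr_natl.
have del0 : 0 <= del by exact: enorm_ge0.
have delD : del <= m%:R * D by apply: le_trans (enorm_le_sum _) (sumD _ dcoord).
have delDel : del <= Del by apply: le_trans delD _; rewrite ler_wpM2l.
have PiD : Pi (torus_mean u) - Pi (torus_mean v) <= Kl * m%:R * D.
  apply: le_trans (ler_norm _) _.
  have meanui i : `|torus_mean u ord0 i| <= \int[mu]_x w x by exact: torus_mean_bound.
  apply: le_trans (KlP _ _ _ _) _.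
  - move=> i; apply: le_trans (meanui i) _; rewrite /MM lerDl.
    by rewrite mulr_ge0.
  - move=> i; have := T4 i; have := meanui i; rewrite !ler_norml /MM.
    move: (torus_mean u _ _) (torus_mean v _ _) (\int[mu]_x w x) (cD * P0) DP0 => a b q r.
    by clear; lra.
  by rewrite -mulrA ler_wpM2l// sumD.
have indL : L1 (\1_E : _ -> R) by exact: indic_integrable.
have wE : \int[mu]_x (\1_E x : R) = e by exact: Rintegral_indic.
have vp : L1 (fun x => enorm (v x) `^ p) := (in_Lp_bounded p0 vper mv vC).2.
have vV0 : \int[mu]_x enorm (v x) `^ p <= V0.
  apply: (@le_trans _ _ (\int[mu]_x (w x `^ p + (C * t) `^ p * \1_E x))).
    apply: le_Rintegral => //.
      exact: (integrable_add up (integrable_scale _ indL)).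
    move=> x _; rewrite indicE; have [_|xE] := boolP (x \in E).
      rewrite mulr1; apply: ler_wpDl; first exact: powR_ge0.
      by apply: ge0_ler_powR; rewrite ?nnegrE ?enorm_ge0 ?(ltW p0).
    have -> : v x = u x.
      by apply: contrapT => uv; move/negP: xE; apply; rewrite inE => /esym.
    by rewrite mulr0 addr0.
  rewrite (RintegralD measurableT up (integrable_scale _ indL)).
  rewrite (RintegralZl _ measurableT indL) wE /V0 lerD2l powRM ?(ltW t00)//.
  rewrite -(mulrA (C `^ p) (t `^ p)); apply: ler_wpM2l => //.
  by apply: le_trans T1 _; rewrite ler_wpM2l.
have GG0 : G <= G0.
  have c1 := integrable_cst_unit mu1 3.
  have c3 := integrable_add vp (integrable_cst_unit mu1 (del `^ p)).
  have c4 := integrable_scale (2 `^ p) c3.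
  rewrite /G (RintegralD measurableT (integrable_add c1 c4) vp).
  rewrite (RintegralD measurableT c1 c4) (RintegralZl _ measurableT c3).
  rewrite (RintegralD measurableT vp (integrable_cst_unit mu1 (del `^ p))).
  rewrite !(Rintegral_cst_unit mu1) /G0 lerD// lerD2l ler_wpM2l ?powR_ge0// lerD//.
  by apply: ge0_ler_powR; rewrite ?nnegrE ?(ltW p0).
have XM : X <= ((nu + alpha) * (C * t) `^ p + c) * e + M * D.
  apply: (le_trans XP).
  have h1 : alpha * (Pi (torus_mean u) - Pi (torus_mean v)) <= alpha * (Kl * m%:R) * D.
    by rewrite -(mulrA alpha) ler_wpM2l.
  have h2 : L * del * G <= L * (m%:R * G0) * D.
    apply: (@le_trans _ _ (L * del * G0)); first by rewrite ler_wpM2l ?mulr_ge0.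
    rewrite (_ : L * (m%:R * G0) * D = L * (m%:R * D) * G0); last by ring.
    by rewrite ler_wpM2r// ler_wpM2l.
  by rewrite /M (mulrDl _ _ D) -addrA lerD2l; exact: lerD.
have EwL : L1 (fun x => \1_E x * w x) := indic_mul_integrable mE uL.
have EwpL : L1 (fun x => \1_E x * w x `^ p) := indic_mul_integrable mE up.
have MEw : M * \int[mu]_x (\1_E x * w x) <= 1 / 2 * X + M2 * e.
  rewrite -wE -(RintegralZl _ measurableT EwL) -(RintegralZl _ measurableT EwpL).
  rewrite -(RintegralZl _ measurableT indL).
  rewrite -(RintegralD measurableT (integrable_scale _ EwpL) (integrable_scale _ indL)).
  apply: le_Rintegral => //.
  - exact: integrable_scale.
  - exact: (integrable_add (integrable_scale _ EwpL) (integrable_scale _ indL)).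
  move=> x _; rewrite indicE; case: (x \in E); last by rewrite !mul0r !mulr0 addr0.
  by rewrite mulr1 (mul1r (w x)) (mul1r (w x `^ p)); exact: young_linear.
have tp1 : N0 <= t `^ (p - 1).
  have p10 : 0 < p - 1 by rewrite subr_gt0.
  have -> : N0 = (N0 `^ (p - 1)^-1) `^ (p - 1).
    by rewrite -powRrM mulVf ?gt_eqF// powRr1.
  by apply: ge0_ler_powR; rewrite ?nnegrE ?(ltW p10) ?(ltW t00) ?powR_ge0.
have tpE : t `^ p = t `^ (p - 1) * t.
  rewrite -[X in _ = _ * X](powRr1 (ltW t00)) -powRD ?subrK//.
  by apply/implyP => _; rewrite gt_eqF.
have CpE : (C * t) `^ p = C `^ p * t `^ p by rewrite powRM// ltW.
have Cp1 : 1 <= C `^ p.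
  by have := @ge0_ler_powR _ p (ltW p0) 1 C; rewrite powR1 !nnegrE; apply.
have low : c + M2 + M * (C * t) <= (nu + alpha) * (C * t) `^ p.
  apply: (@le_trans _ _ (N0 * t)).
    rewrite /N0 (mulrDl (c + M2)) (mulrA M C) lerD2r ler_peMr ?addr_ge0//.
    by rewrite (le_trans _ t2)// ler1n.
  apply: (@le_trans _ _ (t `^ p)); first by rewrite tpE ler_wpM2r// ltW.
  rewrite CpE mulrA ler_peMl ?powR_ge0//.
  by rewrite -[1]mulr1 ler_pM.
(* With r = (nu + alpha) (C t)^p, the bounds [XM], [MEw] and [low] add up to X <= X / 2 + 2 r e,
   whence the factor 4. *)
have Xfin : X <= 4 * ((nu + alpha) * (C * t) `^ p) * e.
  have DE : M * D = M * \int[mu]_x (\1_E x * w x) + M * (C * t) * e.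
    by rewrite /D mulrDr mulrA.
  rewrite DE in XM.
  have := ler_wpM2r e0 low.
  move: XM MEw; move: (M * \int[mu]_x _) => q; move: ((nu + alpha) * _) => r.
  move: (M * (C * t)) => s; clear; lra.
(* Since |v| <= C t everywhere, |u| > C t forces u <> v. *)
apply: (@le_trans _ _ X).
  apply: le_Rintegral => //; first exact: upper_power_integrable mw up _.
  move=> x _; rewrite /upper_power indicE; case: ifPn => [Cw|_]; last first.
    by rewrite mulr_ge0// powR_ge0.
  have -> : x \in E; last by rewrite mul1r.
  rewrite inE /E /= => uv; have := vC x; rewrite -uv leNgt => /negP; exact.
apply: (le_trans Xfin); rewrite CpE tpE.
rewrite (_ : 4 * _ * e = 4 * (nu + alpha) * C `^ p * t `^ (p - 1) * (t * e)); last by ring.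
rewrite (_ : 4 * _ * C `^ p * weak_const n * t `^ (p - 1) * _ =
  4 * (nu + alpha) * C `^ p * t `^ (p - 1) *
  (weak_const n * \int[mu]_x upper_part w (t / 2) x)); last by ring.
apply: ler_wpM2l => //; rewrite !mulr_ge0 ?powR_ge0//.
by apply: le_trans K1.
Qed.

End higher_integrability.

Lemma decay_bounds (R : realType) (p K : R) : 0 < K -> 0 < decay p K < 1.
Proof.
move=> K0; rewrite /decay; have Kp0 : 0 < K * 2 `^ (p - 1) by rewrite mulr_gt0// powR_gt0.
have D0 : 0 < K * 2 `^ (p - 1) + 1 / 2 by lra.
by rewrite divr_gt0//= ltr_pdivrMr// mul1r; lra.
Qed.

Theorem theorem1p3 (R : realType) (n m l : nat) (L p C K : R)
    (p_gt1 : 1 < p) (L_gt0 : 0 < L) :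
  exists2 eps0 : R, 0 < eps0 &
  forall (k : nat) (A : multi_index n k -> 'M[R]_(m, l)), (0 < k)%N ->
  forall (Pi : 'rV[R]_m -> R),
    quasiaffine A Pi ->
    homogeneous_polynomial p Pi ->
    (forall w, `|Pi w| <= enorm w `^ p) ->
  forall alpha nu c : R, 1 < alpha -> 0 < nu -> 0 <= c -> nu + alpha = K ->
  forall f : 'rV[R]_n -> 'rV[R]_m -> R,
    (forall w, Zn_periodic (f ^~ w)) ->
    measurable_integrand f ->
    {ae torus_measure n, forall x, forall w,
      enorm w `^ p - alpha * Pi w <= f x w <= nu * enorm w `^ p + c} ->
    {ae torus_measure n, forall x, forall w w',
      `|f x w - f x w'| <=
      L * (1 + enorm w `^ (p - 1) + enorm w' `^ (p - 1)) * enorm (w - w')} ->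
  truncation_property A p C ->
  forall (u0 : 'rV[R]_m) (u : 'rV[R]_n -> 'rV[R]_m),
    is_minimiser A f u0 p u ->
  forall eps : R, 0 < eps < eps0 -> in_Lp (p + eps)%:E u.
Proof.
(* The exponent is fixed before alpha, nu and the truncation property are available, so positivity
   is enforced by maxima. Later alpha > 1 and nu > 0 give K' = nu + alpha, and the truncation
   property survives enlarging C. *)
pose C' := Num.max C 1; pose K' := Num.max K 1.
pose K1 : R := 4 * K' * C' `^ p * weak_const n.
(* Hole filling compares the tails at t / 2 and at [ratio * t], heights whose quotient is twice the
   ratio. *)
pose b := 2 * ratio p C' K1; pose th := decay p K1.
have C1 : 1 <= C' by rewrite le_max lexx orbT.
have K'0 : 0 < K' by rewrite lt_max ltr01 orbT.
have C'0 : 0 < C' by apply: lt_le_trans C1.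
have K10 : 0 < K1 by rewrite !mulr_gt0 ?powR_gt0 ?weak_const_gt0.
have b1 : 1 < b by have := ratio_ge1 p K1 C1; rewrite /b; lra.
have b0 : 0 < b by apply: lt_trans b1.
have /andP[th0 th1] : 0 < th < 1 := decay_bounds p K10.
have lnb : 0 < ln b by rewrite ln_gt0.
have lnth : 0 < ln th^-1 by rewrite ln_gt0// invf_gt1.
(* The threshold below which b^eps th < 1. *)
exists (ln th^-1 / ln b); first by rewrite divr_gt0.
move=> k A k0 Pi qPi hPi Pip alpha nu c al1 nu0 c0 nuK f fper mf fb fL tp u0 u umin.
move=> eps /andP[eps0 epsb].
have p0 : 0 < p by apply: lt_trans p_gt1.
have [[uper mu ufin] _] := umin.
have up : (torus_measure n).-integrable setT (EFin \o (fun x => enorm (u x) `^ p)).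
  exact/(finite_norm_powR p0 mu).
have K'E : K' = nu + alpha by rewrite /K' -nuK; apply/max_idPl; lra.
have tp' : truncation_property A p C'.
  by apply: truncation_propertyW tp; rewrite le_max lexx.
have [t0 t00 H] : exists2 t0, 0 < t0 & forall t, t0 <= t ->
    \int[torus_measure n]_x upper_power p (fun x => enorm (u x)) (C' * t) x <=
    K1 * t `^ (p - 1) *
      \int[torus_measure n]_x upper_part (fun x => enorm (u x)) (t / 2) x.
  rewrite /K1 K'E; apply: (reverse_hoelder k0 p_gt1 (ltW L_gt0) _ (ltW nu0) _ c0 C1
    qPi (lipschitz_polynomial hPi) Pip mf fb fL tp' umin); lra.
split => //; apply/(finite_norm_powR (addr_gt0 p0 eps0) mu).
have mw := measurable_enorm_comp mu.
have w0 x : 0 <= enorm (u x) by exact: enorm_ge0.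
apply: (@gehring_integrability _ _ _ _ _ _ mw w0 p_gt1 up (t0 / 2) b th) => //.
- by rewrite divr_gt0.
- exact: ltW.
- rewrite -[X in _ < X](mulVf (lt0r_neq0 th0)) ltr_pM2r// /powR gt_eqF//.
  rewrite -[X in _ < X]lnK ?posrE ?invr_gt0// ltr_expR.
  by rewrite -ltr_pdivlMr.
- move=> s ts; rewrite (_ : s = 2 * s / 2); last by rewrite mulrAC divff ?mul1r.
  have ts2 : t0 <= 2 * s by move: ts; rewrite ler_pdivrMr// mulrC.
  rewrite {1}(_ : b * _ = ratio p C' K1 * (2 * s)); last by rewrite /b; field.
  apply: (hole_filling mw w0 p_gt1 up C1 K10); last exact: H.
  exact: lt_le_trans ts2.
Qed.
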